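(* Let $\mathbb{K}$ be a field of characteristic zero, let $n\ge 1$, and let $I=\bigcap_{j=1}^{n}\mathfrak{m}_{p_j}\subset \mathbb{K}[\mathbb{P}^3]$ be the ideal of $n$ points $p_1,\dots,p_n$ in general position in $\mathbb{P}^3$. Then for all $r\ge 1$ $$I^{(3r)}\subset M^{2r}I^{r}.$$
   Context: $\mathbb{K}[\mathbb{P}^3]=\mathbb{K}[x_0,x_1,x_2,x_3]$ is the coordinate ring of $\mathbb{P}^3$ with the standard grading, and $M=(x_0,x_1,x_2,x_3)$ is its maximal homogeneous ideal. For a point $p\in\mathbb{P}^3$, $\mathfrak{m}_p$ is the ideal of forms vanishing at $p$. The $m$-th symbolic power of $I=\bigcap_{j=1}^n\mathfrak{m}_{p_j}$ is $I^{(m)}=\bigcap_{j=1}^n\mathfrak{m}_{p_j}^{m}$. One ideal $I$ of points in general position is fixed, and the containment is asserted for this $I$ for every $r\ge 1$. *)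

(* Defs.v *)
From HB Require Import structures.
From mathcomp Require Import all_boot all_order all_algebra.
From mathcomp Require Export mpoly.
Set Implicit Arguments.
Unset Strict Implicit.
Unset Printing Implicit Defensive.
Import GRing.Theory.
Local Open Scope ring_scope.

(* Ideals are Prop-valued predicates: membership in the ideals considered here
   is not given by a boolean test, so the library's [idealr] does not apply. *)
Section Ideals.
Variable R : comNzRingType.
Implicit Types I J S : R -> Prop.

Definition subideal I J : Prop := forall f, I f -> J f.

Definition ideal_gen S : R -> Prop := fun f =>
  exists s : seq (R * R),
    (forall cg, cg \in s -> S cg.2) /\ f = \sum_(cg <- s) cg.1 * cg.2.

Definition ideal_mul I J : R -> Prop := fun f =>
  exists s : seq (R * R),
    (forall ab, ab \in s -> I ab.1 /\ J ab.2) /\ f = \sum_(ab <- s) ab.1 * ab.2.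

Fixpoint ideal_pow I (k : nat) : R -> Prop :=
  if k is k'.+1 then ideal_mul I (ideal_pow I k') else fun _ => True.

Definition ideal_bigcap (T : Type) (F : T -> R -> Prop) : R -> Prop :=
  fun f => forall t, F t f.

End Ideals.

(* A point of P^N(K) is given by homogeneous coordinates, a nonzero vector of
   K^(N+1).  Every notion below is invariant under rescaling them. *)
Definition proj_point (K : fieldType) (N : nat) : Type :=
  {v : 'rV[K]_N.+1 | v != 0}.

Section ProjectiveSpace.
Variables (K : fieldType) (N : nat).

Definition irrelevant_ideal : {mpoly K[N.+1]} -> Prop :=
  ideal_gen (fun f => exists i : 'I_N.+1, f = 'X_i).

Definition form_vanishing_at (p : proj_point K N) (f : {mpoly K[N.+1]}) : Prop :=
  (exists d : nat, f \is d.-homog) /\ f.@[fun i => val p 0 i] = 0.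

Definition point_ideal (p : proj_point K N) : {mpoly K[N.+1]} -> Prop :=
  ideal_gen (form_vanishing_at p).

Definition points_ideal n (p : 'I_n -> proj_point K N) :
    {mpoly K[N.+1]} -> Prop :=
  ideal_bigcap (fun j => point_ideal (p j)).

Definition symbolic_power n (p : 'I_n -> proj_point K N) (m : nat) :
    {mpoly K[N.+1]} -> Prop :=
  ideal_bigcap (fun j => ideal_pow (point_ideal (p j)) m).

(* The variable of index [mxvec_index j i] is the i-th homogeneous coordinate
   on the j-th factor of (P^N)^n. *)
Definition multihomogeneous n (F : {mpoly K[n * N.+1]}) : Prop :=
  exists d : 'I_n -> nat, forall m, m \in msupp F ->
    forall j, (\sum_(i < N.+1) m (mxvec_index j i))%N = d j.

Definition meval_points n (F : {mpoly K[n * N.+1]}) (p : 'I_n -> proj_point K N) : K :=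
  F.@[fun k => mxvec (\matrix_(j < n, i < N.+1) val (p j) 0 i) 0 k].

(* [U] is the complement in (P^N)^n of the common zero locus of a set [S] of
   multihomogeneous polynomials. *)
Definition zariski_open n (U : ('I_n -> proj_point K N) -> Prop) : Prop :=
  exists S : {mpoly K[n * N.+1]} -> Prop,
    (forall F, S F -> multihomogeneous F) /\
    (forall p, U p <-> exists F, S F /\ meval_points F p <> 0).

(* [P] holds for n points in general position: it holds on a nonempty
   Zariski-open subset of (P^N)^n. *)
Definition in_general_position n (P : ('I_n -> proj_point K N) -> Prop) : Prop :=
  exists U : ('I_n -> proj_point K N) -> Prop,
    [/\ zariski_open U, exists p, U p & forall p, U p -> P p].

End ProjectiveSpace.

(* Main.v *)
(* Work in the chart [x_0 = 1].  Let [t] be such that polynomials of degree [t]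
   interpolate at the points.  Then every polynomial of degree
   [r (t + 1) + E] vanishing to order [r] at the points is a sum of products of
   [r] elements of [I] of degree [t + 1] and one polynomial of degree [E], so a
   form of degree [D >= r (t + 3)] in [I^(3r)] lies in [M^(2r) I^r].  If
   moreover the forms of degree [t + 1] in [I] are generated by those of degree
   [t], then [D >= r (t + 2)] is enough; this happens for one or two points more
   than there are monomials of degree [t - 1].
   The lower bounds on [D] come from special configurations of [N <= n] points
   whose jets of order [s] are realized in degree about [beta s]: intersecting
   with two polynomials of that degree gives [N m <= beta^2 D] when the order is
   [m].  The configurations are grids and, for [13 <= n <= 20], thirteen points
   with [beta = 5/2].  The inequality [N / beta^2 > (t + 3) / 3] being strict, a
   single large [s] serves for all [r], so that the open set of configurations
   is independent of [r].
   At most four points can be taken to be coordinate points, where all the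
   ideals are spanned by monomials. *)
Require Import Defs.
From mathcomp Require Import all_boot all_order all_algebra.
From mathcomp Require Import ring zify.
Set Implicit Arguments.
Unset Strict Implicit.
Unset Printing Implicit Defensive.
Import GRing.Theory.
Local Open Scope ring_scope.

(** * Orders of vanishing and degrees *)

(** A full grid of side [b] gives [N / beta^2 = b], roughly the cube root of [n], against a
    threshold near [t / 3]; so only small [n] are tight. For [t = 3] the threshold is exactly 2. The
    grid of eight points gives [8 / 4 = 2] without slack, and a grid of side 3 would need at least
    19 points. This gap is filled by the sharper containment for 11 and 12 points and by the
    thirteen points, where [13 / (5/2)^2 = 52/25]. The slope 5/2 passes through the dimensions.
    Planes of total degree five in space, then curves of total degree five in each plane, cover
    every point at least twice; peeling them off lowers the order by two at the cost of degree five.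
    A conic with five points has the same slope, since [5 s] conditions meet a linear system of
    degree [2 d]. Special configurations say something about general ones because surjectivity onto
    jets is maximal rank of a matrix that is polynomial in the coordinates. Bezout's inequality is
    obtained by comparing dimensions of spaces of polynomials and of jets in large degree. *)

Notation translate a :=
  (comp_mpoly [tuple 'X_i + (a i)%:MP | i < _]).

Lemma comp_mpoly_sum (R : comNzRingType) (m k : nat) (lq : m.-tuple {mpoly R[k]})
    (I : Type) (r : seq I) (P : pred I) (F : I -> {mpoly R[m]}) :
  comp_mpoly lq (\sum_(i <- r | P i) F i) =
  \sum_(i <- r | P i) comp_mpoly lq (F i).
Proof. exact: (raddf_sum (comp_mpoly lq)). Qed.

Section Orders.
Variables (K : fieldType) (k : nat).
Local Notation poly := {mpoly K[k]}.
Implicit Types (p q : poly) (a : 'I_k -> K) (u : 'X_{1..k}).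

Definition low_order (m : nat) p : Prop :=
  forall u, (mdeg u < m)%N -> p@_u = 0.

Lemma low_order0 m : low_order m 0.
Proof. by move=> u _; rewrite mcoeff0. Qed.

Lemma low_orderD m p q : low_order m p -> low_order m q -> low_order m (p + q).
Proof. by move=> Hp Hq u hu; rewrite mcoeffD Hp ?Hq ?addr0. Qed.

Lemma low_orderB m p q : low_order m p -> low_order m q -> low_order m (p - q).
Proof. by move=> Hp Hq u hu; rewrite mcoeffB Hp ?Hq ?subr0. Qed.

Lemma low_orderW m m' p : (m <= m')%N -> low_order m' p -> low_order m p.
Proof. by move=> le_mm' Hp u hu; apply: Hp; apply: leq_trans le_mm'. Qed.

Lemma low_orderM m m' p q :
  low_order m p -> low_order m' q -> low_order (m + m') (p * q).
Proof.
move=> Hp Hq u hu; rewrite mcoeffM big1 // => -[u1 u2] /= /eqP eu.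
have: (mdeg u1 < m)%N || (mdeg u2 < m')%N.
  by have := congr1 mdeg eu; rewrite mdegD; lia.
by case/orP => h; rewrite ?(Hp _ h) ?(Hq _ h) ?mul0r ?mulr0.
Qed.

Lemma low_order_msupp m p :
  low_order m p <-> forall u, u \in msupp p -> (m <= mdeg u)%N.
Proof.
split=> H u; first by rewrite mcoeff_msupp leqNgt; apply: contraNN => /H ->.
by move=> hu; apply/memN_msupp_eq0/negP => /H; rewrite leqNgt hu.
Qed.

Definition ord_ge a (m : nat) p : Prop := low_order m (translate a p).

Lemma ord_ge0 a m : ord_ge a m 0.
Proof. by rewrite /ord_ge raddf0; apply: low_order0. Qed.

Lemma ord_ge_triv a p : ord_ge a 0 p.
Proof. by []. Qed.

Lemma ord_geD a m p q : ord_ge a m p -> ord_ge a m q -> ord_ge a m (p + q).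
Proof. by rewrite /ord_ge raddfD; apply: low_orderD. Qed.

Lemma ord_geB a m p q : ord_ge a m p -> ord_ge a m q -> ord_ge a m (p - q).
Proof. by rewrite /ord_ge raddfB; apply: low_orderB. Qed.

Lemma ord_geW a m m' p : (m <= m')%N -> ord_ge a m' p -> ord_ge a m p.
Proof. exact: low_orderW. Qed.

Lemma ord_geM a m m' p q :
  ord_ge a m p -> ord_ge a m' q -> ord_ge a (m + m') (p * q).
Proof. by rewrite /ord_ge rmorphM; apply: low_orderM. Qed.

Lemma ord_geMl a m p q : ord_ge a m p -> ord_ge a m (p * q).
Proof. by move=> Hp; rewrite -[m]addn0; apply: ord_geM. Qed.

Lemma ord_geMr a m p q : ord_ge a m q -> ord_ge a m (p * q).
Proof. by rewrite mulrC; apply: ord_geMl. Qed.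

Lemma ord_geZ a m c p : ord_ge a m p -> ord_ge a m (c *: p).
Proof. by rewrite -mul_mpolyC; apply: ord_geMr. Qed.

Lemma ord_ge_exp a m p e : ord_ge a m p -> ord_ge a (m * e) (p ^+ e).
Proof.
move=> Hp; elim: e => [|e IH]; first by rewrite muln0.
by rewrite exprS mulnS; apply: ord_geM.
Qed.

Lemma ord_ge_sum a m (I : Type) (r : seq I) (P : pred I) (F : I -> poly) :
  (forall i, P i -> ord_ge a m (F i)) -> ord_ge a m (\sum_(i <- r | P i) F i).
Proof.
by move=> H; elim/big_ind: _ => //; [exact: ord_ge0 | exact: ord_geD].
Qed.

Lemma ord_ge_prod a (I : Type) (r : seq I) (P : pred I) (F : I -> poly)
    (w : I -> nat) :
  (forall i, P i -> ord_ge a (w i) (F i)) ->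
  ord_ge a (\sum_(i <- r | P i) w i)%N (\prod_(i <- r | P i) F i).
Proof.
by move=> H; elim/big_ind2: _ => //= m p m' q; apply: ord_geM.
Qed.

Lemma ord_ge_prod1 a (I : finType) (P : pred I) (F : I -> poly) i m :
  P i -> ord_ge a m (F i) -> ord_ge a m (\prod_(j | P j) F j).
Proof. by move=> Pi Hi; rewrite (bigD1 i) //=; apply: ord_geMl. Qed.

Lemma mcoeff_meval0 p : p@_0 = p.@[fun=> 0].
Proof.
rewrite mevalE; case: (boolP (0%MM \in msupp p)) => [h|h].
  rewrite (bigD1_seq 0%MM) ?msupp_uniq //= big1 ?mulr1 => [|i _].
    rewrite big1 ?addr0 // => u nz_u.
    have [i hi]: exists i, u i != 0%N.
      apply/existsP; rewrite -negb_forall; apply: contraNN nz_u => /forallP h0.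
      by apply/eqP/mnmP => i; rewrite mnm0E; apply/eqP/h0.
    by rewrite (bigD1 i) //= expr0n (negPf hi) mul0r mulr0.
  by rewrite mnm0E expr0.
rewrite (memN_msupp_eq0 h) big_seq big1 // => u hu.
have [i hi]: exists i, u i != 0%N.
  apply/existsP; rewrite -negb_forall; apply: contraNN h => /forallP h0.
  by rewrite (_ : 0%MM = u) //; apply/mnmP => i; rewrite mnm0E; apply/esym/eqP/h0.
by rewrite (bigD1 i) //= expr0n (negPf hi) mul0r mulr0.
Qed.

Lemma translate_meval a p v :
  (translate a p).@[v] = p.@[fun i => v i + a i].
Proof.
rewrite comp_mpoly_meval; apply: meval_eq => i.
by rewrite tnth_mktuple mevalD mevalXU mevalC.
Qed.

Lemma ord_ge1 a p : ord_ge a 1 p <-> p.@[a] = 0.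
Proof.
have E: (translate a p)@_0 = p.@[a].
  by rewrite mcoeff_meval0 translate_meval; apply: meval_eq => i; rewrite add0r.
split=> [H|H u]; first by rewrite -E; apply: H; rewrite mdeg0.
by rewrite ltnS leqn0 mdeg_eq0 => /eqP ->; rewrite E.
Qed.

Lemma translateX a i : translate a 'X_i = 'X_i + (a i)%:MP.
Proof. by rewrite comp_mpolyXU -tnth_nth tnth_mktuple. Qed.

Lemma translateK a p : translate (fun i => - a i) (translate a p) = p.
Proof.
elim/mpolyind: p => [|c u p _ _ IH]; first by rewrite !raddf0.
rewrite !raddfD /= IH; congr (_ + _).
rewrite mpolyXE_id !comp_mpolyZ !rmorph_prod /=; congr (_ *: _).
apply: eq_bigr => i _; rewrite !rmorphXn /= translateX raddfD /= translateX.
by rewrite comp_mpolyC mpolyCN addrNK.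
Qed.

Lemma translateKV a p : translate a (translate (fun i => - a i) p) = p.
Proof.
rewrite -[RHS](translateK (fun i => - a i)).
congr (comp_mpoly _ _); apply: eq_from_tnth => i.
by rewrite !tnth_mktuple opprK.
Qed.

Lemma meval_sum v (I : Type) (r : seq I) (P : pred I) (F : I -> poly) :
  (\sum_(i <- r | P i) F i).@[v] = \sum_(i <- r | P i) (F i).@[v].
Proof. exact: (raddf_sum (meval v)). Qed.

Lemma mpoly_sumB (I : Type) (r : seq I) (P : pred I) (F G : I -> poly) :
  \sum_(i <- r | P i) F i - \sum_(i <- r | P i) G i
    = \sum_(i <- r | P i) (F i - G i).
Proof. by rewrite -sumrN -big_split. Qed.

Lemma ord_ge_subX a i : ord_ge a 1 ('X_i - (a i)%:MP).
Proof. by apply/ord_ge1; rewrite mevalB mevalXU mevalC subrr. Qed.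

Lemma ord_ge_monom a u :
  ord_ge a (mdeg u) (\prod_i ('X_i - (a i)%:MP) ^+ u i).
Proof.
rewrite mdegE; apply: ord_ge_prod => i _.
by have := ord_ge_exp (e := u i) (ord_ge_subX a i); rewrite mul1n.
Qed.

(* Truncated geometric series in [1 - p / p(a)]. *)
Lemma ord_ge_inv a m p : p.@[a] != 0 -> exists q, ord_ge a m (1 - p * q).
Proof.
move=> nz; set c := p.@[a]; pose z := 1 - c^-1 *: p.
have hz : ord_ge a 1 z.
  by apply/ord_ge1; rewrite mevalB mevalZ meval1 mulVf ?subrr.
exists (c^-1 *: \sum_(i < m) z ^+ i).
have -> : 1 - p * (c^-1 *: \sum_(i < m) z ^+ i) = z ^+ m.
  have: (1 - z) * \sum_(i < m) z ^+ i = 1 - z ^+ m.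
    by rewrite -[X in _ = X - _](expr1n _ m) subrXX; congr (_ * _);
       apply: eq_bigr => i _; rewrite expr1n mul1r.
  rewrite /z opprB addrCA subrr addr0 -/z -scalerAl => h.
  by rewrite -scalerAr h opprB addrCA subrr addr0.
by have := ord_ge_exp (e := m) hz; rewrite mul1n.
Qed.

Definition deg_le (d : nat) p : Prop := (msize p <= d.+1)%N.

Lemma deg_leW d e p : (d <= e)%N -> deg_le d p -> deg_le e p.
Proof. by rewrite /deg_le => h1 h2; lia. Qed.

Lemma deg_le0 d : deg_le d 0.
Proof. by rewrite /deg_le msize0. Qed.

Lemma deg_leD d p q : deg_le d p -> deg_le d q -> deg_le d (p + q).
Proof. by rewrite /deg_le => h1 h2; apply: leq_trans (msizeD_le _ _) _; lia. Qed.

Lemma deg_leN d p : deg_le d p -> deg_le d (- p).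
Proof. by rewrite /deg_le msizeN. Qed.

Lemma deg_leB d p q : deg_le d p -> deg_le d q -> deg_le d (p - q).
Proof. by move=> h1 h2; apply: deg_leD => //; apply: deg_leN. Qed.

Lemma deg_leZ d c p : deg_le d p -> deg_le d (c *: p).
Proof. by apply: leq_trans; apply: msizeZ_le. Qed.

Lemma deg_leM d e p q : deg_le d p -> deg_le e q -> deg_le (d + e) (p * q).
Proof.
move=> h1 h2.
have [->|nzp] := eqVneq p 0; first by rewrite mul0r; apply: deg_le0.
have [->|nzq] := eqVneq q 0; first by rewrite mulr0; apply: deg_le0.
rewrite /deg_le msizeM //; move: h1 h2; rewrite /deg_le.
by move: (msize p) (msize q) => x y; lia.
Qed.

Lemma deg_leC d c : deg_le d c%:MP.
Proof. by rewrite /deg_le msizeC; case: (c != 0). Qed.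

Lemma deg_le1 d : deg_le d 1.
Proof. by rewrite /deg_le msize1. Qed.

Lemma deg_leX (u : 'X_{1..k}) : deg_le (mdeg u) 'X_[u].
Proof. by rewrite /deg_le msizeX. Qed.

Lemma deg_leXi i : deg_le 1 'X_i.
Proof. by have := deg_leX U_(i); rewrite mdeg1. Qed.

Lemma deg_le_exp d p e : deg_le d p -> deg_le (d * e) (p ^+ e).
Proof.
move=> Hp; elim: e => [|e IH]; first exact: deg_le1.
by rewrite exprS mulnS; apply: deg_leM.
Qed.

Lemma deg_le_sum d (I : Type) (r : seq I) (P : pred I) (F : I -> poly) :
  (forall i, P i -> deg_le d (F i)) -> deg_le d (\sum_(i <- r | P i) F i).
Proof.
by move=> H; elim/big_ind: _ => //; [exact: deg_le0 | exact: deg_leD].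
Qed.

Lemma deg_le_prod (I : Type) (r : seq I) (P : pred I) (F : I -> poly)
    (w : I -> nat) :
  (forall i, P i -> deg_le (w i) (F i)) ->
  deg_le (\sum_(i <- r | P i) w i)%N (\prod_(i <- r | P i) F i).
Proof.
move=> H; elim/big_ind2: _ => //= [|m p m' q]; first exact: deg_le1.
exact: deg_leM.
Qed.

Lemma deg_le_msupp d p :
  deg_le d p <-> forall u, u \in msupp p -> (mdeg u <= d)%N.
Proof.
split=> [H u /msize_mdeg_lt hu|H]; first by rewrite -ltnS; apply: leq_trans H.
by rewrite /deg_le msizeE; apply/bigmax_leqP_seq => u hu _; apply: H.
Qed.

Lemma deg_le_translate d a p : deg_le d p -> deg_le d (translate a p).
Proof.
move/deg_le_msupp => H; rewrite [p]mpolyE raddf_sum /= big_seq.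
apply: deg_le_sum => u hu; rewrite comp_mpolyZ; apply: deg_leZ.
apply: deg_leW (H u hu) _; rewrite mdegE mpolyXE_id rmorph_prod /=.
apply: deg_le_prod => i _; rewrite rmorphXn /= translateX.
have h : deg_le 1 ('X_i + (a i)%:MP).
  by apply: deg_leD; [exact: deg_leXi | exact: deg_leC].
by have := deg_le_exp (u i) h; rewrite mul1n.
Qed.

End Orders.

(** * Products of polynomials vanishing at the points *)

Section Powers.
Variables (K : fieldType) (k : nat).
Local Notation poly := {mpoly K[k]}.

(** The bound [E] concerns only the cofactor left after [r] factors from [I]. If [I] consists of
    polynomials of degree at most [t.+1], the whole has degree at most [r * t.+1 + E], and the
    cofactor later becomes a power of the irrelevant ideal. *)
Inductive powspan (I : poly -> Prop) (E : nat) : nat -> poly -> Prop :=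
| powspan_base g : deg_le E g -> powspan I E 0 g
| powspan_mul r u w : I u -> powspan I E r w -> powspan I E r.+1 (u * w)
| powspan_zero r : powspan I E r 0
| powspan_add r v w :
    powspan I E r v -> powspan I E r w -> powspan I E r (v + w).

Variable I : poly -> Prop.

Lemma powspanW E E' r f : (E <= E')%N -> powspan I E r f -> powspan I E' r f.
Proof.
move=> le_E; elim=> {r f} [g Hg|r u w Iu _|r|r v w _ Hv _ Hw].
- by apply: powspan_base; apply: deg_leW Hg.
- exact: powspan_mul.
- exact: powspan_zero.
- exact: powspan_add.
Qed.

Lemma powspan_polyM E e r f g :
  deg_le e g -> powspan I E r f -> powspan I (E + e) r (g * f).
Proof.
move=> Hg; elim=> {r f} [h Hh|r u w Iu _ IH|r|r v w _ Hv _ Hw].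
- by apply: powspan_base; rewrite addnC; apply: deg_leM.
- by rewrite mulrCA; apply: powspan_mul.
- by rewrite mulr0; apply: powspan_zero.
- by rewrite mulrDr; apply: powspan_add.
Qed.

Lemma powspanZ E r c f : powspan I E r f -> powspan I E r (c *: f).
Proof.
by move=> H; rewrite -mul_mpolyC -[E]addn0; apply: powspan_polyM => //; apply: deg_leC.
Qed.

Lemma powspanB E r f g :
  powspan I E r f -> powspan I E r g -> powspan I E r (f - g).
Proof. by move=> Hf Hg; apply: powspan_add => //; rewrite -scaleN1r; apply: powspanZ. Qed.

Lemma powspan_sum E r (T : Type) (s : seq T) (P : pred T) (F : T -> poly) :
  (forall i, P i -> powspan I E r (F i)) ->
  powspan I E r (\sum_(i <- s | P i) F i).
Proof.
by move=> H; elim/big_ind: _ => //; [exact: powspan_zero | exact: powspan_add].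
Qed.

Lemma powspanM E E' r r' f g :
  powspan I E r f -> powspan I E' r' g -> powspan I (E + E') (r + r') (f * g).
Proof.
move=> Hf Hg; elim: Hf => {r f} [h Hh|r u w Iu _ IH|r|r v w _ Hv _ Hw].
- by rewrite addnC; apply: powspan_polyM.
- by rewrite -mulrA addSn; apply: powspan_mul.
- by rewrite mul0r; apply: powspan_zero.
- by rewrite mulrDl; apply: powspan_add.
Qed.

Lemma powspan1 f : I f -> powspan I 0 1 f.
Proof.
by move=> If; rewrite -[f]mulr1; apply: powspan_mul => //; apply: powspan_base; apply: deg_le1.
Qed.

Lemma powspan_exp r f : I f -> powspan I 0 r (f ^+ r).
Proof.
move=> If; elim: r => [|r IH]; first by apply: powspan_base; apply: deg_le1.
by rewrite exprS; apply: powspan_mul.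
Qed.

Lemma powspan_prod (T : Type) (s : seq T) (P : pred T) (F : T -> poly) w :
  (forall i, P i -> powspan I 0 (w i) (F i)) ->
  powspan I 0 (\sum_(i <- s | P i) w i)%N (\prod_(i <- s | P i) F i).
Proof.
move=> H; elim/big_ind2: _ => //.
  by apply: powspan_base; apply: deg_le1.
by move=> x f y g Hf Hg; rewrite -[0%N]addn0; apply: powspanM.
Qed.

Lemma powspan_ord a E r f :
  (forall u, I u -> ord_ge a 1 u) -> powspan I E r f -> ord_ge a r f.
Proof.
move=> HI; elim=> {r f} [g _|r u w Iu _ IH|r|r v w _ Hv _ Hw] //.
- by rewrite -add1n; apply: ord_geM => //; apply: HI.
- exact: ord_ge0.
- exact: ord_geD.
Qed.

End Powers.

(** * Leading forms, and splitting off a linear factor *)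

Section Linear.
Variables (K : fieldType) (k : nat).
Local Notation poly := {mpoly K[k]}.

(** Every monomial present has positive degree, so a variable can be taken out of it; order and
    degree drop together. *)
Lemma low_order_split m d (p : poly) :
  low_order m.+1 p -> deg_le d.+1 p ->
  exists g : 'I_k -> poly, p = \sum_i 'X_i * g i /\
    forall i, low_order m (g i) /\ deg_le d (g i).
Proof.
move=> /low_order_msupp Hm /deg_le_msupp Hd.
rewrite [p]mpolyE big_seq.
elim/big_ind: _ => [|_ _ [g1 [-> h1]] [g2 [-> h2]]|u hu].
- exists (fun=> 0); split=> [|i]; last by split; [exact: low_order0|exact: deg_le0].
  by rewrite big1 // => i _; rewrite mulr0.
- exists (fun i => g1 i + g2 i); split=> [|i].
    by rewrite -big_split; apply: eq_bigr => i _; rewrite mulrDr.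
  have [l1 d1] := h1 i; have [l2 d2] := h2 i.
  by split; [exact: low_orderD|exact: deg_leD].
- have nz_u : u != 0%MM by rewrite -mdeg_eq0 -lt0n; apply: leq_trans (Hm u hu).
  have [i hi]: exists i, u i != 0%N.
    apply/existsP; rewrite -negb_forall; apply: contraNN nz_u => /forallP h0.
    by apply/eqP/mnmP => i; rewrite mnm0E; apply/eqP/h0.
  have lei : (U_(i) <= u)%MM by rewrite lep1mP.
  have eu : (u = U_(i) + (u - U_(i)))%MM by rewrite addmC submK.
  have ed : mdeg u = (mdeg (u - U_(i))).+1 by rewrite {1}eu mdegD mdeg1.
  exists (fun j => if j == i then p@_u *: 'X_[u - U_(i)] else 0).
  split=> [|j].
    rewrite (bigD1 i) //= eqxx big1 ?addr0 => [|j /negPf ->]; last by rewrite mulr0.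
    by rewrite -scalerAr -mpolyXD -eu.
  case: eqP => _; last by split; [exact: low_order0|exact: deg_le0].
  split; last first.
    by apply: deg_leZ; apply: deg_leW (deg_leX _ _); rewrite -ltnS -ed; apply: Hd.
  apply/low_order_msupp => v /msuppZ_le /mem_msuppXP <-.
  by rewrite -ltnS -ed; apply: Hm.
Qed.

Lemma ord_ge_split a m d (p : poly) :
  ord_ge a m.+1 p -> deg_le d.+1 p ->
  exists g : 'I_k -> poly, p = \sum_i ('X_i - (a i)%:MP) * g i /\
    forall i, ord_ge a m (g i) /\ deg_le d (g i).
Proof.
move=> Hm Hd; have [g [Eg Hg]] := low_order_split Hm (deg_le_translate a Hd).
exists (fun i => translate (fun j => - a j) (g i)); split=> [|i].
  rewrite -[LHS](translateK a) Eg raddf_sum /=; apply: eq_bigr => i _.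
  by rewrite rmorphM /= translateX mpolyCN.
have [h1 h2] := Hg i; rewrite /ord_ge translateKV; split=> //.
exact: deg_le_translate.
Qed.

Lemma low_order_homog r (p : poly) : p \is r.-homog -> low_order r p.
Proof. by move=> /dhomogP H; apply/low_order_msupp => u /H <-. Qed.

Lemma homog_low_order_eq0 r (p : poly) :
  p \is r.-homog -> low_order r.+1 p -> p = 0.
Proof.
move=> H1 H2; apply/mpolyP => u; rewrite mcoeff0.
have [h|h] := eqVneq (mdeg u) r; first by apply: H2; rewrite h.
exact: dhomog_nemf_coeff H1 h.
Qed.

Lemma mcoeff_pihomog m (p : poly) u :
  (pihomog mdeg m p)@_u = if mdeg u == m then p@_u else 0.
Proof.
elim/mpolyind: p => [|c v p _ _ IH]; first by rewrite pihomog0 mcoeff0 if_same.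
rewrite linearP /= !mcoeffD !mcoeffZ IH pihomogX mcoeffX.
have [<-|ne] := eqVneq v u.
  by case: eqP => _; rewrite ?mcoeffX ?eqxx ?mcoeff0 ?mulr0 ?addr0.
case: (mdeg v == m); rewrite ?mcoeffX ?(negPf ne) ?mcoeff0 mulr0 add0r;
by case: (mdeg u == m); rewrite ?add0r ?addr0.
Qed.

Lemma low_order_leading m (p : poly) :
  low_order m p -> low_order m.+1 (p - pihomog mdeg m p).
Proof.
move=> H u hu; rewrite mcoeffB mcoeff_pihomog.
case: eqP => [|ne]; first by rewrite subrr.
by rewrite subr0 H // ltn_neqAle -ltnS hu andbT; apply/eqP.
Qed.

End Linear.

(** * Symbolic powers against ordinary powers in large degree *)

Section Interpolation.
Variables (K : fieldType) (k n t : nat).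
Local Notation poly := {mpoly K[k]}.
Variables (a : 'I_n -> 'I_k -> K) (e : 'I_n -> poly).
Hypothesis deg_e : forall j, deg_le t (e j).
Hypothesis eval_e : forall i j, (e i).@[a j] = (i == j)%:R.

Definition vanishing_in (d : nat) (u : poly) : Prop :=
  deg_le d u /\ forall j, u.@[a j] = 0.

Local Notation I := (vanishing_in t.+1).

Lemma vanishing_ord j u : I u -> ord_ge (a j) 1 u.
Proof. by case=> _ H; apply/ord_ge1. Qed.

Lemma vanishingM j (y : poly) :
  deg_le 1 y -> y.@[a j] = 0 -> I (e j * y).
Proof.
move=> Hd Hy; split=> [|i]; first by rewrite -addn1; apply: deg_leM.
rewrite mevalM eval_e; case: eqP => [<-|_]; first by rewrite Hy mulr0.
by rewrite mul0r.
Qed.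

Lemma deg_le_lin (b : 'I_k -> K) i : deg_le 1 ('X_i - (b i)%:MP).
Proof. by apply: deg_leB; [exact: deg_leXi | exact: deg_leC]. Qed.

(** Multiplication by a variable preserves the span of the [e j] up to elements of [I], because
    [e j * ('X_i - a j i)] lies in [I]. Hence a higher degree of [g] costs nothing but a larger
    cofactor. *)
Lemma powspan_interp E g : deg_le (t.+1 + E) g ->
  exists c : 'I_n -> K, powspan I E 1 (g - \sum_j c j *: e j).
Proof.
elim: E g => [|E IH] g Hg.
  exists (fun j => g.@[a j]); apply: powspan1; split=> [|i].
    apply: deg_leB; first by rewrite -[t.+1]addn0.
    by apply: deg_le_sum => j _; apply: deg_leZ; apply: deg_leW (deg_e j).
  rewrite mevalB meval_sum /= (bigD1 i) //= mevalZ eval_e eqxx mulr1.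
  rewrite big1 ?addr0 ?subrr // => j /negPf ne.
  by rewrite mevalZ eval_e ne mulr0.
move/deg_le_msupp: Hg => Hg; rewrite [g]mpolyE big_seq.
elim/big_ind: _ => [|g1 g2 [c1 h1] [c2 h2]|u hu].
- exists (fun=> 0); rewrite big1 ?subr0 => [|j _]; last by rewrite scale0r.
  exact: powspan_zero.
- exists (fun j => c1 j + c2 j).
  rewrite (_ : _ - _ = (g1 - \sum_j c1 j *: e j) + (g2 - \sum_j c2 j *: e j)).
    exact: powspan_add.
  rewrite [X in _ - X](_ : _ = \sum_j c1 j *: e j + \sum_j c2 j *: e j).
    by ring.
  by rewrite -big_split; apply: eq_bigr => j _; rewrite scalerDl.
suff [c Hc]: exists c : 'I_n -> K, powspan I E.+1 1 ('X_[u] - \sum_j c j *: e j).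
  exists (fun j => g@_u * c j).
  rewrite (_ : _ - _ = g@_u *: ('X_[u] - \sum_j c j *: e j)).
    exact: powspanZ.
  rewrite scalerBr; congr (_ - _); rewrite scaler_sumr; apply: eq_bigr => j _.
  by rewrite scalerA.
have [le_u|lt_u] := leqP (mdeg u) (t.+1 + E).
  have [|c Hc] := IH 'X_[u]; first by apply: deg_leW le_u (deg_leX _ _).
  by exists c; apply: powspanW Hc.
have [i hi]: exists i, u i != 0%N.
  apply/existsP; rewrite -negb_forall; apply/negP => /forallP h0.
  move: lt_u; rewrite mdegE big1 // => i _; exact/eqP/h0.
have lei : (U_(i) <= u)%MM by rewrite lep1mP.
have eu : (u = U_(i) + (u - U_(i)))%MM by rewrite addmC submK.
have ed : mdeg u = (mdeg (u - U_(i))).+1 by rewrite {1}eu mdegD mdeg1.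
have [|c Hc] := IH 'X_[u - U_(i)].
  apply: deg_leW (deg_leX _ _); rewrite -ltnS -ed.
  by have := Hg u hu; rewrite addnS.
exists (fun j => c j * a j i).
rewrite {1}eu mpolyXD.
rewrite (_ : _ - _ = 'X_i * ('X_[u - U_(i)] - \sum_j c j *: e j)
          + \sum_j c j *: (e j * ('X_i - (a j i)%:MP))); last first.
  rewrite mulrBr -addrA; congr (_ + _).
  rewrite mulr_sumr -sumrN -sumrN -big_split; apply: eq_bigr => j _ /=.
  rewrite mulrBr scalerBr -scalerAr [e j * 'X_i]mulrC addrA addNr add0r.
  by rewrite [e j * _]mulrC mul_mpolyC scalerA.
apply: powspan_add.
  by have := powspan_polyM (deg_leXi K i) Hc; rewrite addn1.
apply: powspan_sum => j _; apply: powspanZ; apply: (@powspanW _ _ _ 0) => //.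
apply: powspan1; apply: vanishingM; first exact: deg_le_lin.
by rewrite mevalB mevalXU mevalC subrr.
Qed.

(* For [i != j] an affine function [l] with [l (a i) = 0] and [l (a j) = 1]
   gives [e i * e j * v = (e i * l) * (e j * v) + (e i * v) * (e j * (1 - l))]. *)
Lemma powspan_second j u :
  I u -> ord_ge (a j) 2 u -> powspan I 0 2 (e j * u).
Proof.
move=> [Hd Hv] Ho; have [g [Eg Hg]] := ord_ge_split Ho Hd.
pose y i : poly := 'X_i - (a j i)%:MP.
(* The affine function [v i] vanishes at [a j], as each [y c] does, and at [a i], where its value is
   that of [u]. It collects what is lost when the [g c] are replaced by the [b c], which vanish at
   all the points. *)
pose v i : poly := \sum_c (g c).@[a i] *: y c.
pose b c : poly := g c - \sum_i (g c).@[a i] *: e i.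
have Ib c : I (b c).
  split=> [|i].
    apply: deg_leB; first by apply: deg_leW (proj2 (Hg c)).
    by apply: deg_le_sum => i _; apply: deg_leZ; apply: deg_leW (deg_e i).
  rewrite mevalB meval_sum /= (bigD1 i) //= mevalZ eval_e eqxx mulr1.
  rewrite big1 ?addr0 ?subrr // => i' /negPf ne.
  by rewrite mevalZ eval_e ne mulr0.
have yj c : (y c).@[a j] = 0 by rewrite mevalB mevalXU mevalC subrr.
have vj i : (v i).@[a j] = 0.
  by rewrite meval_sum big1 //= => c _; rewrite mevalZ yj mulr0.
have vi i : (v i).@[a i] = 0.
  rewrite -(Hv i) Eg !meval_sum /=; apply: eq_bigr => c _.
  by rewrite mevalM mevalZ mulrC.
have dv i : deg_le 1 (v i).
  by apply: deg_le_sum => c _; apply: deg_leZ; apply: deg_le_lin.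
have gj c : (g c).@[a j] = 0 by apply/ord_ge1; case: (Hg c).
have -> : e j * u = \sum_c (e j * y c) * b c + \sum_(i | i != j) e i * (e j * v i).
  have -> : \sum_(i | i != j) e i * (e j * v i) = \sum_i e i * (e j * v i).
    rewrite [RHS](bigD1 j) //= [X in _ = X + _](_ : _ = 0) ?add0r //.
    rewrite /v big1 ?mulr0 // => c _; first by rewrite gj scale0r.
  rewrite Eg mulr_sumr.
  rewrite [X in _ = _ + X](_ : _ =
      \sum_c \sum_i e i * (e j * ((g c).@[a i] *: y c))); last first.
    rewrite exchange_big /=; apply: eq_bigr => i _.
    by rewrite /v mulr_sumr mulr_sumr.
  rewrite -big_split /=; apply: eq_bigr => c _.
  rewrite [X in _ = _ + X](_ : _ = \sum_i (e j * y c) * ((g c).@[a i] *: e i)).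
    by rewrite /b mulrBr mulr_sumr subrK mulrA.
  by apply: eq_bigr => i _; rewrite -!scalerAr; congr (_ *: _); ring.
apply: powspan_add; apply: powspan_sum => i.
  move=> _; apply: powspan_mul; first exact: vanishingM (deg_le_lin _ _) (yj _).
  exact: powspan1.
move=> nij.
have [c nc]: exists c, a i c != a j c.
  apply/existsP; rewrite -negb_forall; apply/negP => /forallP h.
  have := eval_e i j; rewrite (negPf nij).
  rewrite (@meval_eq _ _ _ (a i)) => [|c]; last exact/esym/eqP/h.
  by rewrite eval_e eqxx => /eqP; rewrite oner_eq0.
pose l : poly := (a j c - a i c)^-1 *: ('X_c - (a i c)%:MP).
have nz : a j c - a i c != 0 by rewrite subr_eq0 eq_sym.
have li : l.@[a i] = 0 by rewrite mevalZ mevalB mevalXU mevalC subrr mulr0.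
have lj : (1 - l).@[a j] = 0.
  by rewrite mevalB mevalZ mevalB mevalXU mevalC meval1 mulVf ?subrr.
have dl : deg_le 1 l by apply: deg_leZ; apply: deg_le_lin.
have dl' : deg_le 1 (1 - l) by apply: deg_leB => //; apply: deg_le1.
rewrite (_ : _ * _ = (e i * l) * (e j * v i) + (e i * v i) * (e j * (1 - l))).
  by apply: powspan_add; apply: powspan_mul; [|apply: powspan1| |apply: powspan1];
     apply: vanishingM.
by ring.
Qed.

(** Each of the [r] linear factors of a monomial in [x - a j] takes one of the [r] factors [e j],
    and the product lies in [I]. *)
Lemma powspan_homog j r (phi : poly) : phi \is r.-homog ->
  powspan I 0 r (e j ^+ r * translate (fun i => - a j i) phi).
Proof.
move=> /dhomogP H; rewrite [phi]mpolyE raddf_sum /= mulr_sumr big_seq.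
apply: powspan_sum => u /H ur; have {}ur : mdeg u = r := ur.
rewrite comp_mpolyZ -scalerAr; apply: powspanZ.
rewrite -ur mdegE mpolyXE_id rmorph_prod /= -prodrXr -big_split /=.
apply: powspan_prod => i _; rewrite rmorphXn /= translateX mpolyCN -exprMn.
apply: powspan_exp; apply: vanishingM; first exact: deg_le_lin.
by rewrite mevalB mevalXU mevalC subrr.
Qed.

(** The terms in [phi j] stand for leading forms of order [r] at the points, the only obstruction to
    one more factor from [I]. When such a term is multiplied by [u] in [I], only the linear part of
    [u] at [a j] survives: the rest gains a factor from [I] by [powspan_second]. *)
Lemma powspan_step E r w : powspan I (t.+1 + E) r w ->
  exists w' : poly, exists2 phi : 'I_n -> poly,
    powspan I E r.+1 w' /\ (forall j, phi j \is r.-homog) &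
    w = w' + \sum_j e j ^+ r.+1 * translate (fun i => - a j i) (phi j).
Proof.
elim=> {r w} [g Hg|r u w Iu _|r|r v w _ [v1 [phi1 [h1 p1] ->]] _ [v2 [phi2 [h2 p2] ->]]].
- have [c Hc] := powspan_interp Hg.
  exists (g - \sum_j c j *: e j); exists (fun j => (c j)%:MP).
    by split=> // j; rewrite -alg_mpolyC; apply: dhomogZ; apply: dhomog1.
  rewrite -[LHS](subrK (\sum_j c j *: e j)); congr (_ + _); apply: eq_bigr => j _.
  by rewrite expr1 comp_mpolyC mulrC mul_mpolyC.
- case=> w' [phi [Hw Hphi] Ew].
  pose l j : poly := pihomog mdeg 1 (translate (a j) u).
  pose tau j (p : poly) : poly := translate (fun i => - a j i) p.
  (* Subtracting [e j] times the linear part, rather than the linear part itself, keeps [u' j] in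
     [I]; the order at [a j] is still 2 since [1 - e j] vanishes there. *)
  pose u' j : poly := u - e j * tau j (l j).
  have hl j : l j \is 1.-homog by exact: pihomogP.
  have dl j : deg_le 1 (tau j (l j)).
    apply: deg_le_translate; apply/deg_le_msupp => v hv.
    by rewrite (dhomog_mf (hl j) hv).
  have ol j : ord_ge (a j) 1 (tau j (l j)).
    by rewrite /ord_ge translateKV; apply: low_order_homog.
  have Iu' j : I (u' j).
    split=> [|i].
      by apply: deg_leB; [case: Iu | rewrite -addn1; apply: deg_leM].
    rewrite mevalB; case: Iu => _ ->; rewrite mevalM eval_e.
    case: eqP => [<-|]; last by rewrite mul0r subrr.
    by rewrite (proj1 (ord_ge1 _ _) (ol j)) mulr0 subrr.
  have Ou' j : ord_ge (a j) 2 (u' j).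
    rewrite (_ : u' j = (u - tau j (l j)) + (1 - e j) * tau j (l j)); last first.
      by rewrite /u'; ring.
    apply: ord_geD.
      rewrite /ord_ge raddfB /= translateKV; apply: low_order_leading.
      exact: vanishing_ord.
    rewrite -[2%N]/(1 + 1)%N; apply: ord_geM (ol j).
    by apply/ord_ge1; rewrite mevalB meval1 eval_e eqxx subrr.
  exists (u * w' + \sum_j (e j * u' j) * (e j ^+ r * tau j (phi j))).
  exists (fun j => l j * phi j).
    split=> [|j]; last by rewrite -add1n; apply: dhomogM.
    apply: powspan_add; first exact: powspan_mul.
    apply: powspan_sum => j _; apply: (@powspanW _ _ _ 0) => //.
    rewrite -[0%N]addn0 -[r.+2]add2n; apply: powspanM.
      exact: powspan_second.
    exact: powspan_homog.
  rewrite Ew mulrDr -addrA; congr (_ + _).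
  rewrite mulr_sumr -big_split /=; apply: eq_bigr => j _.
  by rewrite rmorphM /= /u' /tau !exprS; ring.
- exists 0; exists (fun=> 0).
    by split=> [|j]; [exact: powspan_zero | exact: rpred0].
  by rewrite big1 ?addr0 // => j _; rewrite raddf0 mulr0.
- exists (v1 + v2); exists (fun j => phi1 j + phi2 j).
    by split=> [|j]; [exact: powspan_add | exact: dhomogD].
  rewrite addrACA; congr (_ + _); rewrite -big_split; apply: eq_bigr => j _.
  by rewrite raddfD mulrDr.
Qed.

(* Write [f = w + \sum_j e j ^ (r + 1) phi_j(x - a j)] with [w] in the span and
   [phi_j] homogeneous of degree [r]; as [f] and [w] vanish to order [r + 1] at
   [a j], so does [phi_j(x - a j)], whence [phi_j = 0]. *)
Theorem symbolic_powspan E r f : deg_le (r * t.+1 + E) f ->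
  (forall j, ord_ge (a j) r f) -> powspan I E r f.
Proof.
elim: r E => [|r IH] E; first by move=> Hf _; apply: powspan_base.
rewrite mulSn addnAC addnC => Hd Ho.
have Ho' j : ord_ge (a j) r f by apply: ord_geW (Ho j).
have [w [phi [Hw Hphi] Ef]] := powspan_step (IH _ Hd Ho').
have ophi i j : ord_ge (a j) (if i == j then r else r.+1)
                  (e i ^+ r.+1 * translate (fun c => - a i c) (phi i)).
  case: eqP => [<-|/eqP ne].
    apply: ord_geMr; rewrite /ord_ge translateKV; exact: low_order_homog.
  apply: ord_geMl; rewrite -[X in ord_ge _ X]mul1n; apply: ord_ge_exp.
  by apply/ord_ge1; rewrite eval_e (negPf ne).
suff z j : phi j = 0.
  rewrite Ef big1 ?addr0 // => j _; by rewrite z raddf0 mulr0.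
apply: homog_low_order_eq0 (Hphi j) _.
have h1 : ord_ge (a j) r.+1 (e j ^+ r.+1 * translate (fun c => - a j c) (phi j)).
  have -> : e j ^+ r.+1 * translate (fun c => - a j c) (phi j) = f - w -
     \sum_(i | i != j) e i ^+ r.+1 * translate (fun c => - a i c) (phi i).
    by rewrite {1}Ef (bigD1 j) //=; ring.
  apply: ord_geB; first apply: ord_geB => //.
    by apply: powspan_ord Hw => u; apply: vanishing_ord.
  by apply: ord_ge_sum => i /negPf ne; have := ophi i j; rewrite ne.
have h2 : ord_ge (a j) 1 (1 - e j ^+ r.+1).
  by apply/ord_ge1; rewrite mevalB meval1 rmorphXn /= eval_e eqxx expr1n subrr.
have h3 : ord_ge (a j) r.+1 (translate (fun c => - a j c) (phi j)).
  move: h1; set T := comp_mpoly _ _ => h1.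
  have -> : T = (1 - e j ^+ r.+1) * T + e j ^+ r.+1 * T by ring.
  apply: ord_geD h1; rewrite -add1n; apply: ord_geM h2 _.
  by rewrite /ord_ge translateKV; apply: low_order_homog.
by move: h3; rewrite /ord_ge translateKV.
Qed.

End Interpolation.

(** * Interpolation of jets *)

Section LocalCoordinates.
Variables (K : fieldType) (k : nat).
Local Notation poly := {mpoly K[k]}.
Implicit Types (a : 'I_k -> K) (p q g : poly).

Definition same_leading a m p q : Prop :=
  [/\ ord_ge a m p, ord_ge a m q & ord_ge a m.+1 (p - q)].

Lemma same_leadingM a m m' p q p' q' :
  same_leading a m p q -> same_leading a m' p' q' ->
  same_leading a (m + m') (p * p') (q * q').
Proof.
move=> [h1 h2 h3] [h1' h2' h3']; split; try exact: ord_geM.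
rewrite (_ : _ - _ = (p - q) * p' + q * (p' - q')); last by ring.
by apply: ord_geD; [rewrite -addSn | rewrite -addnS]; apply: ord_geM.
Qed.

Lemma same_leading1 a : same_leading a 0 1 1.
Proof. by split=> //; rewrite subrr; apply: ord_ge0. Qed.

Lemma same_leading_exp a m p q e :
  same_leading a m p q -> same_leading a (m * e) (p ^+ e) (q ^+ e).
Proof.
move=> H; elim: e => [|e IH]; first by rewrite muln0; apply: same_leading1.
by rewrite !exprS mulnS; apply: same_leadingM.
Qed.

Lemma same_leading_prod a (I : Type) (r : seq I) (P : pred I) (w : I -> nat)
    (F G : I -> poly) :
  (forall i, same_leading a (w i) (F i) (G i)) ->
  same_leading a (\sum_(i <- r | P i) w i)%N (\prod_(i <- r | P i) F i)
               (\prod_(i <- r | P i) G i).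
Proof.
move=> H; elim: r => [|i r IH]; first by rewrite !big_nil; apply: same_leading1.
by rewrite !big_cons; case: (P i) => //; apply: same_leadingM.
Qed.

Lemma dhomog_prodn (I : Type) (r : seq I) (P : pred I) (w : I -> nat)
    (F : I -> poly) :
  (forall i, F i \is (w i).-homog) ->
  \prod_(i <- r | P i) F i \is (\sum_(i <- r | P i) w i)%N.-homog.
Proof.
by move=> H; elim/big_ind2: _ => //; [exact: dhomog1 | move=> ? ? ? ?; exact: dhomogM].
Qed.

(* [G] is the Jacobian matrix of [f] at [a]; as it is invertible, every leading
   form is a form in the [f i]. *)
Lemma leading_form_coords a (f : 'I_k -> poly) (G : 'M[K]_k) r g :
  G \in unitmx ->
  (forall i, ord_ge a 2 (f i - \sum_j G i j *: ('X_j - (a j)%:MP))) ->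
  ord_ge a r g ->
  exists phi : poly, phi \is r.-homog /\
    ord_ge a r.+1 (g - (phi \mPo [tuple f i | i < k])).
Proof.
move=> uG Hf Hg; pose B := invmx G.
pose lin i : poly := \sum_j B i j *: 'X_j.
pose y i : poly := 'X_i - (a i)%:MP.
have f1 i : ord_ge a 1 (f i).
  rewrite -[f i](subrK (\sum_j G i j *: y j)); apply: ord_geD.
    by apply: ord_geW (Hf i).
  by apply: ord_ge_sum => j _; apply: ord_geZ; apply: ord_ge_subX.
have Hlead i : same_leading a 1 (y i) (\sum_j B i j *: f j).
  split; first exact: ord_ge_subX.
    by apply: ord_ge_sum => j _; apply: ord_geZ.
  have -> : y i = \sum_j B i j *: \sum_l G j l *: y l.
    rewrite (eq_bigr (fun j => \sum_l (B i j * G j l) *: y l)); last first.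
      by move=> j _; rewrite scaler_sumr; apply: eq_bigr => l _; rewrite scalerA.
    rewrite exchange_big /= (bigD1 i) //= -scaler_suml.
    have E l : \sum_j B i j * G j l = (i == l)%:R.
      by have := congr1 (fun M : 'M[K]_k => M i l) (mulVmx uG); rewrite !mxE.
    rewrite E eqxx scale1r big1 ?addr0 // => l nl.
    by rewrite -scaler_suml E eq_sym (negPf nl) scale0r.
  rewrite mpoly_sumB; apply: ord_ge_sum => j _; rewrite -scalerBr; apply: ord_geZ.
  by rewrite -opprB -[- _]scaleN1r; apply: ord_geZ; apply: Hf.
have [psi [hpsi lpsi]] : exists psi : poly, psi \is r.-homog /\
    low_order r.+1 (translate a g - psi).
  by exists (pihomog mdeg r (translate a g)); split;
     [exact: pihomogP | exact: low_order_leading].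
exists (psi \mPo [tuple lin i | i < k]); split.
  rewrite comp_mpolyE big_seq; apply: rpred_sum => u hu; apply: rpredZ.
  have <- : mdeg u = r by exact: (dhomog_mf hpsi hu).
  rewrite mdegE; apply: dhomog_prodn => i; rewrite tnth_mktuple.
  rewrite -[X in X.-homog]mul1n; apply: dhomogMn.
  apply: rpred_sum => j _; apply: rpredZ.
  by rewrite dhomogX /= mdeg1.
pose psi' := translate (fun i => - a i) psi.
set q := comp_mpoly _ (comp_mpoly _ psi); have -> : g - q = (g - psi') + (psi' - q) by ring.
apply: ord_geD.
  by rewrite /ord_ge raddfB /= translateKV.
rewrite /q /psi' (comp_mpolyE psi [tuple lin i | i < k]) comp_mpoly_sum comp_mpolyE.
rewrite mpoly_sumB big_seq.
apply: ord_ge_sum => u hu; have ur : mdeg u = r by exact: (dhomog_mf hpsi hu).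
rewrite comp_mpolyZ -scalerBr; apply: ord_geZ.
rewrite rmorph_prod /=.
suff [_ _] : same_leading a r (\prod_i y i ^+ u i)
                              (\prod_i (\sum_j B i j *: f j) ^+ u i).
  congr (ord_ge _ _ (_ - _)); apply: eq_bigr => i _.
    by rewrite tnth_mktuple mpolyCN.
  rewrite tnth_mktuple rmorphXn /= comp_mpoly_sum; congr (_ ^+ _).
  apply: eq_bigr => j _; rewrite /= comp_mpolyZ comp_mpolyXU -tnth_nth.
  by rewrite tnth_mktuple.
rewrite -ur mdegE; apply: same_leading_prod => i.
by have := same_leading_exp (u i) (Hlead i); rewrite mul1n.
Qed.

End LocalCoordinates.

(** * Surjectivity onto jets along a subscheme *)

Section JetSurjectivity.
Variables (K : fieldType) (k : nat).
Local Notation poly := {mpoly K[k]}.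
Implicit Types (J : poly -> Prop) (p q g : poly).

Definition is_ideal J : Prop :=
  [/\ J 0, forall p q, J p -> J q -> J (p + q) & forall p q, J q -> J (p * q)].

Definition zero_ideal : poly -> Prop := fun p => p = 0.

Definition add_gen J h : poly -> Prop :=
  fun p => exists v w, J v /\ p = v + h * w.

Lemma zero_idealP : is_ideal zero_ideal.
Proof. by split=> // [p q -> ->|p q ->]; rewrite /zero_ideal ?addr0 ?mulr0. Qed.

Lemma add_genP J h : is_ideal J -> is_ideal (add_gen J h).
Proof.
move=> [J0 JD JM]; split.
- by exists 0, 0; split=> //; rewrite mulr0 addr0.
- move=> _ _ [v [w [Jv ->]]] [v' [w' [Jv' ->]]].
  by exists (v + v'), (w + w'); split; [exact: JD | ring].
- move=> p _ [v [w [Jv ->]]]; exists (p * v), (p * w).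
  by split; [exact: JM | ring].
Qed.

Lemma add_genl J h p : J p -> add_gen J h p.
Proof. by move=> Jp; exists p, 0; rewrite mulr0 addr0. Qed.

Lemma add_genr J h : is_ideal J -> add_gen J h h.
Proof. by case=> J0 _ _; exists 0, 1; rewrite mulr1 add0r. Qed.

(** The ideal [J] plus the [m]-th power of the maximal ideal of [a]: it measures the order at [a] of
    the restriction of [p] to the scheme [J = 0]. *)
Definition mod_ord J (a : 'I_k -> K) m p : Prop :=
  exists v, J v /\ ord_ge a m (p - v).

Section Ideal.
Variable J : poly -> Prop.
Hypothesis idJ : is_ideal J.

Lemma mod_ordD a m p q : mod_ord J a m p -> mod_ord J a m q -> mod_ord J a m (p + q).
Proof.
move=> [v [Jv h]] [w [Jw h']]; exists (v + w); split; first by case: idJ => _ JD _; apply: JD.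
by rewrite opprD addrACA; apply: ord_geD.
Qed.

Lemma mod_ordMr a m p q : mod_ord J a m q -> mod_ord J a m (p * q).
Proof.
move=> [v [Jv h]]; exists (p * v); split; first by case: idJ => _ _; apply.
by rewrite -mulrBr; apply: ord_geMr.
Qed.

Lemma mod_ordN a m p : mod_ord J a m p -> mod_ord J a m (- p).
Proof. by rewrite -mulN1r; apply: mod_ordMr. Qed.

Lemma mod_ordB a m p q : mod_ord J a m p -> mod_ord J a m q -> mod_ord J a m (p - q).
Proof. by move=> hp hq; apply: mod_ordD => //; apply: mod_ordN. Qed.

Lemma ord_mod_ord a m p : ord_ge a m p -> mod_ord J a m p.
Proof. by move=> h; exists 0; rewrite subr0; case: idJ. Qed.

Lemma ideal_mod_ord a m p : J p -> mod_ord J a m p.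
Proof. by move=> h; exists p; rewrite subrr; split=> //; apply: ord_ge0. Qed.

Lemma mod_ord_triv a p : mod_ord J a 0 p.
Proof. exact: ord_mod_ord. Qed.

Lemma mod_ord_sum a m (T : Type) (r : seq T) (P : pred T) (F : T -> poly) :
  (forall i, P i -> mod_ord J a m (F i)) -> mod_ord J a m (\sum_(i <- r | P i) F i).
Proof.
move=> H; elim/big_ind: _ => //; last exact: mod_ordD.
by apply: ord_mod_ord; apply: ord_ge0.
Qed.

End Ideal.

Lemma mod_ordW J a m m' p : (m <= m')%N -> mod_ord J a m' p -> mod_ord J a m p.
Proof. by move=> le [v [Jv h]]; exists v; split=> //; apply: ord_geW h. Qed.

Variables (T : finType) (c : T -> 'I_k -> K).

(** A jet at [c i] on the scheme [J = 0] is represented by an arbitrary polynomial [g i]. The value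
    [s i = 0] imposes no condition, so that one index type serves for all subsets of the points; for
    the zero ideal, [s i = 1] prescribes a value. *)
Definition jet_surj J (s : T -> nat) (d : nat) : Prop :=
  forall g : T -> poly, exists f, deg_le d f /\
    forall i, mod_ord J (c i) (s i) (g i - f).

Lemma jet_surjW J s s' d d' : (forall i, s' i <= s i)%N -> (d <= d')%N ->
  jet_surj J s d -> jet_surj J s' d'.
Proof.
move=> le_s le_d H g; have [f [Hd Hf]] := H g.
by exists f; split=> [|i]; [exact: deg_leW Hd | apply: mod_ordW (Hf i)].
Qed.

Lemma jet_surj0 J s d : is_ideal J -> (forall i, s i = 0%N) -> jet_surj J s d.
Proof.
move=> idJ s0 g; exists 0; split=> [|i]; first exact: deg_le0.
by rewrite s0; apply: mod_ord_triv.
Qed.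

(** Jets are corrected one order at a time, at all points simultaneously. A correction of order [r]
    at one point has to vanish elsewhere only to order [r.+1], not to the full order [s l]; the low
    degree reached on grids rests on this. *)
Lemma jet_surj_triangular J s d : is_ideal J ->
  (forall r i g, (r < s i)%N -> ord_ge (c i) r g ->
    exists f, [/\ deg_le d f, mod_ord J (c i) r.+1 (g - f) &
      forall l, l != i -> mod_ord J (c l) (minn (s l) r.+1) f]) ->
  jet_surj J s d.
Proof.
move=> idJ H g.
have main r : exists f, deg_le d f /\
    forall i, mod_ord J (c i) (minn (s i) r) (g i - f).
  elim: r => [|r [f [Hd Hf]]].
    exists 0; split=> [|i]; first exact: deg_le0.
    by rewrite minn0; apply: mod_ord_triv.
  have step i : exists F, [/\ deg_le d F,
      mod_ord J (c i) (minn (s i) r.+1) (g i - f - F) &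
      forall l, l != i -> mod_ord J (c l) (minn (s l) r.+1) F].
    have [v [Jv Hv]] := Hf i.
    have [lt_r|le_s] := ltnP r (s i); last first.
      exists 0; split=> [||l _]; first exact: deg_le0.
        rewrite subr0; apply: mod_ordW (Hf i); lia.
      by apply: ord_mod_ord => //; apply: ord_ge0.
    have [|F [h1 h2 h3]] := H r i (g i - f - v) lt_r.
      by apply: ord_geW Hv; lia.
    exists F; split=> //.
    rewrite (_ : _ - F = (g i - f - v - F) + v); last by ring.
    apply: mod_ordD => //; last exact: ideal_mod_ord.
    by apply: mod_ordW h2; lia.
  have [F HF] := fin_all_exists step.
  exists (f + \sum_i F i); split=> [|i].
    by apply: deg_leD => //; apply: deg_le_sum => i _; case: (HF i).
  rewrite (bigD1 i) //= (_ : _ - _ = (g i - f - F i) - \sum_(l | l != i) F l).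
    apply: mod_ordB => //; first by case: (HF i).
    by apply: mod_ord_sum => // l nl; case: (HF l) => _ _; apply; rewrite eq_sym.
  by ring.
have [f [Hd Hf]] := main (\max_i s i).
exists f; split=> // i; apply: mod_ordW (Hf i).
by rewrite leq_min leqnn; apply: leq_bigmax.
Qed.

(* Restriction to the surface [h = 0] followed by division by [h]. *)
Lemma jet_surj_peel J h e s d : is_ideal J -> deg_le e h -> (e <= d)%N ->
  jet_surj (add_gen J h) (fun i => if h.@[c i] == 0 then s i else 0%N) d ->
  jet_surj J (fun i => s i - (h.@[c i] == 0%R))%N (d - e) ->
  jet_surj J s d.
Proof.
move=> idJ He led Htr Hres g.
have [f1 [d1 H1]] := Htr g.
have step i : exists u, mod_ord J (c i) (s i) (g i - f1 - h * u).
  have := H1 i; case: eqP => [_ [_ [[v [w [Jv ->]]] Ho]]|/eqP nz _].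
    exists w; exists v; split=> //.
    by rewrite (_ : _ - v = g i - f1 - (v + h * w)) //; ring.
  have [q Hq] := ord_ge_inv (s i) nz.
  exists (q * (g i - f1)); apply: ord_mod_ord => //.
  rewrite (_ : _ - _ = (1 - h * q) * (g i - f1)); last by ring.
  exact: ord_geMl.
have [u Hu] := fin_all_exists step.
have [f2 [d2 H2]] := Hres u.
exists (f1 + h * f2); split=> [|i].
  by apply: deg_leD => //; rewrite -(subnKC led); apply: deg_leM.
rewrite (_ : _ - _ = (g i - f1 - h * u i) + h * (u i - f2)); last by ring.
apply: mod_ordD => //; have [v [Jv Hv]] := H2 i.
exists (h * v); split; first by case: idJ => _ _; apply.
rewrite -mulrBr; move: Hv; case: eqP => [h0|_]; last first.
  by rewrite subn0; apply: ord_geMr.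
move=> Hv; apply: (@ord_geW _ _ _ _ (1 + (s i - 1))); first by lia.
by apply: ord_geM => //; apply/ord_ge1.
Qed.

Definition slope52 J (P : pred T) : Prop :=
  exists C, forall s d, (5 * s + C <= 2 * d)%N ->
    jet_surj J (fun i => if P i then s else 0%N) d.

(** Peeling off each member of [hs] once lowers the order by at least 2 at every point of [P] and
    the degree by 5, which preserves the ratio 5/2. The traces are settled by hypothesis. *)
Lemma slope52_cover J (P : pred T) (hs : seq (poly * nat)) : is_ideal J ->
  (forall he, he \in hs -> deg_le he.2 he.1 /\
     slope52 (add_gen J he.1) [pred i | P i & he.1.@[c i] == 0]) ->
  (forall i, P i -> (2 <= count (fun he => he.1.@[c i] == 0%R) hs)%N) ->
  (\sum_(he <- hs) he.2 = 5)%N ->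
  slope52 J P.
Proof.
move=> idJ Hhs Hcov Hsum.
have [C HC]: exists C, forall he, he \in hs -> forall s d, (5 * s + C <= 2 * d)%N ->
    jet_surj (add_gen J he.1)
      (fun i => if P i && (he.1.@[c i] == 0) then s else 0%N) d.
  elim: hs Hhs {Hcov Hsum} => [|he hs IH] H; first by exists 0%N.
  have [|C1 H1] := IH; first by move=> he' h'; apply: H; rewrite inE h' orbT.
  have [_ [C2 H2]] := H he (mem_head _ _).
  exists (maxn C1 C2) => he'; rewrite inE => /predU1P[->|h'] s d le.
    by apply: H2; lia.
  by apply: H1 h' _ _ _; lia.
have round s0 : forall hs' s d, {subset hs' <= hs} ->
    (forall i, s i <= (if P i then s0 else 0))%N ->
    (5 * s0 + C + 2 * (\sum_(he <- hs') he.2) <= 2 * d)%N ->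
    jet_surj J (fun i => s i - count (fun he => he.1.@[c i] == 0%R) hs')%N
               (d - \sum_(he <- hs') he.2)%N ->
    jet_surj J s d.
  elim=> [|[h e] hs' IH] s d sub le_s led.
    by rewrite big_nil subn0; apply: jet_surjW => //= i; rewrite subn0.
  rewrite big_cons /= in led * => Hres.
  have hin : (h, e) \in hs by apply: sub; rewrite mem_head.
  have [Hdeg _] := Hhs _ hin.
  apply: (jet_surj_peel idJ Hdeg) => /=; first by lia.
    apply: jet_surjW (HC _ hin s0 d _) => //=; last by lia.
    move=> i; have := le_s i; case: (P i) => /=; last by case: eqP; lia.
    by case: eqP.
  apply: IH => [x hx|i||]; first by apply: sub; rewrite inE hx orbT.
  - by apply: leq_trans (leq_subr _ _) (le_s i).
  - by move: led; move: (\sum_(j <- hs') j.2)%N => S; lia.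
  - by rewrite -subnDA; apply: jet_surjW Hres => // i; rewrite subnDA.
(* The extra 10 is twice the degree 5 lost in one round, so the bound required of a trace holds up
   to the last member of [hs]. *)
exists (C + 10)%N => s; elim/ltn_ind: s => s IH d led.
have [->|s_gt0] := posnP s.
  by apply: jet_surj0 => // i; case: (P i).
apply: (round s hs) => //=; first by rewrite Hsum; lia.
rewrite Hsum; have [le2|lt2] := leqP 2 s; last first.
  apply: jet_surj0 => // i; case Pi: (P i) => //=.
  by have /= := Hcov i Pi; move: (count _ _) => x; lia.
have lt_s : (s - 2 < s)%N by lia.
apply: jet_surjW (IH _ lt_s (d - 5)%N _) => // [i|]; last by lia.
by case Pi: (P i) => //=; have /= := Hcov i Pi; move: (count _ _) => x; lia.
Qed.

(** Here [tau] is a local parameter at [a] of the curve [J = 0]: modulo [J], leading forms of order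
    [r] are multiples of [tau ^+ r]. *)
Definition curve_param J (a : 'I_k -> K) (tau : poly) : Prop :=
  ord_ge a 1 tau /\ forall r g, ord_ge a r g ->
    exists x, mod_ord J a r.+1 (g - x *: tau ^+ r).

(** On a curve a leading form has a single coefficient, so one polynomial per point and order is
    enough. The factor [rho], normalized to 1 at the point, supplies the missing order at the
    others. *)
Lemma jet_surj_curve J (P : pred T) s d : is_ideal J ->
  (forall i r, P i -> (r < s)%N -> exists tau rho,
    [/\ curve_param J (c i) tau, rho.@[c i] != 0, deg_le d (tau ^+ r * rho) &
        forall l, P l -> l != i -> ord_ge (c l) s (tau ^+ r * rho)]) ->
  jet_surj J (fun i => if P i then s else 0%N) d.
Proof.
move=> idJ H; apply: jet_surj_triangular => // r i g.
case Pi: (P i) => // lt_r Hg.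
have [tau [rho [[tau1 Htau] nz Hd Hl]]] := H i r Pi lt_r.
have [x Hx] := Htau r g Hg.
exists ((x / rho.@[c i]) *: (tau ^+ r * rho)); split=> [||l nl].
- exact: deg_leZ.
- rewrite (_ : _ - _ = (g - x *: tau ^+ r) +
     x *: (tau ^+ r * (1 - (rho.@[c i])^-1 *: rho))).
    apply: mod_ordD => //; apply: ord_mod_ord => //; apply: ord_geZ.
    rewrite -addn1; apply: ord_geM.
      by have := ord_ge_exp (e := r) tau1; rewrite mul1n.
    by apply/ord_ge1; rewrite mevalB mevalZ meval1 mulVf ?subrr.
  by rewrite mulrBr mulr1 scalerBr -scalerAr scalerA; ring.
- case Pl: (P l); last by rewrite min0n; apply: mod_ord_triv.
  apply: mod_ordW (geq_minl _ _) _; apply: ord_mod_ord => //; apply: ord_geZ.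
  exact: Hl.
Qed.

End JetSurjectivity.

(** The entries are Taylor coefficients of monomials at the points. The base is any commutative
    ring, so that [generic_jets] can form the same matrix with indeterminate coordinates. *)
Definition jetmx (R : comNzRingType) (k : nat) (T : finType)
    (a : T -> 'I_k -> R) (d s : nat) :
    'M[R]_(#|{: 'X_{1..k < d.+1}}|, #|{: T * 'X_{1..k < s}}|) :=
  \matrix_(i, j) (translate (a (enum_val j).1)
      'X_[R, (enum_val i : 'X_{1..k < d.+1})])@_((enum_val j).2 : 'X_{1..k < s}).

Lemma map_jetmx (R S : comNzRingType) (phi : {rmorphism R -> S}) (k : nat)
    (T : finType) (a : T -> 'I_k -> R) (d s : nat) :
  map_mx phi (jetmx a d s) = jetmx (fun x i => phi (a x i)) d s.
Proof.
apply/matrixP => i j; rewrite !mxE -mcoeff_map_mpoly; congr (mcoeff _ _).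
rewrite !comp_mpolyX rmorph_prod /=; apply: eq_bigr => l _.
by rewrite rmorphXn /= !tnth_mktuple rmorphD /= map_mpolyX map_mpolyC.
Qed.

Section JetMatrix.
Variables (K : fieldType) (k : nat).
Local Notation poly := {mpoly K[k]}.

Definition coef_row (d : nat) (f : poly) : 'rV[K]_#|{: 'X_{1..k < d.+1}}| :=
  \row_i f@_(enum_val i : 'X_{1..k < d.+1}).

Definition row_poly (d : nat) (v : 'rV[K]_#|{: 'X_{1..k < d.+1}}|) : poly :=
  \sum_i v 0 i *: 'X_[(enum_val i : 'X_{1..k < d.+1})].

Lemma row_poly_deg d v : deg_le d (@row_poly d v).
Proof.
apply: deg_le_sum => i _; apply: deg_leZ; apply: deg_leW (deg_leX _ _).
by rewrite -ltnS bmdeg.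
Qed.

Lemma row_polyK d v : coef_row d (row_poly v) = v.
Proof.
apply/rowP => i; rewrite mxE /row_poly raddf_sum /= (bigD1 i) //=.
rewrite mcoeffZ mcoeffX eqxx mulr1 big1 ?addr0 // => j nj.
rewrite mcoeffZ mcoeffX; case: eqP => [e|]; last by rewrite mulr0.
by case/eqP: nj; apply: enum_val_inj; apply: val_inj.
Qed.

Lemma coef_rowK d f : deg_le d f -> row_poly (coef_row d f) = f.
Proof.
move=> Hd; rewrite {2}(mpolywE Hd) /row_poly.
rewrite (reindex (@enum_rank _)) /=; last by apply: onW_bij; apply: enum_rank_bij.
by apply: eq_bigr => u _; rewrite mxE enum_rankK.
Qed.

Variables (T : finType) (c : T -> 'I_k -> K).

Lemma coef_row_jetmx d s f j : deg_le d f ->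
  (coef_row d f *m jetmx c d s) 0 j =
    (translate (c (enum_val j).1) f)@_((enum_val j).2 : 'X_{1..k < s}).
Proof.
move=> Hd; rewrite -{2}(coef_rowK Hd) /row_poly comp_mpoly_sum raddf_sum mxE.
by apply: eq_bigr => i _; rewrite /= comp_mpolyZ mcoeffZ !mxE.
Qed.

Lemma jet_surjP d s :
  jet_surj c (@zero_ideal K k) (fun=> s) d <-> row_full (jetmx c d s).
Proof.
split=> [H|full g].
  suff step j : exists B : 'rV[K]_ _, B *m jetmx c d s = delta_mx 0 j.
    have [B HB] := fin_all_exists step.
    apply/row_fullP; exists (\matrix_j B j); apply/row_matrixP => j.
    by rewrite row_mul rowK HB rowE mulmx1.
  set x := enum_val j.
  have [f [Hd Hf]] := H (fun y => if y == x.1 then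
     translate (fun i => - c y i) 'X_[(x.2 : 'X_{1..k < s})] else 0).
  exists (coef_row d f); apply/rowP => i; rewrite coef_row_jetmx // mxE eqxx /=.
  have [_ [-> ]] := Hf (enum_val i).1; rewrite subr0 => /(_ (enum_val i).2).
  rewrite bmdeg raddfB mcoeffB => /(_ isT) /eqP; rewrite subr_eq0 => /eqP /= <-.
  case: eqP => [e|ne].
    rewrite translateKV mcoeffX; congr (_%:R); congr nat_of_bool.
    apply/eqP/eqP => [h|->] //; apply: enum_val_inj; rewrite -/x.
    by move: e h; case: (enum_val i) (x) => [y u] [y' u'] /= -> /val_inj ->.
  rewrite raddf0 mcoeff0; case: eqP => // e; by rewrite e in ne.
pose w := \row_(j < #|{: T * 'X_{1..k < s}}|)
  (translate (c (enum_val j).1) (g (enum_val j).1))@_((enum_val j).2 : 'X_{1..k < s}).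
have /submxP [v Hv] : (w <= jetmx c d s)%MS by apply: submx_full.
exists (row_poly v); split=> [|x]; first exact: row_poly_deg.
exists 0; split=> // u hu; rewrite subr0 raddfB mcoeffB.
pose j := enum_rank (x, BMultinom hu).
have := congr1 (fun M : 'rV_ _ => M 0 j) Hv; rewrite mxE.
rewrite -{1}(row_polyK v) coef_row_jetmx; last exact: row_poly_deg.
by rewrite enum_rankK /= => ->; rewrite subrr.
Qed.

(* Multiplication by [F] maps into the jets that are multiples of [F], and those
   only depend on jets of order [j - m]. *)
Lemma jet_count d D m j F : F != 0 -> deg_le d F ->
  (forall x, ord_ge (c x) m F) -> (d <= D)%N -> (m <= j)%N ->
  jet_surj c (@zero_ideal K k) (fun=> j) D ->
  (#|{: 'X_{1..k < (D - d).+1}}| + #|T| * #|{: 'X_{1..k < j}}| <=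
   #|{: 'X_{1..k < D.+1}}| + #|T| * #|{: 'X_{1..k < j - m}}|)%N.
Proof.
move=> nzF Hd Ho led lem /jet_surjP full.
pose A : 'M[K]_(#|{: 'X_{1..k < (D - d).+1}}|, _) :=
  \matrix_i coef_row D (F * 'X_[(enum_val i : 'X_{1..k < (D - d).+1})]).
have degF (f : poly) : deg_le (D - d) f -> deg_le D (F * f).
  by move=> Hf; rewrite -(subnKC led); apply: deg_leM.
have mulA (v : 'rV_ _) : v *m A = coef_row D (F * row_poly v).
  rewrite mulmx_sum_row; apply/rowP => i; rewrite summxE !mxE /row_poly.
  rewrite mulr_sumr raddf_sum; apply: eq_bigr => l _ /=.
  by rewrite !mxE -scalerAr mcoeffZ.
have rkA : row_free A.
  rewrite -kermx_eq0; apply/rowV0P => v /sub_kermxP.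
  rewrite mulA => h0; have := degF _ (row_poly_deg v).
  move/coef_rowK; rewrite h0 {1}/row_poly big1 => [|i _]; last by rewrite mxE scale0r.
  move/esym/eqP; rewrite mulf_eq0 (negPf nzF) /= => /eqP p0.
  by rewrite -(row_polyK v) p0; apply/rowP => i; rewrite !mxE mcoeff0.
pose X : 'M[K]_(#|{: T * 'X_{1..k < j - m}}|, #|{: T * 'X_{1..k < j}}|) :=
  \matrix_(i, l) if (enum_val i).1 == (enum_val l).1 then
    (translate (c (enum_val i).1) F *
       'X_[((enum_val i).2 : 'X_{1..k < j - m})])@_((enum_val l).2 : 'X_{1..k < j})
  else 0.
have EX : A *m jetmx c D j = jetmx c (D - d) (j - m) *m X.
  apply/row_matrixP => i; rewrite !row_mul rowK; apply/rowP => l.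
  have hX : deg_le (D - d) ('X_[(enum_val i : 'X_{1..k < (D - d).+1})] : poly).
    by apply: deg_leW (deg_leX _ _); rewrite -ltnS bmdeg.
  rewrite coef_row_jetmx; last exact: degF.
  set x := (enum_val l).1; set v : 'X_{1..k < j} := (enum_val l).2.
  rewrite rmorphM /=; set q := comp_mpoly _ 'X_[_].
  rewrite mxE (reindex (@enum_rank _)) /=; last by apply: onW_bij; apply: enum_rank_bij.
  rewrite (eq_bigr (fun y => if y.1 == x then
      q@_(y.2 : 'X_{1..k < j - m}) * (translate (c x) F *
         'X_[(y.2 : 'X_{1..k < j - m})])@_v else 0)); last first.
    move=> y _; rewrite !mxE enum_rankK -/x -/v; case: eqP => [->|_] //.
    by rewrite mulr0.
  rewrite -(pair_bigA _ (fun y (w : 'X_{1..k < j - m}) => if y == x then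
      q@_w * (translate (c x) F * 'X_[w])@_v else 0)) (bigD1 x) //= eqxx.
  rewrite [X in _ + X]big1 ?addr0 => [|y /negPf ->]; last by rewrite big1.
  clearbody q.
  pose q' : poly := \sum_(w : 'X_{1..k < j - m}) q@_w *: ('X_[w] : poly).
  have -> : \sum_(w : 'X_{1..k < j - m}) q@_w * (translate (c x) F * 'X_[w])@_v
          = (translate (c x) F * q')@_v.
    rewrite mulr_sumr raddf_sum; apply: eq_bigr => w _ /=.
    by rewrite -scalerAr mcoeffZ.
  have lq : low_order (j - m) (q - q').
    move=> u hu; rewrite mcoeffB raddf_sum (bigD1 (BMultinom hu)) //=.
    rewrite mcoeffZ mcoeffX eqxx mulr1 big1 ?addr0 ?subrr // => w nw.
    rewrite mcoeffZ mcoeffX; case: eqP => [e|]; last by rewrite mulr0.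
    by case/eqP: nw; apply: val_inj.
  have := low_orderM (Ho x) lq (u := v); rewrite subnKC // bmdeg => /(_ isT).
  by rewrite mulrBr mcoeffB => /eqP; rewrite subr_eq0 => /eqP.
have := mxrank_mul_min A (jetmx c D j).
have -> : \rank A = #|{: 'X_{1..k < (D - d).+1}}| by exact/eqP.
have -> : \rank (jetmx c D j) = (#|T| * #|{: 'X_{1..k < j}}|)%N.
  by rewrite -card_prod; apply/eqP.
have : (\rank (A *m jetmx c D j) <= #|T| * #|{: 'X_{1..k < j - m}}|)%N.
  by rewrite EX -card_prod; apply: leq_trans (mxrankM_maxr _ _) (rank_leq_row _).
lia.
Qed.

End JetMatrix.

(** * Degree bounds from interpolation of jets *)

Lemma card_bmultinom (k s : nat) :
  #|{: 'X_{1..k.+1 < s}}| = (\sum_(e < s) 'C(e + k, e))%N.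
Proof.
rewrite -sum1_card (partition_big (fun u : 'X_{1..k.+1 < s} => Ordinal (bmdeg u)) predT) //=.
apply: eq_bigr => e _; rewrite sum1_card -(mpoly.size_basis k e).
rewrite cardE -(size_map (@bmnm k.+1 s)).
apply/perm_size/uniq_perm; rewrite ?uniq_basis //.
  by rewrite map_inj_uniq ?enum_uniq //; apply: val_inj.
move=> u; rewrite -basis_cover; apply/mapP/idP => [[v]|ue].
  by rewrite mem_enum unfold_in => /eqP [<-] ->.
have hu : (mdeg u < s)%N by rewrite (eqP ue).
exists (BMultinom hu) => //; rewrite mem_enum unfold_in.
by apply/eqnP; rewrite /= (eqP ue).
Qed.

Lemma double_bin2 e : (2 * 'C(e + 2, e) = (e + 2) * (e + 1))%N.
Proof.
have -> : 'C(e + 2, e) = 'C(e + 2, 2) by rewrite -bin_sub ?leq_addr // addKn.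
by have := mul_bin_diag e.+2 1; rewrite bin1 addn1 addn2 => <-.
Qed.

Lemma sum_triangular_upper d x :
  (2 * \sum_(x <= e < x + d) 'C(e + 2, e) <= d * (x + d + 1) ^ 2)%N.
Proof.
elim: d => [|d IH]; first by rewrite addn0 big_geq ?muln0.
rewrite addnS big_nat_recr ?leq_addr //= mulnDr double_bin2; nia.
Qed.

Lemma sum_triangular_lower d x :
  (d * x ^ 2 <= 2 * \sum_(x <= e < x + d) 'C(e + 2, e))%N.
Proof.
elim: d => [|d IH]; first by rewrite mul0n.
rewrite addnS big_nat_recr ?leq_addr //= mulnDr double_bin2; nia.
Qed.

Lemma card_bmultinom3_diff s d :
  (#|{: 'X_{1..3 < s + d}}| =
     #|{: 'X_{1..3 < s}}| + \sum_(s <= e < s + d) 'C(e + 2, e))%N.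
Proof.
rewrite !card_bmultinom -!(big_mkord predT (fun e => 'C(e + 2, e))).
by rewrite -big_cat_nat ?leq_addr.
Qed.

Lemma quadratic_growth (A B C D : nat) :
  (forall q, A * q ^ 2 <= B * q ^ 2 + C * q + D)%N -> (A <= B)%N.
Proof.
move=> H; rewrite leqNgt; apply/negP => lt.
have := H (C + D).+1; nia.
Qed.

Section Seshadri.
Variable (K : fieldType).
Local Notation poly := {mpoly K[3]}.
Variables (T : finType) (c : T -> 'I_3 -> K).
Local Notation jets := (jet_surj c (@zero_ideal K 3)).

Lemma submonomial (k : nat) (u : 'X_{1..k}) m : (m <= mdeg u)%N ->
  exists2 v : 'X_{1..k}, (v <= u)%MM & mdeg v = m.
Proof.
elim: m => [|m IH] lem.
  by exists 0%MM; rewrite ?mdeg0 //; apply/mnm_lepP => i; rewrite mnm0E.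
have [v le_v dv] := IH (ltnW lem).
have [i lt_i] : exists i, (v i < u i)%N.
  apply/existsP; apply: contraT; rewrite negb_exists => /forallP h.
  suff : (mdeg u <= m)%N by lia.
  by rewrite -dv !mdegE; apply: leq_sum => i _; rewrite leqNgt.
exists (v + U_(i))%MM; last by rewrite mdegD mdeg1 dv addn1.
apply/mnm_lepP => j; rewrite mnmDE mnm1E.
by case: eqP => [<-|_]; [rewrite addn1 | rewrite addn0; apply/mnm_lepP].
Qed.

(** A monomial of degree at most [q * s] at a point is a product of [q] monomials of degree at most
    [s]. Realizing each of them in degree [d0], with order [s.+1] at the other points, gives order
    [q * s.+1] there, which is enough as [q] is positive. *)
Lemma jet_surj_product d0 s q : (0 < q)%N -> jets (fun=> s.+1) d0 ->
  jets (fun=> (q * s).+1) (q * d0).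
Proof.
move=> q_gt0 H.
have monom i q' (u : 'X_{1..3}) : (mdeg u <= q' * s)%N -> exists f : poly,
    [/\ deg_le (q' * d0) f,
        ord_ge (c i) (mdeg u).+1 (f - \prod_l ('X_l - (c i l)%:MP) ^+ u l) &
        forall l, l != i -> ord_ge (c l) (q' * s.+1) f].
  elim: q' u => [|q' IH] u le_u.
    exists 1; split=> //; first exact: deg_le1.
    have -> : u = 0%MM by apply/eqP; rewrite -mdeg_eq0; lia.
    by rewrite big1 ?subrr => [|l _]; [exact: ord_ge0 | rewrite mnm0E].
  have [v le_v dv] := submonomial (geq_minl (mdeg u) s).
  have eu : u = (v + (u - v))%MM by rewrite addmC submK.
  have du : (mdeg u = mdeg v + mdeg (u - v))%N by rewrite {1}eu mdegD.
  have [|f2 [d2 o2 z2]] := IH (u - v)%MM; first by nia.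
  pose y (w : 'X_{1..3}) : poly := \prod_l ('X_l - (c i l)%:MP) ^+ w l.
  have [f1 [d1 Hf1]] := H (fun x => if x == i then y v else 0).
  have o1 : ord_ge (c i) (mdeg v).+1 (f1 - y v).
    have [_ [-> ]] := Hf1 i; rewrite eqxx subr0 => h.
    rewrite -opprB -scaleN1r; apply: ord_geZ; apply: ord_geW h.
    by rewrite dv ltnS geq_minr.
  have oy w : ord_ge (c i) (mdeg w) (y w) by exact: ord_ge_monom.
  have of1 : ord_ge (c i) (mdeg v) f1.
    by rewrite -(subrK (y v) f1); apply: ord_geD => //; apply: ord_geW o1.
  exists (f1 * f2); split=> [||l nl].
  - by rewrite mulSn; apply: deg_leM.
  - have -> : \prod_l ('X_l - (c i l)%:MP) ^+ u l = y v * y (u - v)%MM.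
      rewrite -big_split; apply: eq_bigr => l _ /=.
      by rewrite -exprD -mnmDE -eu.
    rewrite (_ : _ - _ = f1 * (f2 - y (u - v)%MM) + (f1 - y v) * y (u - v)%MM).
      by rewrite du; apply: ord_geD; [rewrite -addnS | rewrite -addSn]; apply: ord_geM.
    by ring.
  - rewrite mulSn; apply: ord_geM; last exact: z2.
    have [_ [-> ]] := Hf1 l; rewrite (negPf nl) subr0 sub0r => h.
    by rewrite -[f1]opprK -scaleN1r; apply: ord_geZ.
apply: jet_surj_triangular; first exact: zero_idealP.
move=> r i g le_r Hg.
pose h := pihomog mdeg r (translate (c i) g).
have hr : h \is r.-homog by exact: pihomogP.
have step (u : 'X_{1..3}) : exists f : poly, mdeg u = r -> [/\ deg_le (q * d0) f,
        ord_ge (c i) r.+1 (f - \prod_l ('X_l - (c i l)%:MP) ^+ u l) &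
        forall l, l != i -> ord_ge (c l) (q * s.+1) f].
  have [e|ne] := eqVneq (mdeg u) r; last by exists 0 => e; rewrite e eqxx in ne.
  have [|f Hf] := monom i q u; first by lia.
  by exists f => _; rewrite -e.
have [F HF] : exists F : 'X_{1..3 < r.+1} -> poly, forall u : 'X_{1..3 < r.+1}, mdeg u = r ->
   [/\ deg_le (q * d0) (F u),
        ord_ge (c i) r.+1 (F u - \prod_l ('X_l - (c i l)%:MP) ^+ u l) &
        forall l, l != i -> ord_ge (c l) (q * s.+1) (F u)].
  by have [F HF] := fin_all_exists (fun u : 'X_{1..3 < r.+1} => step u); exists F.
have hE : h = \sum_(u : 'X_{1..3 < r.+1} | mdeg u == r) h@_u *: 'X_[u].
  rewrite {1}(@mpolywE _ _ r.+1 h); last first.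
    by apply/deg_le_msupp => u hu; rewrite (dhomog_mf hr hu).
  rewrite [RHS]big_mkcond /=; apply: eq_bigr => u _; case: eqP => // /eqP ne.
  by rewrite (dhomog_nemf_coeff hr ne) scale0r.
have lh : low_order r.+1 (translate (c i) g - h) by exact: low_order_leading.
clearbody h.
exists (\sum_(u : 'X_{1..3 < r.+1} | mdeg u == r) h@_u *: F u); split=> [||l nl].
- by apply: deg_le_sum => u /eqP hu; apply: deg_leZ; case: (HF u hu).
- apply: ord_mod_ord; first exact: zero_idealP.
  set S := \sum_(u | _) _; pose h' := translate (fun l => - c i l) h.
  rewrite (_ : _ - _ = (g - h') - (S - h')); last by ring.
  apply: ord_geB; first by rewrite /ord_ge raddfB /= translateKV.
  rewrite /h' hE comp_mpoly_sum /S mpoly_sumB; apply: ord_ge_sum => u /eqP hu.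
  rewrite comp_mpolyZ -scalerBr; apply: ord_geZ; have [_ + _] := HF u hu.
  congr (ord_ge _ _ (_ - _)); rewrite comp_mpolyX; apply: eq_bigr => l _.
  by rewrite tnth_mktuple mpolyCN.
- apply: ord_mod_ord; first exact: zero_idealP.
  apply: ord_ge_sum => u /eqP hu; apply: ord_geZ; have [_ _ /(_ l nl)] := HF u hu.
  by apply: ord_geW; nia.
Qed.

(* Bezout's inequality for [F] and two general members of the linear system of
   forms of degree [d0] vanishing to order [s] at the points. *)
Theorem jet_surj_bezout d0 s d m F : (0 < d0)%N -> jets (fun=> s.+1) d0 ->
  F != 0 -> deg_le d F -> (forall x, ord_ge (c x) m F) ->
  (#|T| * m * s ^ 2 <= d * d0 ^ 2)%N.
Proof.
move=> d0_gt0 H nzF Hd Ho.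
have [->|s_gt0] := posnP s; first by rewrite muln0.
(* In degree [q * d0] and order [q * s], the [m] top layers of jets at each point are weighed
   against the polynomials of the [d] top degrees. The coefficients of [q ^ 2] then give the
   inequality. *)
have key q : (0 < q)%N -> (d <= q * d0)%N -> (m <= q * s)%N ->
    (#|T| * (m * (q * s - m) ^ 2) <= d * (q * d0 + 2) ^ 2)%N.
  move=> q_gt0 le1 le2.
  have := jet_count nzF Hd Ho le1 (leqW le2) (jet_surj_product q_gt0 H).
  have -> : ((q * d0).+1 = (q * d0 - d).+1 + d)%N by lia.
  have -> : ((q * s).+1 = ((q * s).+1 - m) + m)%N by lia.
  rewrite addnK !card_bmultinom3_diff.
  have := sum_triangular_upper d (q * d0 - d).+1.
  have := sum_triangular_lower m ((q * s).+1 - m).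
  set A := (\sum_(_ <= e < _) _)%N; set B := (\sum_(_ <= e < _) _)%N.
  move: #|{: 'X_{1..3 < _}}| #|{: 'X_{1..3 < _}}| => x y h1 h2 h3.
  rewrite mulnDr in h3; have {}h3 : (#|T| * A <= B)%N by lia.
  apply: (@leq_trans (2 * (#|T| * A))%N).
    rewrite [X in (_ <= X)%N]mulnCA leq_mul2l; apply/orP; right; apply: leq_trans h1.
    by rewrite leq_mul2l leq_sqr; apply/orP; right; lia.
  apply: (@leq_trans (2 * B)%N); first by rewrite leq_mul2l h3 orbT.
  apply: leq_trans h2 _; rewrite leq_mul2l leq_sqr; apply/orP; right; lia.
(* The conditions of [key] are met after shifting [q] by [(d + m).+1]; [e] is the corresponding
   shift of [q * d0 + 2] and does not affect the leading coefficient. *)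
pose e := ((d + m).+1 * d0 + 2)%N.
apply: (@quadratic_growth _ _ (2 * d * d0 * e) (d * e ^ 2)) => q.
have Hq : (#|T| * (m * (q * s) ^ 2) <= d * (q * d0 + e) ^ 2)%N.
  have le1 : (d <= (q + (d + m).+1) * d0)%N by nia.
  have le2 : (m <= (q + (d + m).+1) * s)%N by nia.
  have := key _ (ltn_addl _ (ltn0Sn _)) le1 le2;
  have -> : ((q + (d + m).+1) * d0 + 2 = q * d0 + e)%N by rewrite /e; nia.
  apply: leq_trans.
  rewrite !leq_mul2l leq_sqr; apply/orP; right; apply/orP; right; nia.
have -> : (#|T| * m * s ^ 2 * q ^ 2 = #|T| * (m * (q * s) ^ 2))%N by rewrite expnMn; lia.
apply: leq_trans Hq _; rewrite sqrnD expnMn; nia.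
Qed.

End Seshadri.

Lemma digits_inj N B (m m' : 'I_N -> nat) :
  (forall i, m i < B)%N -> (forall i, m' i < B)%N ->
  (\sum_i m i * B ^ i = \sum_i m' i * B ^ i)%N -> m =1 m'.
Proof.
elim: N m m' => [|N IH] m m' Hm Hm'; first by move=> _ [].
have E (f : 'I_N.+1 -> nat) : (\sum_i f i * B ^ i =
    (\sum_i f (lift ord0 i) * B ^ i) * B + f ord0)%N.
  rewrite big_ord_recl expn0 muln1 addnC big_distrl /=; congr (_ + _)%N.
  by apply: eq_bigr => i _; rewrite expnSr mulnA.
rewrite !E => h.
have B_gt0 : (0 < B)%N by apply: leq_ltn_trans (Hm ord0).
have h0 : m ord0 = m' ord0.
  by have := congr1 (modn^~ B) h; rewrite !modnMDl !modn_small.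
have h1 : (\sum_i m (lift ord0 i) * B ^ i = \sum_i m' (lift ord0 i) * B ^ i)%N.
  by have := congr1 (divn^~ B) h; rewrite !divnMDl // !divn_small // !addn0.
move=> i; case: (unliftP ord0 i) => [j ->|-> //].
by apply: (IH (fun j => m (lift ord0 j)) (fun j => m' (lift ord0 j))).
Qed.

(** * Generic configurations in characteristic zero *)

Section Generic.
Variables (K : fieldType) (charK0 : [pchar K] =i pred0).

Lemma natr_eq0 (x : nat) : (x%:R == 0 :> K) = (x == 0)%N.
Proof. exact: (proj1 (pcharf0P K) charK0). Qed.

Lemma natr_inj : injective (fun x : nat => x%:R : K).
Proof.
suff W x y : (x <= y)%N -> x%:R = y%:R :> K -> x = y.
  by move=> x y; case/orP: (leq_total x y) => h e; [apply: W|apply/esym/W].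
move=> le e; have := natr_eq0 (y - x); rewrite natrB // e subrr eqxx.
by move/esym/eqP; lia.
Qed.

(* Kronecker substitution *)
Lemma mpoly_nonvanishing N (p : {mpoly K[N]}) : p != 0 ->
  exists v : 'I_N -> K, p.@[v] != 0.
Proof.
move=> nz; pose B := msize p; pose w (u : 'X_{1..N}) := (\sum_i u i * B ^ i)%N.
pose q : {poly K} := \sum_(u <- msupp p) p@_u *: 'X^(w u).
have Hdeg u i : u \in msupp p -> (u i < B)%N.
  move=> hu; apply: leq_ltn_trans (msize_mdeg_lt hu).
  by rewrite mdegE (bigD1 i) //= leq_addr.
have nzq : q != 0.
  apply/eqP => q0; have hl := mlead_supp nz.
  have := congr1 (fun r : {poly K} => r`_(w (mlead p))) q0.
  rewrite coef0 /q coef_sum (bigD1_seq (mlead p)) ?msupp_uniq //=.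
  rewrite coefZ coefXn eqxx mulr1 big_seq_cond big1 ?addr0 => [h|u /andP[hu nu]].
    by move: hl; rewrite mcoeff_msupp h eqxx.
  rewrite coefZ coefXn; case: eqP => [e|]; last by rewrite mulr0.
  case/eqP: nu; apply/mnmP; apply: (digits_inj _ _ (esym e)) => i; exact: Hdeg.
have [x Hx] : exists x : nat, q.[x%:R] != 0.
  pose s := [seq x%:R : K | x <- iota 0 (size q)].
  have us : uniq s by rewrite map_inj_uniq ?iota_uniq //; apply: natr_inj.
  have := max_poly_roots nzq _ us; rewrite size_map size_iota ltnn => h.
  have /allPn[_ /mapP[x _ ->] nx] : ~~ all (root q) s.
    by apply/negP => /h.
  by exists x.
exists (fun i => x%:R ^+ (B ^ i)).
suff -> : p.@[fun i : 'I_N => x%:R ^+ (B ^ i)] = q.[x%:R] by [].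
rewrite mevalE horner_sum; apply: eq_bigr => u _.
rewrite hornerZ hornerXn -prodrXr; congr (_ * _); apply: eq_bigr => i _.
by rewrite -exprM mulnC.
Qed.

Section Configurations.
Variables (n N : nat).

Definition config_eval (a : 'I_n -> 'I_N -> K) : 'I_(n * N) -> K :=
  fun v => mxvec (\matrix_(j, i) a j i) 0 v.

Lemma config_evalE a j i : config_eval a (mxvec_index j i) = a j i.
Proof. by rewrite /config_eval mxvecE mxE. Qed.

(** An explicit nonzero polynomial on affine configurations is kept as witness, so that finite
    conjunctions multiply the witnesses. *)
Definition generic (P : ('I_n -> 'I_N -> K) -> Prop) : Prop :=
  exists2 Phi : {mpoly K[n * N]}, Phi != 0 &
    forall a, Phi.@[config_eval a] != 0 -> P a.

Lemma genericI P Q : generic P -> generic Q -> generic (fun a => P a /\ Q a).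
Proof.
move=> [p nzp Hp] [q nzq Hq]; exists (p * q); first exact: mulf_neq0.
by move=> a; rewrite mevalM mulf_eq0 => /norP[/Hp ? /Hq ?].
Qed.

Lemma genericW (P Q : ('I_n -> 'I_N -> K) -> Prop) :
  (forall a, P a -> Q a) -> generic P -> generic Q.
Proof. by move=> H [p nzp Hp]; exists p => // a /Hp /H. Qed.

Lemma generic_all (T : finType) (P : T -> ('I_n -> 'I_N -> K) -> Prop) :
  (forall x, generic (P x)) -> generic (fun a => forall x, P x a).
Proof.
move=> H; have {}H x : exists p : {mpoly K[n * N]}, p != 0 /\
    forall a, p.@[config_eval a] != 0 -> P x a by have [p ? ?] := H x; exists p.
have [p Hp] := fin_all_exists H.
exists (\prod_x p x); first by apply/prodf_neq0 => x _; case: (Hp x).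
move=> a; rewrite rmorph_prod /= => /prodf_neq0 h x.
by case: (Hp x) => _; apply; apply: h.
Qed.

(** A maximal minor of the jet matrix that is nonzero at [c0] is a nonzero polynomial in the
    coordinates, and wherever it does not vanish the rank is maximal. Only the points in the image
    of [iota] are constrained, which lets special configurations have fewer than [n] points. *)
Lemma generic_jets (T : finType) (iota : T -> 'I_n) d s : injective iota ->
  (exists c : T -> 'I_N -> K, jet_surj c (@zero_ideal K N) (fun=> s) d) ->
  generic (fun a => jet_surj (fun x => a (iota x)) (@zero_ideal K N) (fun=> s) d).
Proof.
move=> inj [c0 /jet_surjP full].
pose gen (x : T) (i : 'I_N) : {mpoly K[n * N]} := 'X_(mxvec_index (iota x) i).
have evalM a : map_mx (meval (config_eval a)) (jetmx gen d s)
             = jetmx (fun x => a (iota x)) d s.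
  rewrite (map_jetmx (meval (config_eval a))).
  apply/matrixP => i j; rewrite !mxE; congr (mcoeff _ (comp_mpoly _ _)).
  by apply: eq_from_tnth => l; rewrite !tnth_mktuple /gen /= mevalXU config_evalE.
pose f := fullrankfun full; pose Phi := \det (rowsub f (jetmx gen d s)).
have evalP a : Phi.@[config_eval a] = \det (rowsub f (jetmx (fun x => a (iota x)) d s)).
  rewrite /Phi -[LHS](det_map_mx (meval (config_eval a))) -evalM.
  by congr (\det _); apply/matrixP => i j; rewrite !mxE.
exists Phi => [|a].
  (* Points outside the image of [iota] do not enter the minor; they are put at the origin. *)
  pose a0 j : 'I_N -> K := if [pick x | iota x == j] is Some x then c0 x else fun=> 0.
  have Ea0 : jetmx (fun x => a0 (iota x)) d s = jetmx c0 d s.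
    apply/matrixP => i j; rewrite !mxE; congr (mcoeff _ (comp_mpoly _ _)).
    apply: eq_from_tnth => l; rewrite !tnth_mktuple /a0.
    by case: pickP => [x /eqP /inj -> //|/(_ (enum_val j).1)]; rewrite eqxx.
  apply/eqP => P0; have := evalP a0; rewrite P0 meval0 Ea0 => /esym/eqP.
  have := fullrowsub_unit full; rewrite unitmxE unitfE -/f => /negPf -> //.
rewrite evalP -unitfE -unitmxE => /mxrank_unit rk; apply/jet_surjP.
rewrite /row_full eqn_leq rank_leq_col -{1}rk.
by rewrite rowsubE; apply: mxrankM_maxr.
Qed.

End Configurations.
End Generic.

(** * Points in general position *)

Lemma big_mxvec_index (R : Type) (idx : R) (op : Monoid.com_law idx) n m
    (F : 'I_(n * m) -> R) :
  \big[op/idx]_v F v = \big[op/idx]_(j < n) \big[op/idx]_(i < m) F (mxvec_index j i).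
Proof.
rewrite pair_bigA (reindex _ (curry_mxvec_bij n m)) /=.
by apply: eq_bigr => -[j i] _.
Qed.

Section Homogenize.
Variables (K : fieldType) (n N : nat).

Definition affine_point (a : 'I_N -> K) : 'rV[K]_N.+1 :=
  \row_i if unlift ord0 i is Some j then a j else 1.

Lemma affine_point_neq0 a : affine_point a != 0.
Proof.
apply/eqP => /(congr1 (fun v : 'rV_ _ => v 0 ord0)) /eqP.
by rewrite !mxE unlift_none oner_eq0.
Qed.

Definition has_affine_coords (p : proj_point K N) (a : 'I_N -> K) : Prop :=
  exists2 x : K, x != 0 & val p = x *: affine_point a.

Definition multihomog_mnm e (u : 'X_{1..n * N}) : 'X_{1..n * N.+1} :=
  [multinom mxvec (\matrix_(j < n, i < N.+1) if unlift ord0 i is Some l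
     then u (mxvec_index j l) else (e - \sum_l u (mxvec_index j l))%N) ord0 v
   | v < n * N.+1].

Lemma multihomog_mnmE e u j i : multihomog_mnm e u (mxvec_index j i) =
  if unlift ord0 i is Some l then u (mxvec_index j l)
  else (e - \sum_l u (mxvec_index j l))%N.
Proof. by rewrite mnmE mxvecE mxE. Qed.

(** The exponent [msize p] exceeds the degree of [p] in each block of variables, so the zeroth
    coordinate of every factor divides every monomial. Nonvanishing therefore also forces all the
    points into the affine chart. *)
Definition multihomog (p : {mpoly K[n * N]}) : {mpoly K[n * N.+1]} :=
  \sum_(u <- msupp p) p@_u *: 'X_[multihomog_mnm (msize p) u].

Lemma sum_block_lt (p : {mpoly K[n * N]}) u j : u \in msupp p ->
  (\sum_l u (mxvec_index j l) < msize p)%N.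
Proof.
move/msize_mdeg_lt; apply: leq_ltn_trans.
by rewrite mdegE big_mxvec_index (bigD1 j) //= leq_addr.
Qed.

Lemma multihomogP p : multihomogeneous (multihomog p).
Proof.
exists (fun=> msize p) => m /msupp_sum_le /flattenP[_ /mapP[u + ->]].
rewrite filter_predT => hu /msuppZ_le /mem_msuppXP <- j.
rewrite big_ord_recl multihomog_mnmE unlift_none.
have -> : (\sum_(l < N) multihomog_mnm (msize p) u (mxvec_index j (lift ord0 l)) =
    \sum_l u (mxvec_index j l))%N.
  by apply: eq_bigr => l _; rewrite multihomog_mnmE liftK.
by rewrite subnK // ltnW // sum_block_lt.
Qed.

Lemma multihomog_affine p (q : 'I_n -> proj_point K N) (x : 'I_n -> K) a :
  (forall j, val (q j) = x j *: affine_point (a j)) ->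
  meval_points (multihomog p) q = (\prod_j x j ^+ msize p) * p.@[config_eval a].
Proof.
move=> Hq; rewrite /meval_points meval_sum mevalE mulr_sumr big_seq [RHS]big_seq.
apply: eq_bigr => u hu; rewrite mevalZ mulrCA; congr (_ * _).
rewrite mevalX !big_mxvec_index -big_split /=; apply: eq_bigr => j _.
rewrite big_ord_recl multihomog_mnmE unlift_none mxvecE mxE Hq !mxE unlift_none mulr1.
rewrite (eq_bigr (fun l => x j ^+ u (mxvec_index j l) * a j l ^+ u (mxvec_index j l))).
  rewrite big_split /= mulrA prodrXr -exprD subnK; last by rewrite ltnW // sum_block_lt.
  by congr (_ * _); apply: eq_bigr => l _; rewrite config_evalE.
by move=> l _; rewrite multihomog_mnmE liftK mxvecE mxE Hq !mxE liftK exprMn.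
Qed.

Lemma multihomog_nonzero p (q : 'I_n -> proj_point K N) :
  meval_points (multihomog p) q <> 0 -> forall j, val (q j) 0 ord0 != 0.
Proof.
move=> nz j; apply/eqP => h; apply: nz.
rewrite /meval_points meval_sum big_seq big1 // => u hu.
rewrite mevalZ mevalX big_mxvec_index (bigD1 j) //= (bigD1 ord0) //=.
rewrite multihomog_mnmE unlift_none mxvecE mxE h expr0n.
by rewrite subn_eq0 leqNgt sum_block_lt // !mul0r mulr0.
Qed.

Lemma generic_general (charK0 : [pchar K] =i pred0)
    (P : ('I_n -> proj_point K N) -> Prop) (Q : ('I_n -> 'I_N -> K) -> Prop) :
  generic Q ->
  (forall q a, (forall j, has_affine_coords (q j) (a j)) -> Q a -> P q) ->
  in_general_position P.
Proof.
move=> [p nzp Hp] HQ.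
exists (fun q => exists F, F = multihomog p /\ meval_points F q <> 0); split.
- exists (fun F => F = multihomog p); split=> [F ->|q //]; exact: multihomogP.
- have [v Hv] := mpoly_nonvanishing charK0 nzp.
  pose a j i := v (mxvec_index j i).
  exists (fun j => exist _ (affine_point (a j)) (affine_point_neq0 (a j))).
  exists (multihomog p); split=> //.
  rewrite (@multihomog_affine _ _ (fun=> 1) a) => [|j]; last by rewrite scale1r.
  rewrite big1 ?mul1r => [|j _]; last by rewrite expr1n.
  apply/eqP; rewrite (@meval_eq _ _ _ v) // => w.
  by case/mxvec_indexP: w => j i; rewrite config_evalE.
- move=> q [_ [-> nz]]; have nz0 := multihomog_nonzero nz.
  pose a j i := val (q j) 0 (lift ord0 i) / val (q j) 0 ord0.
  have Hq j : val (q j) = val (q j) 0 ord0 *: affine_point (a j).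
    apply/rowP => i; rewrite !mxE; case: (unliftP ord0 i) => [l ->|->].
      by rewrite /a mulrCA mulfV ?mulr1.
    by rewrite mulr1.
  apply: (HQ q a) => [j|]; first by exists (val (q j) 0 ord0).
  apply: Hp; apply/eqP => h; apply: nz.
  by rewrite (multihomog_affine _ Hq) h mulr0.
Qed.

End Homogenize.

(** * Ideals of points *)

Section IdealPowers.
Variable R : comNzRingType.
Implicit Types (I J : R -> Prop) (f g : R).

Lemma ideal_mul_mem I J f g : I f -> J g -> ideal_mul I J (f * g).
Proof.
move=> If Jg; exists [:: (f, g)]; split; last by rewrite big_seq1.
by move=> ab; rewrite inE => /eqP ->.
Qed.

Lemma ideal_mul0 I J : ideal_mul I J 0.
Proof. by exists [::]; split=> //; rewrite big_nil. Qed.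

Lemma ideal_mulD I J f g : ideal_mul I J f -> ideal_mul I J g -> ideal_mul I J (f + g).
Proof.
move=> [s [Hs ->]] [s' [Hs' ->]]; exists (s ++ s'); split; last by rewrite big_cat.
by move=> ab; rewrite mem_cat => /orP[/Hs|/Hs'].
Qed.

Lemma ideal_mul_sum I J (T : Type) (r : seq T) (P : pred T) (F : T -> R) :
  (forall i, P i -> ideal_mul I J (F i)) -> ideal_mul I J (\sum_(i <- r | P i) F i).
Proof.
by move=> H; elim/big_ind: _ => //; [exact: ideal_mul0 | exact: ideal_mulD].
Qed.

Lemma ideal_mulP I J (Q : R -> Prop) : Q 0 -> (forall f g, Q f -> Q g -> Q (f + g)) ->
  (forall f g, I f -> J g -> Q (f * g)) -> forall f, ideal_mul I J f -> Q f.
Proof.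
move=> Q0 QD QM _ [s [Hs ->]]; rewrite big_seq; elim/big_ind: _ => // ab /Hs[].
exact: QM.
Qed.

Lemma ideal_powD I k f g : ideal_pow I k f -> ideal_pow I k g -> ideal_pow I k (f + g).
Proof. by case: k => [//|k]; apply: ideal_mulD. Qed.

Lemma ideal_pow0 I k : ideal_pow I k 0.
Proof. by case: k => [//|k]; apply: ideal_mul0. Qed.

Lemma ideal_powM I k f g : ideal_pow I k g -> ideal_pow I k (f * g).
Proof.
elim: k g => [//|k IH] g; move: g; apply: ideal_mulP => [|g h|a b Ia Jb].
- by rewrite mulr0; apply: ideal_mul0.
- by rewrite mulrDr; apply: ideal_mulD.
- by rewrite mulrCA; apply: ideal_mul_mem => //; apply: IH.
Qed.

Lemma ideal_pow_mul I k l f g :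
  ideal_pow I k f -> ideal_pow I l g -> ideal_pow I (k + l) (f * g).
Proof.
elim: k f => [|k IH] f; first by move=> _; apply: ideal_powM.
move=> Hf Hg; move: f Hf; apply: ideal_mulP => [|f h|a b Ia Jb].
- by rewrite mul0r; apply: ideal_mul0.
- by rewrite mulrDl; apply: ideal_mulD.
- by rewrite -mulrA; apply: ideal_mul_mem => //; apply: IH.
Qed.

Lemma ideal_powW I k l f : (k <= l)%N -> ideal_pow I l f -> ideal_pow I k f.
Proof.
move=> le_kl; rewrite -(subnK le_kl); elim: (l - k)%N f => [//|m IH] f.
move: f; apply: ideal_mulP => [|f g|a b Ia Jb]; first exact: ideal_pow0.
  exact: ideal_powD.
by apply: ideal_powM; apply: IH.
Qed.

Lemma ideal_pow_mem I f k : I f -> ideal_pow I k (f ^+ k).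
Proof.
by move=> If; elim: k => [//|k IH]; rewrite exprS; apply: ideal_mul_mem.
Qed.

Lemma ideal_pow_prod I (T : Type) (r : seq T) (P : pred T) (F : T -> R) w :
  (forall i, P i -> ideal_pow I (w i) (F i)) ->
  ideal_pow I (\sum_(i <- r | P i) w i)%N (\prod_(i <- r | P i) F i).
Proof.
by move=> H; elim/big_ind2: _ => //; move=> ? ? ? ?; apply: ideal_pow_mul.
Qed.

Variables M I : R -> Prop.

Definition mixed_pow (a r : nat) : R -> Prop :=
  ideal_mul (ideal_pow M a) (ideal_pow I r).

Lemma mixed_powM a r b s f g :
  mixed_pow a r f -> mixed_pow b s g -> mixed_pow (a + b) (r + s) (f * g).
Proof.
move=> Hf Hg; move: f Hf; apply: ideal_mulP => [|f h|x y Mx Iy].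
- by rewrite mul0r; apply: ideal_mul0.
- by rewrite mulrDl; apply: ideal_mulD.
move: g Hg; apply: ideal_mulP => [|f h|x' y' Mx' Iy'].
- by rewrite mulr0; apply: ideal_mul0.
- by rewrite mulrDr; apply: ideal_mulD.
by rewrite mulrACA; apply: ideal_mul_mem; apply: ideal_pow_mul.
Qed.

Lemma mixed_powW a b r s f : (a <= b)%N -> (r <= s)%N ->
  mixed_pow b s f -> mixed_pow a r f.
Proof.
move=> le_ab le_rs; move: f; apply: ideal_mulP => [|f g|x y Mx Iy].
- exact: ideal_mul0.
- exact: ideal_mulD.
- by apply: ideal_mul_mem; [exact: ideal_powW Mx | exact: ideal_powW Iy].
Qed.

End IdealPowers.

(** * Forms and their dehomogenizations *)

Section Dehomogenize.
Variables (K : fieldType) (N : nat).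
Local Notation poly := {mpoly K[N]}.
Local Notation form := {mpoly K[N.+1]}.

Definition dehom (F : form) : poly :=
  F \mPo [tuple if unlift ord0 i is Some l then 'X_l else 1 | i < N.+1].

Definition mnm_tail (u : 'X_{1..N.+1}) : 'X_{1..N} :=
  [multinom u (lift ord0 l) | l < N].

Definition mnm_cons (x : nat) (u : 'X_{1..N}) : 'X_{1..N.+1} :=
  [multinom if unlift ord0 i is Some l then u l else x | i < N.+1].

Lemma mdeg_cons x u : mdeg (mnm_cons x u) = (x + mdeg u)%N.
Proof.
rewrite !mdegE big_ord_recl mnmE unlift_none; congr (_ + _)%N.
by apply: eq_bigr => l _; rewrite mnmE liftK.
Qed.

Lemma mdeg_tail (u : 'X_{1..N.+1}) : mdeg u = (u ord0 + mdeg (mnm_tail u))%N.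
Proof.
rewrite !mdegE big_ord_recl; congr (_ + _)%N.
by apply: eq_bigr => l _; rewrite mnmE.
Qed.

Lemma mnm_cons_tail (u : 'X_{1..N.+1}) : mnm_cons (u ord0) (mnm_tail u) = u.
Proof.
by apply/mnmP => i; rewrite mnmE; case: (unliftP ord0 i) => [l ->|-> //]; rewrite mnmE.
Qed.

Lemma mnm_tail_cons x u : mnm_tail (mnm_cons x u) = u.
Proof. by apply/mnmP => l; rewrite !mnmE liftK. Qed.

Lemma dehomX u : dehom 'X_[u] = 'X_[mnm_tail u].
Proof.
rewrite /dehom comp_mpolyX big_ord_recl tnth_mktuple unlift_none expr1n mul1r.
rewrite [RHS]mpolyXE_id; apply: eq_bigr => l _.
by rewrite tnth_mktuple liftK mnmE.
Qed.

Lemma dehomZ c F : dehom (c *: F) = c *: dehom F.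
Proof. exact: comp_mpolyZ. Qed.

Lemma dehomD F G : dehom (F + G) = dehom F + dehom G.
Proof. exact: raddfD. Qed.

Lemma dehom0 : dehom 0 = 0.
Proof. exact: raddf0. Qed.

Lemma dehom_eval F a : (dehom F).@[a] = F.@[fun i => affine_point a 0 i].
Proof.
rewrite comp_mpoly_meval; apply: meval_eq => i; rewrite tnth_mktuple mxE.
by case: (unlift ord0 i) => [l|]; rewrite ?mevalXU ?meval1.
Qed.

(** The target degree is prescribed instead of being that of [f], which makes the map linear and
    inverse to [dehom] on forms of degree [d]; terms of degree above [d] are dropped. *)
Definition homogenize (d : nat) (f : poly) : form :=
  \sum_(u : 'X_{1..N < d.+1}) f@_u *: 'X_[mnm_cons (d - mdeg u) u].

Lemma homogenizeD d f g : homogenize d (f + g) = homogenize d f + homogenize d g.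
Proof. by rewrite -big_split; apply: eq_bigr => u _; rewrite mcoeffD scalerDl. Qed.

Lemma homogenize0 d : homogenize d 0 = 0.
Proof. by rewrite /homogenize big1 // => u _; rewrite mcoeff0 scale0r. Qed.

Lemma homogenizeZ d c f : homogenize d (c *: f) = c *: homogenize d f.
Proof.
by rewrite scaler_sumr; apply: eq_bigr => u _; rewrite mcoeffZ scalerA.
Qed.

Lemma homogenizeP d f : homogenize d f \is d.-homog.
Proof.
apply: rpred_sum => u _; apply: rpredZ; rewrite dhomogX /= mdeg_cons subnK //.
by rewrite -ltnS bmdeg.
Qed.

Lemma homogenizeX d u : (mdeg u <= d)%N ->
  homogenize d 'X_[u] = 'X_[mnm_cons (d - mdeg u) u].
Proof.
rewrite -ltnS => hu; rewrite /homogenize (bigD1 (BMultinom hu)) //=.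
rewrite mcoeffX eqxx scale1r big1 ?addr0 // => v nv; rewrite mcoeffX.
case: eqP => [e|]; last by rewrite scale0r.
by case/eqP: nv; apply: val_inj.
Qed.

Lemma dehomK d F : F \is d.-homog -> homogenize d (dehom F) = F.
Proof.
move=> hF; rewrite [F]mpolyE big_seq; elim/big_ind: _ => [|F1 F2 E1 E2|u hu].
- by rewrite /dehom raddf0 homogenize0.
- by rewrite /dehom raddfD homogenizeD E1 E2.
have <- : mdeg u = d by exact: (dhomog_mf hF hu).
rewrite /dehom comp_mpolyZ -/(dehom _) homogenizeZ dehomX.
rewrite homogenizeX; first by rewrite mdeg_tail addnK mnm_cons_tail.
by rewrite mdeg_tail leq_addl.
Qed.

Lemma homogenizeK d f : deg_le d f -> dehom (homogenize d f) = f.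
Proof.
move=> Hd; rewrite {2}(mpolywE Hd) /dehom /homogenize comp_mpoly_sum.
apply: eq_bigr => u _; rewrite comp_mpolyZ -/(dehom _) dehomX.
by rewrite mnm_tail_cons.
Qed.

Lemma homogenizeM d e f g : deg_le d f -> deg_le e g ->
  homogenize (d + e) (f * g) = homogenize d f * homogenize e g.
Proof.
move=> Hf Hg; rewrite -[RHS](@dehomK (d + e)).
  by rewrite /dehom rmorphM /= -!/(dehom _) !homogenizeK.
by apply: dhomogM; apply: homogenizeP.
Qed.

Lemma meval_scaled d (F : form) (x : K) v : F \is d.-homog ->
  F.@[fun i => x * v i] = x ^+ d * F.@[v].
Proof.
move=> hF; rewrite !mevalE mulr_sumr big_seq [RHS]big_seq; apply: eq_bigr => u hu.
rewrite mulrCA; congr (_ * _); have <- : mdeg u = d by exact: (dhomog_mf hF hu).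
rewrite mdegE -prodrXr -big_split; apply: eq_bigr => i _ /=.
by rewrite exprMn.
Qed.

(* The coefficient of degree [d] is the dehomogenization of the component of
   degree [d]. *)
Definition graded_dehom (F : form) : {poly poly} :=
  mmap (polyC \o @mpolyC N K)
       (fun i => if unlift ord0 i is Some l then 'X * ('X_l)%:P else 'X) F.

Lemma graded_dehomM F G : graded_dehom (F * G) = graded_dehom F * graded_dehom G.
Proof. exact: rmorphM. Qed.

Lemma graded_dehomD F G : graded_dehom (F + G) = graded_dehom F + graded_dehom G.
Proof. exact: raddfD. Qed.

Lemma graded_dehom_sum (T : Type) (r : seq T) (P : pred T) (F : T -> form) :
  graded_dehom (\sum_(i <- r | P i) F i) = \sum_(i <- r | P i) graded_dehom (F i).
Proof. exact: raddf_sum. Qed.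

Lemma graded_dehomE F d : (graded_dehom F)`_d = dehom (pihomog mdeg d F).
Proof.
elim/mpolyind: F => [|c u F _ _ IH].
  by rewrite /graded_dehom mmap0 coef0 pihomog0 dehom0.
rewrite linearP /= dehomD -IH /graded_dehom mmapD coefD.
congr (_ + _); rewrite mmapZ mmapX /= coefCM dehomZ mul_mpolyC.
have -> : mmap1 (fun i => if unlift ord0 i is Some l then 'X * ('X_l)%:P else 'X) u
    = (dehom 'X_[u])%:P * 'X^(mdeg u) :> {poly poly}.
  rewrite dehomX mdegE /mmap1 big_ord_recl unlift_none [in RHS]big_ord_recl.
  rewrite exprD mulrCA; congr (_ * _); rewrite mpolyXE_id rmorph_prod /=.
  rewrite -prodrXr -big_split; apply: eq_bigr => l _ /=.
  by rewrite liftK exprMn mnmE rmorphXn mulrC.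
rewrite coefCM coefXn pihomogX [d == _]eq_sym /=.
have [_|_] := eqVneq (mdeg u) d; first by rewrite mulr1.
by rewrite mulr0 dehom0.
Qed.

(** Here [F] may be inhomogeneous, and so may the factors of its terms. The ring morphism
    [graded_dehom] records all components at once; for a generator of the ideal only one coefficient
    can be nonzero, and it vanishes at [a]. *)
Lemma ideal_pow_ord (p : proj_point K N) a m F : has_affine_coords p a ->
  ideal_pow (point_ideal p) m F ->
  forall d, ord_ge a m (dehom (pihomog mdeg d F)).
Proof.
move=> [x nzx Hp] HF d; rewrite -graded_dehomE; elim: m F HF d => [//|m IH] F.
move: F; apply: ideal_mulP => [d|F G HF HG d|F G [s [Hs ->]] HG d].
- by rewrite /graded_dehom mmap0 coef0; apply: ord_ge0.
- by rewrite graded_dehomD coefD; apply: ord_geD; [exact: HF | exact: HG].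
rewrite graded_dehomM coefM -add1n; apply: ord_ge_sum => i _.
apply: ord_geM; last exact: IH.
rewrite graded_dehom_sum coef_sum big_seq; apply: ord_ge_sum => cg /Hs.
move=> [[e he] hv]; rewrite graded_dehomM coefM; apply: ord_ge_sum => l _.
apply: ord_geMr; rewrite graded_dehomE.
have [->|ne] := eqVneq (i - l)%N e; last first.
  by rewrite (pihomog_ne0 _ he) 1?eq_sym // dehom0; apply: ord_ge0.
rewrite pihomog_dE //; apply/ord_ge1; rewrite dehom_eval.
apply/eqP; have := meval_scaled x (fun i => affine_point a 0 i) he.
have <- : cg.2.@[fun i => val p 0 i] = cg.2.@[fun i => x * affine_point a 0 i].
  by apply: meval_eq => v; rewrite Hp mxE.
by rewrite hv => /esym/eqP; rewrite mulf_eq0 expf_eq0 (negPf nzx) andbF.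
Qed.

End Dehomogenize.

(** * From a degree bound to the containment *)

Section Containment.
Variables (K : fieldType) (N n : nat).
Variables (p : 'I_n -> proj_point K N) (a : 'I_n -> 'I_N -> K).
Hypothesis Hp : forall j, has_affine_coords (p j) (a j).

Local Notation mixed :=
  (mixed_pow (@irrelevant_ideal K N) (points_ideal p)).

Lemma irrelevant_var i : @irrelevant_ideal K N 'X_i.
Proof.
exists [:: (1, 'X_i)]; split; last by rewrite big_seq1 mul1r.
by move=> cg; rewrite inE => /eqP -> /=; exists i.
Qed.

Lemma irrelevant_homog d F : F \is d.-homog ->
  ideal_pow (@irrelevant_ideal K N) d F.
Proof.
move=> hF; rewrite [F]mpolyE big_seq; elim/big_ind: _ => [|? ?|u hu].
- exact: ideal_pow0.
- exact: ideal_powD.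
rewrite -mul_mpolyC; apply: ideal_powM; have <- : mdeg u = d by exact: (dhomog_mf hF hu).
rewrite mdegE mpolyXE_id; apply: ideal_pow_prod => i _.
by apply: ideal_pow_mem; apply: irrelevant_var.
Qed.

Lemma points_ideal_homog d F : F \is d.-homog ->
  (forall j, F.@[fun i => affine_point (a j) 0 i] = 0) -> points_ideal p F.
Proof.
move=> hF HF j; exists [:: (1, F)]; split; last by rewrite big_seq1 mul1r.
move=> cg; rewrite inE => /eqP -> /=; split; first by exists d.
have [x _ Ex] := Hp j.
have -> : F.@[fun i => val (p j) 0 i] = F.@[fun i => x * affine_point (a j) 0 i].
  by apply: meval_eq => i; rewrite Ex mxE.
by rewrite (meval_scaled x _ hF) HF mulr0.
Qed.

Lemma points_ideal_homogenize d f : vanishing_in a d f ->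
  points_ideal p (homogenize d f).
Proof.
move=> [Hd Hv]; apply: points_ideal_homog (homogenizeP d f) _ => j.
by rewrite -dehom_eval homogenizeK.
Qed.

Variables (t delta : nat).
Hypothesis interp : jet_surj a (@zero_ideal K N) (fun=> 1%N) t.
Hypothesis Hdelta : forall u, vanishing_in a t.+1 u ->
  mixed delta 1 (homogenize t.+1 u).
Hypothesis delta_le2 : (delta <= 2)%N.

Lemma powspan_mixed E r f : powspan (vanishing_in a t.+1) E r f ->
  deg_le (r * t.+1 + E) f /\
  mixed (r * delta + E) r (homogenize (r * t.+1 + E) f).
Proof.
elim=> {r f} [g Hg|r u w Iu _ [IHd IH]|r|r v w _ [d1 h1] _ [d2 h2]].
- rewrite !mul0n !add0n; split=> //; rewrite -[homogenize _ _]mulr1.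
  apply: ideal_mul_mem => //; exact/irrelevant_homog/homogenizeP.
- have Hd : deg_le t.+1 u by case: Iu.
  rewrite !mulSn -!addnA; split; first exact: deg_leM.
  by rewrite homogenizeM //; have := mixed_powM (Hdelta Iu) IH; rewrite add1n.
- by split; [exact: deg_le0 | rewrite homogenize0; apply: ideal_mul0].
- by split; [exact: deg_leD | rewrite homogenizeD; apply: ideal_mulD].
Qed.

(** A form of degree [D] and order at least [r] at the points is a sum of products of [r] elements
    of [I] of degree [t.+1] and a cofactor of degree [D - r * t.+1]. With [delta] linear factors
    gained from each element, the exponent of the irrelevant ideal is [D - r * t.+1 + r * delta],
    and [bound] says that it is at least [2 * r]. The order [3 * r] enters through [bound]. *)
Theorem symbolic_containment r :
  (forall f D, f != 0 -> deg_le D f -> (forall j, ord_ge (a j) (3 * r) f) ->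
     (r * (t + 3) <= D + r * delta)%N) ->
  subideal (symbolic_power p (3 * r))
           (ideal_mul (ideal_pow (@irrelevant_ideal K N) (2 * r))
                      (ideal_pow (points_ideal p) r)).
Proof.
move=> bound F HF.
have [e [deg_e eval_e]] : exists e : 'I_n -> {mpoly K[N]},
    (forall j, deg_le t (e j)) /\ (forall i j, (e i).@[a j] = (i == j)%:R).
  have step i : exists f : {mpoly K[N]}, deg_le t f /\ forall j, f.@[a j] = (i == j)%:R.
    have [f [Hd Hf]] := interp (fun j => (i == j)%:R%:MP).
    exists f; split=> // j; have [_ [-> ]] := Hf j; rewrite subr0 => /ord_ge1/eqP.
    by rewrite mevalB mevalC subr_eq0 => /eqP.
  have [e He] := fin_all_exists step.
  by exists e; split=> [j|i j]; [case: (He j) | case: (He i)].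
rewrite (pihomog_partitionE (mf := mdeg) (leqnn (msize F))).
apply: ideal_mul_sum => d _; set G := pihomog mdeg d F.
have hG : G \is d.-homog by exact: pihomogP.
rewrite -(dehomK hG); set f := dehom G.
have Hf : deg_le d f.
  rewrite /f [G]mpolyE /dehom comp_mpoly_sum big_seq; apply: deg_le_sum => u hu.
  rewrite comp_mpolyZ; apply: deg_leZ; rewrite -/(dehom _) dehomX.
  apply: deg_leW (deg_leX _ _); rewrite -(dhomog_mf hG hu) /=.
  by rewrite [X in (_ <= X)%N]mdeg_tail leq_addl.
have Ho j : ord_ge (a j) (3 * r) f by apply: ideal_pow_ord (Hp j) (HF j) d.
have [->|nzf] := eqVneq f 0; first by rewrite homogenize0; apply: ideal_mul0.
have led := bound f d nzf Hf Ho.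
(* By [delta_le2], the allowance [r * delta] never brings the degree below that of [r] factors from
   [I]. *)
have led' : (r * t.+1 <= d)%N by nia.
have Hf' : deg_le (r * t.+1 + (d - r * t.+1)) f by rewrite subnKC.
have Ho' j : ord_ge (a j) r f by apply: ord_geW (Ho j); lia.
have [_] := powspan_mixed (symbolic_powspan deg_e eval_e Hf' Ho').
by rewrite subnKC //; apply: mixed_powW => //; nia.
Qed.

End Containment.

(** * Grids and principal lattices *)

Section Special.
Variables (K : fieldType) (charK0 : [pchar K] =i pred0) (N : nat).
Local Notation poly := {mpoly K[N]}.

Lemma jet_surj_sub (T S : finType) (h : S -> T) (c : T -> 'I_N -> K) s d :
  injective h -> jet_surj c (@zero_ideal K N) (fun=> s) d ->
  jet_surj (fun x => c (h x)) (@zero_ideal K N) (fun=> s) d.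
Proof.
move=> inj H g.
have [f [Hd Hf]] := H (fun y => if [pick x | h x == y] is Some x then g x else 0).
exists f; split=> // x; have := Hf (h x).
by case: pickP => [y /eqP /inj -> //|/(_ x)]; rewrite eqxx.
Qed.

Lemma comp_homog_ord r (phi : poly) (f : 'I_N -> poly) a : phi \is r.-homog ->
  (forall l, ord_ge a 1 (f l)) -> ord_ge a r (phi \mPo [tuple f l | l < N]).
Proof.
move=> hphi Hf; rewrite comp_mpolyE big_seq; apply: ord_ge_sum => u hu.
apply: ord_geZ; have <- : mdeg u = r by exact: (dhomog_mf hphi hu).
rewrite mdegE; apply: ord_ge_prod => l _; rewrite tnth_mktuple.
by have := ord_ge_exp (e := u l) (Hf l); rewrite mul1n.
Qed.

Lemma comp_homog_deg e r (phi : poly) (f : 'I_N -> poly) : phi \is r.-homog ->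
  (forall l, deg_le e (f l)) -> deg_le (e * r) (phi \mPo [tuple f l | l < N]).
Proof.
move=> hphi Hf; rewrite comp_mpolyE big_seq; apply: deg_le_sum => u hu.
apply: deg_leZ; have <- : mdeg u = r by exact: (dhomog_mf hphi hu).
rewrite mdegE big_distrr /=; apply: deg_le_prod => l _; rewrite tnth_mktuple.
exact: deg_le_exp.
Qed.

Lemma natr_sub_eq0 (x y : nat) : (x%:R - y%:R == 0 :> K) = (x == y).
Proof. by rewrite subr_eq0 (inj_eq (natr_inj charK0)). Qed.

Lemma deg_le_natfactors (l : 'I_N) (I : finType) (P : pred I) (w : I -> nat) :
  deg_le #|P| (\prod_(v | P v) ('X_l - (w v)%:R%:MP) : poly).
Proof.
rewrite -sum1_card; apply: deg_le_prod => v _.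
by apply: deg_leB; [exact: deg_leXi | exact: deg_leC].
Qed.

(** The polynomials [f l], products over the grid hyperplanes in direction [l], are local
    coordinates at all grid points at once. A leading form of order [r] at [x] is realized by a form
    in them, of degree [b * r], which has order [r] at the other points too. The factor [del], of
    degree at most [N * b], adds one order at those points and is nonzero at [x]. *)
Theorem grid_jets b s :
  jet_surj (fun (x : {ffun 'I_N -> 'I_b}) l => (x l)%:R) (@zero_ideal K N)
           (fun=> s.+1) (b * s + N * b).
Proof.
apply: jet_surj_triangular; first exact: zero_idealP.
move=> r x g le_r Hg.
pose c (x : {ffun 'I_N -> 'I_b}) l : K := (x l)%:R.
pose h (y : {ffun 'I_N -> 'I_b}) l : poly :=
  \prod_(v : 'I_b | v != y l) ('X_l - (v%:R)%:MP).
pose f l : poly := \prod_(v : 'I_b) ('X_l - (v%:R)%:MP).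
have fE y l : f l = ('X_l - (c y l)%:MP) * h y l by rewrite /f (bigD1 (y l)).
have f1 y l : ord_ge (c y) 1 (f l).
  by rewrite (fE y); apply: ord_geMl; apply: ord_ge_subX.
have nzh l : (h x l).@[c x] != 0.
  rewrite rmorph_prod /=; apply/prodf_neq0 => v nv.
  rewrite mevalB mevalXU mevalC natr_sub_eq0; apply: contraNN nv => /eqP e.
  by apply/eqP/val_inj.
pose G : 'M[K]_N := diag_mx (\row_l (h x l).@[c x]).
have uG : G \in unitmx.
  rewrite unitmxE unitfE det_diag; apply/prodf_neq0 => l _; by rewrite mxE.
have HG i : ord_ge (c x) 2 (f i - \sum_j G i j *: ('X_j - (c x j)%:MP)).
  rewrite (bigD1 i) //= big1 ?addr0 => [|j nj]; last first.
    by rewrite !mxE eq_sym (negPf nj) mulr0n scale0r.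
  rewrite !mxE eqxx mulr1n (fE x) -mul_mpolyC mulrC -mulrBl.
  rewrite -[2%N]/(1 + 1)%N; apply: ord_geM; last exact: ord_ge_subX.
  by apply/ord_ge1; rewrite mevalB mevalC subrr.
have [phi [hphi Hphi]] := leading_form_coords uG HG Hg.
pose del : poly := \prod_l h x l.
have nzd : del.@[c x] != 0 by rewrite rmorph_prod /=; apply/prodf_neq0.
set q := comp_mpoly _ phi in Hphi.
exists ((del.@[c x])^-1 *: (del * q)); split.
- apply: deg_leZ; rewrite addnC; apply: deg_leM.
    rewrite -[X in (X * b)%N](card_ord N) -sum_nat_const; apply: deg_le_prod => l _.
    apply: deg_leW (deg_le_natfactors _ _ _).
    by apply: leq_trans (max_card _) _; rewrite card_ord.
  apply: (@deg_leW _ _ (b * r)); first by rewrite leq_mul2l -ltnS le_r orbT.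
  apply: comp_homog_deg hphi _ => l.
  by apply: deg_leW (deg_le_natfactors _ _ _); rewrite cardT size_enum_ord.
- apply: ord_mod_ord; first exact: zero_idealP.
  rewrite (_ : _ - _ = (g - q) + (1 - (del.@[c x])^-1 *: del) * q).
    apply: ord_geD Hphi _; rewrite -add1n; apply: ord_geM.
      by apply/ord_ge1; rewrite mevalB mevalZ meval1 mulVf ?subrr.
    exact: comp_homog_ord.
  by rewrite mulrBl mul1r -scalerAl; ring.
- move=> y nyx; apply: ord_mod_ord; first exact: zero_idealP.
  apply: (@ord_geW _ _ _ _ (1 + r)); first by rewrite geq_minr.
  apply: ord_geZ; apply: ord_geM; last by apply: comp_homog_ord hphi _ => l; apply: f1.
  have [l nl] : exists l, y l != x l.
    apply/existsP; apply: contraT; rewrite negb_exists => /forallP e.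
    by case/negP: nyx; apply/eqP/ffunP => l; apply/eqP; have := e l; rewrite negbK.
  apply: (@ord_ge_prod1 _ _ _ _ _ _ l) => //.
  apply: (@ord_ge_prod1 _ _ _ _ _ _ (y l)) => //; exact: ord_ge_subX.
Qed.

Lemma grid_jets_card b s M : (M <= b ^ N)%N ->
  exists c : 'I_M -> 'I_N -> K,
    jet_surj c (@zero_ideal K N) (fun=> s.+1) (b * s + N * b).
Proof.
move=> leM; have leM' : (M <= #|{: {ffun 'I_N -> 'I_b}}|)%N.
  by rewrite card_ffun !card_ord.
have inj : injective (fun i : 'I_M => enum_val (widen_ord leM' i)).
  by move=> i j /enum_val_inj /(congr1 val) /= /val_inj.
by have := jet_surj_sub inj (@grid_jets b s);
  exists (fun i l => (enum_val (widen_ord leM' i) l)%:R).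
Qed.

(* Newton interpolation on the principal lattice *)
Theorem lattice_jets t :
  jet_surj (fun (u : 'X_{1..N < t.+1}) l => (u l)%:R) (@zero_ideal K N)
           (fun=> 1%N) t.
Proof.
pose c (u : 'X_{1..N}) l : K := (u l)%:R.
pose f (u : 'X_{1..N}) : poly := \prod_l \prod_(v < u l) ('X_l - (v%:R)%:MP).
have f0 u w : ~~ (u <= w)%MM -> (f u).@[c w] = 0.
  move=> nle; have [l lt_l] : exists l, (w l < u l)%N.
    apply/existsP; apply: contraT; rewrite negb_exists => /forallP e.
    by case/negP: nle; apply/mnm_lepP => l; have := e l; rewrite -leqNgt.
  rewrite rmorph_prod /= (bigD1 l) //= rmorph_prod /= (bigD1 (Ordinal lt_l)) //=.
  by rewrite mevalB mevalXU mevalC subrr !mul0r.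
have fn u : (f u).@[c u] != 0.
  rewrite rmorph_prod /=; apply/prodf_neq0 => l _.
  rewrite rmorph_prod /=; apply/prodf_neq0 => v _.
  by rewrite mevalB mevalXU mevalC natr_sub_eq0 gtn_eqF.
have fd u : deg_le (mdeg u) (f u).
  rewrite mdegE; apply: deg_le_prod => l _.
  by apply: deg_leW (deg_le_natfactors _ _ _); rewrite cardT size_enum_ord.
move=> g.
have main e : (e <= t.+1)%N -> exists p, deg_le t p /\
    forall u : 'X_{1..N < t.+1}, (mdeg u < e)%N -> p.@[c u] = (g u).@[c u].
  elim: e => [|e IH] le_e; first by exists 0; split=> //; exact: deg_le0.
  have [p [Hd Hp]] := IH (ltnW le_e).
  pose x (u : 'X_{1..N < t.+1}) := ((g u).@[c u] - p.@[c u]) / (f u).@[c u].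
  exists (p + \sum_(u : 'X_{1..N < t.+1} | mdeg u == e) x u *: f u); split.
    apply: deg_leD => //; apply: deg_le_sum => u /eqP hu; apply: deg_leZ.
    by apply: deg_leW (fd u); rewrite hu.
  move=> w; rewrite ltnS leq_eqVlt mevalD meval_sum => /predU1P[hw|hw].
    have zero (u : 'X_{1..N < t.+1}) : (mdeg u == e) && (u != w) -> (x u *: f u).@[c w] = 0.
      move=> /andP[/eqP hu nu]; rewrite mevalZ f0 ?mulr0 //.
      apply: contraNN nu => le_u; apply/eqP/val_inj => /=.
      have e0 : mdeg (w - u)%MM = 0%N.
        by have := congr1 mdeg (submK le_u); rewrite mdegD hu hw; lia.
      have := submK le_u; move/eqP: e0; rewrite mdeg_eq0 => /eqP ->.
      by rewrite add0m.
    have hwe : mdeg w == e by apply/eqP.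
    rewrite (bigD1 w hwe) /= [X in _ + (_ + X)]big1; last exact: zero.
    rewrite addr0 mevalZ /x divfK; last exact: fn.
    by rewrite addrC subrK.
  rewrite Hp // big1 ?addr0 // => u /eqP hu.
  rewrite mevalZ f0 ?mulr0 //; apply/negP => le_u.
  by have := congr1 mdeg (submK le_u); rewrite mdegD hu; lia.
have [p [Hd Hp]] := main _ (leqnn t.+1).
exists p; split=> // u; apply: ord_mod_ord; first exact: zero_idealP.
by apply/ord_ge1; rewrite mevalB -/(c u) Hp ?subrr // bmdeg.
Qed.

Lemma lattice_jets_card t M : (M <= #|{: 'X_{1..N < t.+1}}|)%N ->
  exists c : 'I_M -> 'I_N -> K, jet_surj c (@zero_ideal K N) (fun=> 1%N) t.
Proof.
move=> leM.
have inj : injective (fun i : 'I_M => enum_val (widen_ord leM i)).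
  by move=> i j /enum_val_inj /(congr1 val) /= /val_inj.
by have := jet_surj_sub inj (@lattice_jets t);
  exists (fun i l => (enum_val (widen_ord leM i) l)%:R).
Qed.

End Special.

(** * Generation by polynomials of lower degree *)

Section LinearGeneration.
Variables (K : fieldType) (N : nat).
Local Notation poly := {mpoly K[N]}.

Lemma powspan0_deg (I : poly -> Prop) E f : powspan I E 0 f -> deg_le E f.
Proof.
move: {-2}0%N (erefl 0%N) => r er H.
elim: H er => {r f} // [r _|r v w _ Hv _ Hw er]; first exact: deg_le0.
by apply: deg_leD; [exact: Hv | exact: Hw].
Qed.

Lemma powspan1_ind (I Q : poly -> Prop) E :
  Q 0 -> (forall f g, Q f -> Q g -> Q (f + g)) ->
  (forall u w, I u -> deg_le E w -> Q (u * w)) ->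
  forall f, powspan I E 1 f -> Q f.
Proof.
move=> Q0 QD QM f; move: {-2}1%N (erefl 1%N) => r er H.
elim: H er => {r f} // [r u w Iu Hw _ [er]|r v w _ Hv _ Hw er].
  by apply: QM => //; apply: (@powspan0_deg I); rewrite -er.
by apply: QD; [exact: Hv | exact: Hw].
Qed.

Lemma jet_surj_dual (T : finType) (c : T -> 'I_N -> K) d :
  jet_surj c (@zero_ideal K N) (fun=> 1%N) d ->
  exists e : T -> poly, (forall j, deg_le d (e j)) /\
    (forall i j, (e i).@[c j] = (i == j)%:R).
Proof.
move=> interp.
have step i : exists f : poly, deg_le d f /\ forall j, f.@[c j] = (i == j)%:R.
  have [f [Hd Hf]] := interp (fun j => (i == j)%:R%:MP).
  exists f; split=> // j; have [_ [-> ]] := Hf j; rewrite subr0 => /ord_ge1/eqP.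
  by rewrite mevalB mevalC subr_eq0 => /eqP.
have [e He] := fin_all_exists step.
by exists e; split=> [j|i j]; [case: (He j) | case: (He i)].
Qed.

(** The matrix of values is square, so surjectivity gives injectivity. *)
Lemma jet_surj_unisolvent (T : finType) (c : T -> 'I_N -> K) d f :
  #|T| = #|{: 'X_{1..N < d.+1}}| ->
  jet_surj c (@zero_ideal K N) (fun=> 1%N) d ->
  deg_le d f -> (forall x, f.@[c x] = 0) -> f = 0.
Proof.
move=> cardT /jet_surjP full Hd H0.
have c1 : #|{: 'X_{1..N < 1}}| = 1%N.
  have h0 : (mdeg (0%MM : 'X_{1..N}) < 1)%N by rewrite mdeg0.
  rewrite (@eq_card1 _ (BMultinom h0)) // => u; rewrite !inE.
  apply/esym/eqP/val_inj; apply/eqP; rewrite /= -mdeg_eq0 -leqn0.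
  by have := bmdeg u.
have free : row_free (jetmx c d 1).
  by rewrite /row_free; move/eqP: full => ->; rewrite card_prod c1 muln1 cardT.
have : coef_row d f *m jetmx c d 1 = 0.
  apply/rowP => j; rewrite coef_row_jetmx // mxE.
  by apply: (proj2 (ord_ge1 (c (enum_val j).1) f) (H0 _)); apply: bmdeg.
move/(congr1 (mulmxr (pinvmx (jetmx c d 1)))) => /=.
rewrite mul0mx -mulmxA mulmxVp // mulmx1 => h.
by rewrite -(coef_rowK Hd) h /row_poly big1 // => i _; rewrite mxE scale0r.
Qed.

Variables (m t' : nat) (z : 'I_m -> 'I_N -> K) (e : 'I_m -> poly).
Hypothesis deg_e : forall j, deg_le t' (e j).
Hypothesis eval_e : forall i j, (e i).@[z j] = (i == j)%:R.
Local Notation t := t'.+1.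
Variable I : poly -> Prop.
Local Notation span := (powspan I 1 1).

Lemma span_mem u y : I u -> deg_le 1 y -> span (u * y).
Proof. by move=> Iu Hy; apply: powspan_mul => //; apply: powspan_base. Qed.

Section OnePoint.
Variables (q : 'I_N -> K) (g : poly).
Hypothesis HI : forall u, deg_le t u -> (forall j, u.@[z j] = 0) -> u.@[q] = 0 -> I u.
Hypothesis Iq : forall u, I u -> u.@[q] = 0.
Hypothesis Hg : vanishing_in z t g.
Hypothesis gq : g.@[q] = 1.
Variables (i1 i2 : 'I_m) (Lq L2 : poly).
Hypothesis nz1 : (e i1).@[q] != 0.
Hypothesis nz2 : (e i2).@[q] != 0.
Hypothesis deg_L : deg_le 1 Lq /\ deg_le 1 L2.
Hypothesis eval_Lq : [/\ Lq.@[q] = 1, Lq.@[z i1] = 0 & Lq.@[z i2] = 0].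
Hypothesis eval_L2 : [/\ L2.@[q] = 0, L2.@[z i1] = 0 & L2.@[z i2] = 1].

(* The syzygy [y * (y' * e j) = y' * (y * e j)]. *)
Lemma one_point_syzygy j y y' : deg_le 1 y -> deg_le 1 y' ->
  y.@[z j] = 0 -> y'.@[z j] = 0 ->
  span ((e j).@[q] *: ((y.@[q] *: y' - y'.@[q] *: y) * g)).
Proof.
move=> Hy Hy' yj y'j.
pose w (y : poly) := e j * y - (e j).@[q] * y.@[q] *: g.
have Iw y0 : deg_le 1 y0 -> y0.@[z j] = 0 -> I (w y0).
  move=> d0 v0; have [d1 v1] := vanishingM deg_e eval_e d0 v0; have [d2 v2] := Hg.
  apply: HI => [|i|].
  - by apply: deg_leB => //; apply: deg_leZ.
  - by rewrite mevalB mevalZ v1 v2 mulr0 subrr.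
  - by rewrite mevalB mevalZ mevalM gq mulr1 subrr.
rewrite (_ : _ *: _ = w y' * y - w y * y').
  by apply: powspanB; apply: span_mem => //; apply: Iw.
by rewrite /w -!mul_mpolyC !mpolyCM; ring.
Qed.

(** For [y] vanishing at [q] and [z j], the syzygy between [Lq] and [y] yields [y * g]. A general
    [l] needs two indices: minus a multiple of [L2] it vanishes at [z i2], and [L2] vanishes at
    [z i1]. *)
Lemma one_point_span l : deg_le 1 l -> l.@[q] = 0 -> span (l * g).
Proof.
move=> Hl lq; have [dq d2] := deg_L.
have [q1 q2 q3] := eval_Lq; have [l1 l2 l3] := eval_L2.
have two y j : deg_le 1 y -> y.@[q] = 0 -> y.@[z j] = 0 -> Lq.@[z j] = 0 ->
    (e j).@[q] != 0 -> span (y * g).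
  move=> Hy yq yj Lj nz; have := one_point_syzygy dq Hy Lj yj.
  rewrite q1 yq scale1r scale0r subr0 => /(powspanZ ((e j).@[q])^-1).
  by rewrite scalerA mulVf // scale1r.
rewrite -[l](subrK (l.@[z i2] *: L2)) mulrDl; apply: powspan_add.
  apply: (two _ i2) => //; first by apply: deg_leB => //; apply: deg_leZ.
    by rewrite mevalB mevalZ lq l1 mulr0 subrr.
  by rewrite mevalB mevalZ l3 mulr1 subrr.
by rewrite -scalerAl; apply: powspanZ; apply: (two _ i1).
Qed.

(** Interpolation at the [z j] in degree [t'] makes the polynomials of degree [t] vanishing there
    generate in degree [t.+1], and these are multiples of [g] modulo [I]. What remains is one term
    [l * g], whose affine factor must vanish at [q]. *)
Lemma one_point_generation u : deg_le t.+1 u -> (forall j, u.@[z j] = 0) ->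
  u.@[q] = 0 -> span u.
Proof.
move=> Hu uz uq.
have hz : powspan (vanishing_in z t) 1 1 u.
  by apply: (symbolic_powspan deg_e eval_e) => [|j]; [rewrite mul1n addn1|apply/ord_ge1].
suff [l [Hl Hs]] : exists l, deg_le 1 l /\ span (u - l * g).
  have ord_q v : I v -> ord_ge q 1 v by move=> Iv; apply/ord_ge1/Iq.
  have /ord_ge1 := powspan_ord ord_q Hs.
  rewrite mevalB mevalM gq mulr1 uq sub0r => /eqP; rewrite oppr_eq0 => /eqP lq.
  rewrite -[u](subrK (l * g)); apply: powspan_add => //; exact: one_point_span.
move: u {Hu uz uq} hz; apply: powspan1_ind => [|f1 f2|u w Iu Hw].
- by exists 0; split; [exact: deg_le0 | rewrite mul0r subrr; exact: powspan_zero].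
- move=> [l1 [d1 h1]] [l2 [d2 h2]]; exists (l1 + l2); split; first exact: deg_leD.
  by rewrite mulrDl opprD addrACA; apply: powspan_add.
exists (u.@[q] *: w); split; first exact: deg_leZ.
rewrite (_ : _ - _ = (u - u.@[q] *: g) * w); last first.
  by rewrite -!mul_mpolyC; ring.
apply: span_mem => //; have [d1 v1] := Iu; have [d2 v2] := Hg; apply: HI => [|j|].
- by apply: deg_leB => //; apply: deg_leZ.
- by rewrite mevalB mevalZ v1 v2 mulr0 subrr.
- by rewrite mevalB mevalZ gq mulr1 subrr.
Qed.

End OnePoint.

Section TwoPoints.
Variables (q1 q2 : 'I_N -> K).
Hypothesis HI : forall u, deg_le t u -> (forall j, u.@[z j] = 0) ->
  u.@[q1] = 0 -> u.@[q2] = 0 -> I u.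
Variables (i1 i2 : 'I_m) (L1 L2 M2 : poly).
Hypothesis deg_L : [/\ deg_le 1 L1, deg_le 1 L2 & deg_le 1 M2].
Hypothesis eval_L1 : [/\ L1.@[q1] = 1, L1.@[q2] = 0, L1.@[z i1] = 0 & L1.@[z i2] = 0].
Hypothesis eval_L2 : [/\ L2.@[q1] = 0, L2.@[q2] = 1, L2.@[z i1] = 0 & L2.@[z i2] = 0].
Hypothesis eval_M : [/\ M2.@[q1] = 0, M2.@[q2] = 0, M2.@[z i1] = 0 & M2.@[z i2] = 1].
Variables g1 g2 : poly.
Hypothesis Hg1 : vanishing_in z t g1.
Hypothesis Hg2 : vanishing_in z t g2.
Hypothesis eval_g1 : g1.@[q1] = 1 /\ g1.@[q2] = 0.
Hypothesis eval_g2 : g2.@[q1] = 0 /\ g2.@[q2] = 1.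

Lemma two_points_syzygy j y y' : deg_le 1 y -> deg_le 1 y' ->
  y.@[z j] = 0 -> y'.@[z j] = 0 ->
  span ((e j).@[q1] *: ((y.@[q1] *: y' - y'.@[q1] *: y) * g1) +
        (e j).@[q2] *: ((y.@[q2] *: y' - y'.@[q2] *: y) * g2)).
Proof.
move=> Hy Hy' yj y'j.
pose w (y : poly) := e j * y - (e j).@[q1] * y.@[q1] *: g1
                             - (e j).@[q2] * y.@[q2] *: g2.
have [g11 g12] := eval_g1; have [g21 g22] := eval_g2.
have Iw y0 : deg_le 1 y0 -> y0.@[z j] = 0 -> I (w y0).
  move=> d0 v0; have [d1 v1] := vanishingM deg_e eval_e d0 v0.
  have [d2 v2] := Hg1; have [d3 v3] := Hg2.
  apply: HI => [|i||].
  - by do 2?[apply: deg_leB]; rewrite //; apply: deg_leZ.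
  - by rewrite !mevalB !mevalZ v1 v2 v3 !mulr0 !subrr.
  - by rewrite !mevalB !mevalZ mevalM g11 g21 mulr1 mulr0 subr0 subrr.
  - by rewrite !mevalB !mevalZ mevalM g12 g22 mulr1 mulr0 subr0 subrr.
rewrite (_ : _ + _ = w y' * y - w y * y').
  by apply: powspanB; apply: span_mem => //; apply: Iw.
by rewrite /w -!mul_mpolyC !mpolyCM; ring.
Qed.

Hypothesis nz1 : (e i1).@[q1] != 0.
Hypothesis nz2 : (e i2).@[q1] != 0.
Hypothesis nzdet :
  (e i1).@[q2] * (e i2).@[q1] - (e i2).@[q2] * (e i1).@[q1] != 0.

(** If [y] vanishes at both [q1] and [q2], the argument for one point applies. For [L2], which is 1
    at [q2], each syzygy also contains a multiple of [L1 * g2]; combining those of [z i1] and [z i2]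
    eliminates it, and [nzdet] is the coefficient left on [L2 * g1] up to sign. *)
Lemma two_points_span l : deg_le 1 l -> l.@[q1] = 0 -> span (l * g1).
Proof.
move=> Hl lq1; have [dL1 dL2 dM2] := deg_L.
have [L11 L12 L13 L14] := eval_L1; have [L21 L22 L23 L24] := eval_L2.
have [M1' M2' M3' M4'] := eval_M.
have three y j : deg_le 1 y -> y.@[q1] = 0 -> y.@[q2] = 0 -> y.@[z j] = 0 ->
    L1.@[z j] = 0 -> (e j).@[q1] != 0 -> span (y * g1).
  move=> Hy yq1 yq2 yj Lj nz; have := two_points_syzygy dL1 Hy Lj yj.
  rewrite L11 L12 yq1 yq2 scale1r !scale0r !subr0 mul0r scaler0 addr0.
  by move=> /(powspanZ ((e j).@[q1])^-1); rewrite scalerA mulVf // scale1r.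
have both y : deg_le 1 y -> y.@[q1] = 0 -> y.@[q2] = 0 -> span (y * g1).
  move=> Hy yq1 yq2; rewrite -[y](subrK (y.@[z i2] *: M2)) mulrDl; apply: powspan_add.
    apply: (three _ i2) => //; first by apply: deg_leB => //; apply: deg_leZ.
    - by rewrite mevalB mevalZ yq1 M1' mulr0 subrr.
    - by rewrite mevalB mevalZ yq2 M2' mulr0 subrr.
    - by rewrite mevalB mevalZ M4' mulr1 subrr.
  by rewrite -scalerAl; apply: powspanZ; apply: (three _ i1).
have L2g : span (L2 * g1).
  have s1 := two_points_syzygy dL2 dL1 L23 L13.
  have s2 := two_points_syzygy dL2 dL1 L24 L14.
  rewrite L11 L12 L21 L22 !scale1r !scale0r !subr0 !sub0r in s1 s2.
  have := powspanB (powspanZ ((e i1).@[q2]) s2) (powspanZ ((e i2).@[q2]) s1).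
  have nzd := nzdet.
  set d := (e i1).@[q2] * (e i2).@[q1] - (e i2).@[q2] * (e i1).@[q1] in nzd.
  rewrite (_ : _ - _ = - d *: (L2 * g1)).
    move=> /(powspanZ (- d)^-1).
    by rewrite scalerA mulVf ?scale1r // oppr_eq0.
  by rewrite /d -!mul_mpolyC mpolyCN mpolyCB !mpolyCM; ring.
rewrite -[l](subrK (l.@[q2] *: L2)) mulrDl; apply: powspan_add.
  apply: both; first by apply: deg_leB => //; apply: deg_leZ.
    by rewrite mevalB mevalZ lq1 L21 mulr0 subrr.
  by rewrite mevalB mevalZ L22 mulr1 subrr.
by rewrite -scalerAl; apply: powspanZ.
Qed.

Hypothesis Iq : forall u, I u -> u.@[q1] = 0 /\ u.@[q2] = 0.

Lemma two_points_generation u :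
  (forall l, deg_le 1 l -> l.@[q2] = 0 -> span (l * g2)) ->
  deg_le t.+1 u -> (forall j, u.@[z j] = 0) ->
  u.@[q1] = 0 -> u.@[q2] = 0 -> span u.
Proof.
move=> span2 Hu uz uq1 uq2.
have [g11 g12] := eval_g1; have [g21 g22] := eval_g2.
have hz : powspan (vanishing_in z t) 1 1 u.
  by apply: (symbolic_powspan deg_e eval_e) => [|j]; [rewrite mul1n addn1|apply/ord_ge1].
suff [l [l' [Hl Hl' Hs]]] : exists l l', [/\ deg_le 1 l, deg_le 1 l' &
    span (u - l * g1 - l' * g2)].
  have o1 v : I v -> ord_ge q1 1 v by move=> /Iq[Iv _]; apply/ord_ge1.
  have o2 v : I v -> ord_ge q2 1 v by move=> /Iq[_ Iv]; apply/ord_ge1.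
  have /ord_ge1 := powspan_ord o1 Hs.
  rewrite !mevalB !mevalM g11 g21 mulr1 mulr0 uq1 sub0r subr0 => /eqP.
  rewrite oppr_eq0 => /eqP lq.
  have /ord_ge1 := powspan_ord o2 Hs.
  rewrite !mevalB !mevalM g12 g22 mulr1 mulr0 uq2 subr0 sub0r => /eqP.
  rewrite oppr_eq0 => /eqP lq'.
  rewrite (_ : u = (u - l * g1 - l' * g2) + (l * g1 + l' * g2)); last by ring.
  apply: powspan_add => //.
  by apply: powspan_add; [exact (two_points_span Hl lq) | exact (span2 _ Hl' lq')].
move: u {Hu uz uq1 uq2} hz; apply: powspan1_ind => [|f1 f2|u w Iu Hw].
- exists 0, 0; split; try exact: deg_le0.
  by rewrite !mul0r !subrr; apply: powspan_zero.
- move=> [l1 [l1' [d1 d1' h1]]] [l2 [l2' [d2 d2' h2]]].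
  exists (l1 + l2), (l1' + l2'); split; try exact: deg_leD.
  rewrite (_ : _ - _ = (f1 - l1 * g1 - l1' * g2) + (f2 - l2 * g1 - l2' * g2)).
    exact: powspan_add.
  by ring.
exists (u.@[q1] *: w), (u.@[q2] *: w); split; try exact: deg_leZ.
rewrite (_ : _ - _ = (u - u.@[q1] *: g1 - u.@[q2] *: g2) * w); last first.
  by rewrite -!mul_mpolyC; ring.
apply: span_mem => //; have [d1 v1] := Iu; have [d2 v2] := Hg1; have [d3 v3] := Hg2.
apply: HI => [|j||].
- by do 2?[apply: deg_leB]; rewrite //; apply: deg_leZ.
- by rewrite !mevalB !mevalZ v1 v2 v3 !mulr0 !subrr.
- by rewrite !mevalB !mevalZ g11 g21 mulr1 mulr0 subr0 subrr.
- by rewrite !mevalB !mevalZ g12 g22 mulr1 mulr0 subr0 subrr.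
Qed.

End TwoPoints.
End LinearGeneration.

Section GenericGeneration.
Variables (K : fieldType) (charK0 : [pchar K] =i pred0) (N t' m : nat).
Hypothesis card_m : m = #|{: 'X_{1..N < t'.+1}}|.
Hypothesis m_gt1 : (1 < m)%N.

Definition linearly_generated n (a : 'I_n -> 'I_N -> K) t : Prop :=
  jet_surj a (@zero_ideal K N) (fun=> 1%N) t /\
  forall u, vanishing_in a t.+1 u -> powspan (vanishing_in a t) 1 1 u.

Let i1 : 'I_m := Ordinal (ltnW m_gt1).
Let i2 : 'I_m := Ordinal m_gt1.

Lemma generic_interp n (T : finType) (iota : T -> 'I_n) t :
  injective iota -> (#|T| <= #|{: 'X_{1..N < t.+1}}|)%N ->
  generic (fun a : 'I_n -> 'I_N -> K =>
    jet_surj (fun x => a (iota x)) (@zero_ideal K N) (fun=> 1%N) t).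
Proof.
move=> inj leT; apply: generic_jets => //.
have [c Hc] := lattice_jets_card charK0 leT.
exists (fun x => c (enum_rank x)).
exact: (jet_surj_sub (@enum_rank_inj T) Hc).
Qed.

Lemma unisolvent_eval (z : 'I_m -> 'I_N -> K) f w :
  jet_surj w (@zero_ideal K N) (fun=> 1%N) t' ->
  (exists j : 'I_m, f.@[z j] != 0) ->
  deg_le t' f -> exists x : 'I_m, f.@[w x] != 0.
Proof.
move=> Hw [j nz] Hd; apply/existsP; apply: contraT; rewrite negb_exists => /forallP h.
case/eqP: nz; rewrite (@jet_surj_unisolvent _ _ _ w t' f) ?meval0 //.
  by rewrite card_ord -card_m.
by move=> x; apply/eqP; have := h x; rewrite negbK.
Qed.

(** If [e i] also vanished at [w i], it would vanish on the whole unisolvent set [w] and be zero. *)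
Lemma unisolvent_eval_neq0 (z w : 'I_m -> 'I_N -> K) e i :
  (forall j, deg_le t' (e j)) -> (forall i j, (e i).@[z j] = (i == j)%:R) ->
  (forall j, j != i -> w j = z j) ->
  jet_surj w (@zero_ideal K N) (fun=> 1%N) t' -> (e i).@[w i] != 0.
Proof.
move=> de ev wz H; have [|x] := unisolvent_eval (z := z) H _ (de i).
  by exists i; rewrite ev eqxx oner_neq0.
by have [->|ne] // := eqVneq x i; rewrite wz // ev (eq_sym i) (negPf ne) eqxx.
Qed.

(** Exchanging [i1] or [i2] for the extra point keeps the first [m] points unisolvent, which makes
    [e i1] and [e i2] nonzero at it. Interpolation in degree 1 at the extra point and these two
    provides [Lq] and [L2]. *)
Lemma generic_generation1 : (m + 1 <= #|{: 'X_{1..N < t'.+2}}|)%N ->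
  (3 <= #|{: 'X_{1..N < 2}}|)%N ->
  generic (fun a : 'I_(m + 1) -> 'I_N -> K => linearly_generated a t'.+1).
Proof.
move=> le_m le3.
pose L (j : 'I_m) : 'I_(m + 1) := lshift 1 j; pose Q : 'I_(m + 1) := rshift m ord0.
have injL : injective L by move=> i j /(congr1 val) /= /val_inj.
pose rep i (j : 'I_m) := if j == i then Q else L j.
have inj_rep i : injective (rep i).
  move=> x y; rewrite /rep; have := ltn_ord x; have := ltn_ord y.
  by case: eqP => [->|_]; case: eqP => [->|_] // ? ? /(congr1 val) /= h;
    apply: val_inj => /=; lia.
pose tri (x : 'I_3) : 'I_(m + 1) := if x == 0 :> nat then Q else
   if x == 1 :> nat then L i1 else L i2.
have inj_tri : injective tri.
  by case=> [[|[|[|//]]] hx] [[|[|[|//]]] hy] /(congr1 val) /= h;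
    apply: val_inj => //=; lia.
have G0 : generic (fun a : 'I_(m + 1) -> 'I_N -> K =>
    jet_surj a (@zero_ideal K N) (fun=> 1%N) t'.+1).
  by apply: (@generic_interp _ _ id) => //; rewrite card_ord.
have cardm : (#|'I_m| <= #|{: 'X_{1..N < t'.+1}}|)%N by rewrite card_ord -card_m.
have Gtri := generic_interp inj_tri (t := 1); rewrite card_ord in Gtri.
have := genericI (genericI G0 (Gtri le3)) (genericI (generic_interp injL cardm)
  (genericI (generic_interp (inj_rep i1) cardm) (generic_interp (inj_rep i2) cardm))).
apply: genericW => a [[H0 H3] [HL [H1 H2]]]; split=> // u [du vu].
have [e [de ev]] := jet_surj_dual HL.
have [l [dl lv]] := jet_surj_dual H3.
have [g [dg gv]] := jet_surj_dual H0.
have nz i : jet_surj (fun x => a (rep i x)) (@zero_ideal K N) (fun=> 1%N) t' ->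
    (e i).@[a Q] != 0.
  move=> Hi; have := @unisolvent_eval_neq0 _ (fun x => a (rep i x)) e i de ev.
  by rewrite /rep /= eqxx; apply=> // j /negPf ->.
pose x0 : 'I_3 := @Ordinal 3 0 isT; pose x1 : 'I_3 := @Ordinal 3 1 isT.
pose x2 : 'I_3 := @Ordinal 3 2 isT.
have lE i j : (l i).@[a (tri j)] = (i == j)%:R by exact: lv.
apply: (@one_point_generation _ _ _ t' (fun j => a (L j)) e de ev
   (vanishing_in a t'.+1) (a Q) (g Q) _ _ _ _ i1 i2 (l x0) (l x2)) => //.
- move=> v dv v1 v2; split=> // j; case: (splitP j) => j' hj.
    by rewrite (_ : j = L j') //; apply: val_inj.
  by rewrite (_ : j = Q) //; apply: val_inj; rewrite /= hj ord1.
- by move=> v [_ hv]; apply: hv.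
- by split=> // j; rewrite gv; case: eqP => // /(congr1 val) /=; have := ltn_ord j; lia.
- by rewrite gv eqxx.
- exact: nz.
- exact: nz.
- by split; [rewrite -[Q]/(tri x0) | rewrite -[L i1]/(tri x1) | rewrite -[L i2]/(tri x2)];
     rewrite lE.
- by split; [rewrite -[Q]/(tri x0) | rewrite -[L i1]/(tri x1) | rewrite -[L i2]/(tri x2)];
     rewrite lE.
Qed.

Lemma generic_generation2 : (m + 2 <= #|{: 'X_{1..N < t'.+2}}|)%N ->
  (4 <= #|{: 'X_{1..N < 2}}|)%N ->
  generic (fun a : 'I_(m + 2) -> 'I_N -> K => linearly_generated a t'.+1).
Proof.
move=> le_m le4.
pose L (j : 'I_m) : 'I_(m + 2) := lshift 2 j; pose Q (k : 'I_2) : 'I_(m + 2) := rshift m k.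
have injL : injective L by move=> i j /(congr1 val) /= /val_inj.
pose rep i k (j : 'I_m) := if j == i then Q k else L j.
have inj_rep i k : injective (rep i k).
  move=> x y; rewrite /rep; have := ltn_ord x; have := ltn_ord y.
  by case: eqP => [->|_]; case: eqP => [->|_] // ? ? /(congr1 val) /= h;
    apply: val_inj => /=; lia.
pose k0 : 'I_2 := @Ordinal 2 0 isT; pose k1 : 'I_2 := @Ordinal 2 1 isT.
(* Exchanging both [i1] and [i2] for the extra points gives [nzdet]: the determinant is the value at
   one extra point of a nonzero combination of [e i1] and [e i2] that vanishes at the other one and
   at the remaining points. *)
pose rep2 (j : 'I_m) := if j == i1 then Q k0 else if j == i2 then Q k1 else L j.
have i12 : i1 != i2 by [].
have inj_rep2 : injective rep2.
  move=> x y; rewrite /rep2; have := ltn_ord x; have := ltn_ord y.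
  case: eqP => [->|/eqP n1]; case: eqP => [->|/eqP n2] //; try case: eqP => [->|/eqP n3] //;
  try case: eqP => [->|/eqP n4] //; move=> ? ? /(congr1 val) /= h; apply: val_inj => /=; lia.
pose quad (x : 'I_4) : 'I_(m + 2) := if x == 0 :> nat then Q k0 else
   if x == 1 :> nat then Q k1 else if x == 2 :> nat then L i1 else L i2.
have inj_quad : injective quad.
  by case=> [[|[|[|[|//]]]] hx] [[|[|[|[|//]]]] hy] /(congr1 val) /= h;
    apply: val_inj => //=; lia.
have G0 : generic (fun a : 'I_(m + 2) -> 'I_N -> K =>
    jet_surj a (@zero_ideal K N) (fun=> 1%N) t'.+1).
  by apply: (@generic_interp _ _ id) => //; rewrite card_ord.
have cardm : (#|'I_m| <= #|{: 'X_{1..N < t'.+1}}|)%N by rewrite card_ord -card_m.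
have Gquad := generic_interp inj_quad (t := 1); rewrite card_ord in Gquad.
have Grep : generic (fun a : 'I_(m + 2) -> 'I_N -> K => forall ik : 'I_m * 'I_2,
    jet_surj (fun x => a (rep ik.1 ik.2 x)) (@zero_ideal K N) (fun=> 1%N) t').
  by apply: generic_all => ik; apply: generic_interp.
have := genericI (genericI G0 (Gquad le4)) (genericI (generic_interp injL cardm)
  (genericI Grep (generic_interp inj_rep2 cardm))).
apply: genericW => a [[H0 H4] [HL [H1 H2]]]; split=> // u [du vu].
have [e [de ev]] := jet_surj_dual HL.
have [l [dl lv]] := jet_surj_dual H4.
have [g [dg gv]] := jet_surj_dual H0.
have nz i k : (e i).@[a (Q k)] != 0.
  have := @unisolvent_eval_neq0 _ (fun x => a (rep i k x)) e i de ev.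
  by rewrite /rep /= eqxx; apply; [move=> j /negPf -> | exact: (H1 (i, k))].
have nzd : (e i1).@[a (Q k1)] * (e i2).@[a (Q k0)]
         - (e i2).@[a (Q k1)] * (e i1).@[a (Q k0)] != 0.
  pose f := (e i1).@[a (Q k1)] *: e i2 - (e i2).@[a (Q k1)] *: e i1.
  have [||x] := unisolvent_eval (z := fun j => a (L j)) (f := f) H2.
  - by exists i2; rewrite mevalB !mevalZ !ev eqxx (negPf i12) mulr1 mulr0 subr0.
  - by apply: deg_leB; apply: deg_leZ.
  rewrite /rep2 mevalB !mevalZ; have [//|n1] := eqVneq x i1.
  have [_|n2] := eqVneq x i2; first by rewrite [X in _ - X]mulrC subrr eqxx.
  by rewrite !ev !(eq_sym _ x) (negPf n1) (negPf n2) !mulr0 subrr eqxx.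
pose x0 : 'I_4 := @Ordinal 4 0 isT; pose x1 : 'I_4 := @Ordinal 4 1 isT.
pose x2 : 'I_4 := @Ordinal 4 2 isT; pose x3 : 'I_4 := @Ordinal 4 3 isT.
have lE i j : (l i).@[a (quad j)] = (i == j)%:R by exact: lv.
have e0 i : (l i).@[a (Q k0)] = (i == x0)%:R by rewrite -lE.
have e1 i : (l i).@[a (Q k1)] = (i == x1)%:R by rewrite -lE.
have e2 i : (l i).@[a (L i1)] = (i == x2)%:R by rewrite -lE.
have e3 i : (l i).@[a (L i2)] = (i == x3)%:R by rewrite -lE.
have Hvan v : deg_le t'.+1 v -> (forall j, v.@[a (L j)] = 0) ->
    v.@[a (Q k0)] = 0 -> v.@[a (Q k1)] = 0 -> vanishing_in a t'.+1 v.
  move=> dv v1 v2 v3; split=> // j; case: (splitP j) => j' hj.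
    by rewrite (_ : j = L j') //; apply: val_inj.
  have [->|->] : j = Q k0 \/ j = Q k1; try by [].
  by case: j' hj => [[|[|//]]] hj' hj; [left|right]; apply: val_inj.
have gz k : vanishing_in (fun j => a (L j)) t'.+1 (g (Q k)).
  by split=> // j; rewrite gv; case: eqP => // /(congr1 val) /=; have := ltn_ord j; lia.
have g0 k : (g (Q k)).@[a (Q k0)] = (k == k0)%:R.
  by rewrite gv (inj_eq (@rshift_inj m 2)).
have g1 k : (g (Q k)).@[a (Q k1)] = (k == k1)%:R.
  by rewrite gv (inj_eq (@rshift_inj m 2)).
apply: (@two_points_generation _ _ _ t' (fun j => a (L j)) e de ev
   (vanishing_in a t'.+1) (a (Q k0)) (a (Q k1)) _ i1 i2 (l x0) (l x1) (l x3)
   _ _ _ _ (g (Q k0)) (g (Q k1))) => //; rewrite ?e0 ?e1 ?e2 ?e3 ?g0 ?g1 //.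
- by move=> v [_ hv].
(* The multiples of the second [g] follow by exchanging the two extra points, which only changes the
   sign of the determinant. *)
- move=> y dy hy.
  apply: (@two_points_span _ _ _ t' (fun j => a (L j)) e de ev
   (vanishing_in a t'.+1) (a (Q k1)) (a (Q k0)) _ i1 i2 (l x1) (l x0) (l x3)
   _ _ _ _ (g (Q k1)) (g (Q k0))) => //; rewrite ?e0 ?e1 ?e2 ?e3 ?g0 ?g1 //.
    by move=> v dv v1 v2 v3; apply: Hvan.
  by rewrite -opprB oppr_eq0 mulrC [X in _ - X]mulrC.
Qed.

End GenericGeneration.

(** * Coordinate points *)

Section CoordinateChange.
Variables (K : fieldType) (M : nat).
Local Notation form := {mpoly K[M]}.

Lemma homog1E (G : form) : G \is 1.-homog -> G = \sum_k G@_U_(k) *: 'X_k.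
Proof.
move=> hG; apply/mpolyP => w; rewrite raddf_sum /=.
under eq_bigr do rewrite mcoeffZ mcoeffX.
case: (boolP (mdeg w == 1%N)) => [|ne].
  rewrite mdeg_eq1 => /existsP[k /eqP ->]; rewrite (bigD1 k) //= eqxx mulr1.
  rewrite big1 ?addr0 // => i ne.
  by rewrite eq_mnm1 (negPf ne) mulr0.
rewrite (dhomog_nemf_coeff hG ne) big1 // => k _.
by case: eqP => [ek|]; rewrite ?mulr0 //; move: ne; rewrite -ek mdeg1.
Qed.

Definition linear_form (V : 'M[K]_M) (k : 'I_M) : form := \sum_i V i k *: 'X_i.

(** Evaluation at a row vector [c] becomes evaluation at [c *m V], so the [j]-th coordinate point is
    sent to row [j] of [V]. *)
Definition linear_subst (V : 'M[K]_M) (F : form) : form :=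
  F \mPo [tuple linear_form V k | k < M].

Lemma linear_formP V k : linear_form V k \is 1.-homog.
Proof. by apply: rpred_sum => i _; apply: rpredZ; rewrite dhomogX /= mdeg1. Qed.

Lemma linear_form_eval V k (c : 'I_M -> K) :
  (linear_form V k).@[c] = \sum_i V i k * c i.
Proof. by rewrite meval_sum; apply: eq_bigr => i _; rewrite mevalZ mevalXU. Qed.

Lemma linear_substX V u :
  linear_subst V 'X_[u] = \prod_k linear_form V k ^+ u k.
Proof. by rewrite /linear_subst comp_mpolyX; apply: eq_bigr => k _; rewrite tnth_mktuple. Qed.

Lemma linear_substXi V k : linear_subst V 'X_k = linear_form V k.
Proof. by rewrite /linear_subst comp_mpolyXU -tnth_nth tnth_mktuple. Qed.

Lemma linear_substZ V c F : linear_subst V (c *: F) = c *: linear_subst V F.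
Proof. exact: comp_mpolyZ. Qed.

Lemma linear_substD V F G : linear_subst V (F + G) = linear_subst V F + linear_subst V G.
Proof. exact: raddfD. Qed.

Lemma linear_subst0 V : linear_subst V 0 = 0.
Proof. exact: raddf0. Qed.

Lemma linear_substM V F G : linear_subst V (F * G) = linear_subst V F * linear_subst V G.
Proof. exact: rmorphM. Qed.

Lemma linear_subst_sum V (T : Type) (r : seq T) (P : pred T) (F : T -> form) :
  linear_subst V (\sum_(i <- r | P i) F i) = \sum_(i <- r | P i) linear_subst V (F i).
Proof. exact: comp_mpoly_sum. Qed.

Lemma linear_subst_eval V F (c : 'I_M -> K) :
  (linear_subst V F).@[c] = F.@[fun k => \sum_i V i k * c i].
Proof.
by rewrite comp_mpoly_meval; apply: meval_eq => k; rewrite tnth_mktuple linear_form_eval.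
Qed.

Lemma linear_subst_homog V d F : F \is d.-homog -> linear_subst V F \is d.-homog.
Proof.
move=> hF; rewrite [F]mpolyE linear_subst_sum big_seq; apply: rpred_sum => u hu.
rewrite linear_substZ; apply: rpredZ.
have <- : mdeg u = d by exact: (dhomog_mf hF hu).
rewrite linear_substX mdegE; apply: dhomog_prodn => k.
by rewrite -[X in X.-homog]mul1n; apply: dhomogMn; apply: linear_formP.
Qed.

Lemma linear_substK V W F : W *m V = 1%:M ->
  linear_subst W (linear_subst V F) = F.
Proof.
move=> WV; have XK k : linear_subst W (linear_form V k) = 'X_k.
  rewrite linear_subst_sum.
  under eq_bigr do rewrite linear_substZ linear_substXi scaler_sumr.
  rewrite exchange_big /= (bigD1 k) //= [X in _ + X]big1 ?addr0 => [|i ne].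
    under eq_bigr do rewrite scalerA mulrC.
    rewrite -scaler_suml; have /matrixP/(_ k k) := WV; rewrite !mxE eqxx => ->.
    by rewrite scale1r.
  under eq_bigr do rewrite scalerA mulrC.
  rewrite -scaler_suml; have /matrixP/(_ i k) := WV; rewrite !mxE (negPf ne) => ->.
  by rewrite scale0r.
elim/mpolyind: F => [|c u F _ _ IH]; first by rewrite !linear_subst0.
rewrite !linear_substD IH !linear_substZ linear_substX; congr (_ *: _ + _).
rewrite [RHS]mpolyXE_id /linear_subst rmorph_prod; apply: eq_bigr => k _.
by rewrite rmorphXn /= -/(linear_subst _ _) XK.
Qed.

(** Order of vanishing at the [j]-th coordinate point: the degree of each monomial in the other
    variables is at least [m], written without subtraction. *)
Definition coord_ord (j : 'I_M) (m : nat) (G : form) : Prop :=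
  forall u, u \in msupp G -> (m + u j <= mdeg u)%N.

Lemma coord_ordD j m F G : coord_ord j m F -> coord_ord j m G -> coord_ord j m (F + G).
Proof. by move=> HF HG u /msuppD_le; rewrite mem_cat => /orP[/HF|/HG]. Qed.

Lemma coord_ord0 j m : coord_ord j m 0.
Proof. by move=> u; rewrite msupp0. Qed.

Lemma coord_ordM j m m' F G :
  coord_ord j m F -> coord_ord j m' G -> coord_ord j (m + m') (F * G).
Proof.
move=> HF HG _ /msuppM_le /allpairsP[[u1 u2] /= [/HF h1 /HG h2 ->]].
by rewrite mnmE mdegD; lia.
Qed.

Lemma coord_ord_triv j G : coord_ord j 0 G.
Proof. by move=> u _; rewrite add0n mdegE (bigD1 j) //= leq_addr. Qed.

Lemma coord_ord_sum j m (T : Type) (r : seq T) (P : pred T) (F : T -> form) :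
  (forall i, P i -> coord_ord j m (F i)) -> coord_ord j m (\sum_(i <- r | P i) F i).
Proof.
by move=> H; elim/big_ind: _ => //; [exact: coord_ord0 | exact: coord_ordD].
Qed.

Lemma coord_ord1 j e G : G \is e.-homog -> G.@[fun i => (i == j)%:R] = 0 -> coord_ord j 1 G.
Proof.
move=> hG vG u hu; rewrite add1n ltn_neqAle; apply/andP; split; last first.
  by rewrite mdegE (bigD1 j) //= leq_addr.
apply/negP => /eqP eq_u.
suff z : G@_u = 0 by move: hu; rewrite mcoeff_msupp z eqxx.
have uE i : i != j -> u i = 0%N.
  by move: eq_u => + ne; rewrite mdegE (bigD1 j) //= (bigD1 i) //=; lia.
rewrite -vG mevalE (bigD1_seq u) ?msupp_uniq //= [X in _ + X]big_seq_cond.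
rewrite [X in _ + X]big1 => [|w /andP[hw ne]].
  rewrite addr0 big1 ?mulr1 // => i _; have [_|ne] := eqVneq i j; first by rewrite expr1n.
  by rewrite uE.
suff [i nj nw] : exists2 i, i != j & w i != 0%N.
  by rewrite (bigD1 i) //= (negPf nj) expr0n (negPf nw) mul0r mulr0.
apply/exists_inP; apply: contraNT ne; rewrite negb_exists_in => /forall_inP wE.
have {}wE i : i != j -> w i = 0%N by move/wE; rewrite negbK => /eqP.
have h : mdeg w = w j by rewrite mdegE (bigD1 j) //= big1 ?addn0 // => i /wE.
apply/eqP/mnmP => i; have [->|ne] := eqVneq i j; last by rewrite uE ?wE.
by rewrite -h eq_u (dhomog_mf hG hu) (dhomog_mf hG hw).
Qed.

End CoordinateChange.

Section PointOrder.
Variables (K : fieldType) (N : nat).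

Lemma ideal_pow_coord_ord (V : 'M[K]_N.+1) (p : proj_point K N) x j m F :
  val p = x *: row j V -> x != 0 ->
  ideal_pow (point_ideal p) m F -> coord_ord j m (linear_subst V F).
Proof.
move=> Hp nzx; elim: m F => [|m IH] F; first by move=> _; apply: coord_ord_triv.
move: F; apply: ideal_mulP => [|F G HF HG|F G [s [Hs ->]] HG].
- by rewrite linear_subst0; apply: coord_ord0.
- by rewrite linear_substD; apply: coord_ordD.
rewrite linear_substM -(add1n m); apply: coord_ordM; last exact: IH.
rewrite linear_subst_sum big_seq; apply: coord_ord_sum => cg /Hs [[e he] hv].
rewrite linear_substM -[1%N]add0n; apply: coord_ordM; first exact: coord_ord_triv.
apply: (coord_ord1 (linear_subst_homog V he)); rewrite linear_subst_eval.
have : x ^+ e * (cg.2).@[fun k => \sum_i V i k * (i == j)%:R] = 0.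
  rewrite -(meval_scaled _ _ he) -[RHS]hv; apply: meval_eq => k; rewrite Hp !mxE.
  rewrite (bigD1 j) //= eqxx mulr1 big1 ?addr0 // => i /negPf ->.
  by rewrite mulr0.
by move/eqP; rewrite mulf_eq0 expf_eq0 (negPf nzx) andbF => /eqP.
Qed.

Lemma homogenize_sum d (T : Type) (r : seq T) (P : pred T) (F : T -> {mpoly K[N]}) :
  homogenize d (\sum_(i <- r | P i) F i) = \sum_(i <- r | P i) homogenize d (F i).
Proof. by elim/big_rec2: _ => [|i x y _ <-]; rewrite ?homogenize0 ?homogenizeD. Qed.

Lemma point_ideal_homog (p : proj_point K N) a d F : has_affine_coords p a ->
  F \is d.-homog -> F.@[fun i => affine_point a 0 i] = 0 -> point_ideal p F.
Proof.
move=> Hp hF vF; have := @points_ideal_homog K N 1 (fun=> p) (fun=> a) (fun=> Hp) d F hF.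
by move/(_ (fun=> vF) ord0).
Qed.

(** A converse to [ideal_pow_ord]. In the expansion of [f] around [a], each factor ['X_i - a i]
    homogenizes to a linear form vanishing at [p]; the degree missing up to [D] is filled by a power
    of the zeroth variable. *)
Lemma ideal_pow_homogenize (p : proj_point K N) a m D f : has_affine_coords p a ->
  ord_ge a m f -> deg_le D f -> ideal_pow (point_ideal p) m (homogenize D f).
Proof.
move=> Hp /low_order_msupp Hf /(deg_le_translate a)/deg_le_msupp Hd.
rewrite -[f](translateK a) [translate a f]mpolyE comp_mpoly_sum homogenize_sum big_seq.
elim/big_ind: _ => [||u hu]; [exact: ideal_pow0 | exact: ideal_powD |].
rewrite comp_mpolyZ homogenizeZ -mul_mpolyC; apply: ideal_powM.
pose G := \prod_i homogenize 1 ('X_i - (a i)%:MP) ^+ u i : {mpoly K[N.+1]}.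
have hG : G \is (mdeg u).-homog.
  rewrite mdegE; apply: dhomog_prodn => i; rewrite -[X in X.-homog]mul1n.
  by apply: dhomogMn; apply: homogenizeP.
have Gpow : ideal_pow (point_ideal p) (mdeg u) G.
  rewrite mdegE; apply: ideal_pow_prod => i _; apply: ideal_pow_mem.
  apply: (point_ideal_homog Hp (homogenizeP _ _)); rewrite -dehom_eval homogenizeK.
    by rewrite mevalB mevalXU mevalC subrr.
  exact: deg_le_lin.
have dG : dehom G = translate (fun i => - a i) 'X_[u].
  rewrite /dehom rmorph_prod comp_mpolyX; apply: eq_bigr => i _ /=.
  rewrite tnth_mktuple rmorphXn /= -/(dehom _) homogenizeK ?mpolyCN //.
  exact: deg_le_lin.
rewrite -dG -(subnK (Hd u hu)) -[dehom G]mul1r homogenizeM; first last.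
- by rewrite dG; apply: deg_le_translate; apply: deg_leX.
- exact: deg_le1.
by apply: ideal_powM; rewrite dehomK //; apply: ideal_powW Gpow; apply: Hf.
Qed.

(** The coefficients of the homogenized dual functions form a right inverse. *)
Lemma affine_rows_free n (a : 'I_n -> 'I_N -> K) :
  jet_surj a (@zero_ideal K N) (fun=> 1%N) 1 ->
  row_free (\matrix_(j < n) affine_point (a j)).
Proof.
move=> /jet_surj_dual[e [de ev]]; apply/row_freeP.
exists (\matrix_(k, i) (homogenize 1 (e i))@_U_(k)); apply/matrixP => j i.
rewrite [LHS]mxE [RHS]mxE eq_sym -ev -(homogenizeK (de i)) dehom_eval.
rewrite [in RHS](homog1E (homogenizeP _ _)) meval_sum.
by apply: eq_bigr => k _; rewrite mevalZ mevalXU mulrC !mxE; case: (unlift _ _).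
Qed.

End PointOrder.

Lemma row_free_complete (K : fieldType) (n M : nat) (A : 'M[K]_(n, M)) : row_free A ->
  exists2 V : 'M[K]_M, V \in unitmx &
    forall (j : 'I_n) (i : 'I_M), i = j :> nat -> row i V = row j A.
Proof.
move=> free; have leM : (n <= M)%N by move/eqP: (free) => <-; exact: rank_leq_col.
move: A free; rewrite -(subnKC leM) => A /eqP rankA; set k := (M - n)%N in A rankA *.
exists (block_mx (col_ebase A) 0 0 1%:M *m row_ebase A).
  rewrite unitmx_mul row_ebase_unit andbT unitmxE det_ublock det1 mulr1.
  by rewrite -unitmxE col_ebase_unit.
move=> j i eij; have -> : i = lshift k j by apply: val_inj.
rewrite -{3}(mulmx_ebase A) rankA.
have -> : col_ebase A *m (pid_mx n : 'M_(n, n + k)) = row_mx (col_ebase A) 0.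
  by rewrite -[pid_mx n]/(pid_mx _) pid_mx_row mul_mx_row mulmx1 mulmx0.
rewrite !row_mul; congr (_ *m _).
by rewrite /block_mx -[lshift k j]/(lshift k j) rowKu.
Qed.

(** * At most four points, and the simplex *)

Section FewPoints.
Variables (K : fieldType) (N : nat).

(** Once the points are coordinate points, any single monomial [u] of the form has [m + u j <= D]
    for every [j]; the bound is the sum of these inequalities. *)
Lemma simplex_bound (a : 'I_N.+1 -> 'I_N -> K) f D m :
  jet_surj a (@zero_ideal K N) (fun=> 1%N) 1 ->
  f != 0 -> deg_le D f -> (forall j, ord_ge (a j) m f) ->
  (N.+1 * m <= N * D)%N.
Proof.
move=> /affine_rows_free; set V := \matrix_j _; rewrite row_free_unit => Vunit.
move=> nzf df Hf; pose G := linear_subst V (homogenize D f).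
have hG : G \is D.-homog by apply/linear_subst_homog/homogenizeP.
have nzG : G != 0.
  apply: contraNneq nzf => G0; rewrite -(homogenizeK df).
  rewrite -(linear_substK (homogenize D f) (mulVmx Vunit)) -/G G0.
  by rewrite linear_subst0 dehom0.
have ordG j : coord_ord j m G.
  pose q : proj_point K N := exist _ (affine_point (a j)) (affine_point_neq0 (a j)).
  apply: (@ideal_pow_coord_ord _ _ V q 1); rewrite ?oner_neq0 //.
    by rewrite scale1r rowK.
  apply: ideal_pow_homogenize => //.
  by exists 1; rewrite ?oner_neq0 ?scale1r.
have [u hu] : exists u, u \in msupp G.
  case E: (msupp G) => [|u s]; last by exists u; rewrite inE eqxx.
  by move/eqP: E; rewrite msupp_eq0 (negPf nzG).
have : (\sum_(j < N.+1) (m + u j) <= \sum_(j < N.+1) D)%N.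
  by apply: leq_sum => j _; rewrite -(dhomog_mf hG hu); apply: ordG.
rewrite big_split /= !sum_nat_const card_ord -mdegE.
by rewrite (dhomog_mf hG hu : mdeg u = D); lia.
Qed.

Variables (n : nat) (p : 'I_n -> proj_point K N) (a : 'I_n -> 'I_N -> K).
Hypothesis Hp : forall j, has_affine_coords (p j) (a j).
Hypothesis interp : jet_surj a (@zero_ideal K N) (fun=> 1%N) 1.

Local Notation mixed :=
  (mixed_pow (@irrelevant_ideal K N) (points_ideal p)).

Section CoordinatePoints.
Variable W : 'M[K]_N.+1.
Local Notation E := (linear_form W).
Hypothesis dualW : forall (j : 'I_n) i,
  (E i).@[fun k => affine_point (a j) 0 k] = (i == j :> nat)%:R.

Lemma homog_mixed d F : F \is d.-homog -> mixed d 0 F.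
Proof.
by move=> hF; rewrite -[F]mulr1; apply: ideal_mul_mem => //; apply: irrelevant_homog.
Qed.

Lemma vanishing_mixed d F : F \is d.-homog ->
  (forall j, F.@[fun i => affine_point (a j) 0 i] = 0) -> mixed 0 1 F.
Proof.
move=> hF vF; rewrite -[F]mul1r; apply: ideal_mul_mem => //; rewrite -[F]mulr1.
by apply: ideal_mul_mem => //; apply: points_ideal_homog hF vF.
Qed.

Lemma sum_mnm_pos (u : 'X_{1..N.+1}) (P : pred 'I_N.+1) :
  (0 < \sum_(i | P i) u i)%N -> exists2 i, P i & (0 < u i)%N.
Proof.
move=> pos; have /existsP[i /andP[Pi ui]] : [exists i, P i && (0 < u i)%N].
  apply: contraTT pos; rewrite negb_exists => /forallP h.
  rewrite -leqNgt leqn0 big1 // => i Pi; have := h i.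
  by rewrite Pi lt0n negbK => /eqP.
by exists i.
Qed.

Lemma sum_mnm_sub (u : 'X_{1..N.+1}) i (P : pred 'I_N.+1) : (0 < u i)%N ->
  (\sum_(k | P k) (u - U_(i))%MM k + P i = \sum_(k | P k) u k)%N.
Proof.
move=> ui; rewrite -[in RHS](submK (m := U_(i)) (m' := u)); last by rewrite lep1mP -lt0n.
under [RHS]eq_bigr do rewrite mnmDE mnm1E.
rewrite big_split /=; congr (_ + _)%N.
case: (boolP (P i)) => Pi; last first.
  by rewrite big1 // => k Pk; case: eqP => // e; rewrite e Pk in Pi.
by rewrite (bigD1 i) //= eqxx big1 ?addn0 // => k /andP[_ /negPf]; rewrite eq_sym => ->.
Qed.

Lemma mdeg_sub1 (u : 'X_{1..N.+1}) i : (0 < u i)%N -> (mdeg (u - U_(i))%MM + 1 = mdeg u)%N.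
Proof. by move=> ui; have := sum_mnm_sub xpredT ui; rewrite !mdegE. Qed.

Lemma linear_substX_sub (u : 'X_{1..N.+1}) i : (0 < u i)%N ->
  linear_subst W 'X_[u] = E i * linear_subst W 'X_[u - U_(i)].
Proof.
move=> ui; rewrite -linear_substXi -linear_substM -mpolyXD addmC submK //.
by rewrite lep1mP -lt0n.
Qed.

Definition outer_deg (u : 'X_{1..N.+1}) : nat := (\sum_(i < N.+1 | n <= i) u i)%N.

Lemma outer_deg_sub1 (u : 'X_{1..N.+1}) (i : 'I_N.+1) : (n <= i)%N -> (0 < u i)%N ->
  (outer_deg (u - U_(i))%MM + 1 = outer_deg u)%N.
Proof. by move=> ni /(sum_mnm_sub (fun k => n <= k)%N); rewrite ni. Qed.

(* Factors of index at least [n], and products of two different factors, vanish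
   at all the points.  Using up the former first and then the two largest
   exponents keeps the hypotheses true. *)
Lemma monomial_mixed (u : 'X_{1..N.+1}) r b :
  (forall j : 'I_N.+1, (j < n)%N -> u j + r <= mdeg u)%N ->
  (2 * r + b <= mdeg u + outer_deg u)%N ->
  (r + b <= mdeg u)%N -> mixed b r (linear_subst W 'X_[u]).
Proof.
elim: r u b => [|r IH] u b H1 H2 H3.
  apply: (@mixed_powW _ _ _ _ (mdeg u) 0 0) => //.
  apply/homog_mixed/linear_subst_homog; by rewrite dhomogX.
have [c0|/sum_mnm_pos[i le_ni ui]] := posnP (outer_deg u); last first.
  have du := mdeg_sub1 ui; have su := outer_deg_sub1 le_ni ui.
  rewrite (linear_substX_sub ui) -[b]add0n -[r.+1]add1n; apply: mixed_powM.
    apply: (vanishing_mixed (linear_formP W i)) => j; rewrite dualW.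
    by case: eqP => // e; move: le_ni; rewrite /= e leqNgt ltn_ord.
  apply: IH; [|lia|lia] => j lt_jn; have := H1 j lt_jn.
  by rewrite mnmBE; lia.
have sumlt : (\sum_(i < N.+1 | (i < n)%N) u i = mdeg u)%N.
  rewrite mdegE [RHS](bigID (fun i : 'I_N.+1 => n <= i)%N) /=.
  rewrite -/(outer_deg u) c0 add0n.
  by apply: eq_bigl => i; rewrite -ltnNge.
have [i0 ni0 ui0] : exists2 i : 'I_N.+1, (i < n)%N & (0 < u i)%N.
  by apply: sum_mnm_pos; rewrite sumlt; lia.
case: (@arg_maxnP _ i0 (fun i : 'I_N.+1 => i < n)%N (fun i => u i) ni0) => i ni maxi.
have ui : (0 < u i)%N by apply: leq_trans ui0 (maxi _ ni0).
have sumi := sumlt; rewrite (bigD1 i) //= in sumi.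
have [k0 /andP[nk0 ki0] uk0] : exists2 k : 'I_N.+1, (k < n)%N && (k != i) & (0 < u k)%N.
  apply: sum_mnm_pos; rewrite lt0n; apply/eqP => z.
  by have := H1 i ni; rewrite -sumi z; lia.
case: (@arg_maxnP _ k0 (fun k : 'I_N.+1 => (k < n)%N && (k != i)) (fun i => u i)).
  by rewrite nk0.
move=> k /andP[nk ki] maxk.
have uk : (0 < u k)%N by apply: leq_trans uk0 (maxk _ _); rewrite nk0.
rewrite (bigD1 k) ?nk //= in sumi.
have uk' : (0 < (u - U_(i))%MM k)%N by rewrite mnmBE mnm1E eq_sym (negPf ki) subn0.
rewrite (linear_substX_sub ui) (linear_substX_sub uk') mulrA -[b]add0n -[r.+1]add1n.
have d1 := mdeg_sub1 ui; have d2 := mdeg_sub1 uk'.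
apply: mixed_powM.
  apply: (vanishing_mixed (dhomogM (linear_formP W i) (linear_formP W k))) => j.
  rewrite mevalM !dualW; case: eqP => [e1|]; last by rewrite mul0r.
  case: eqP => [e2|]; last by rewrite mulr0.
  by case/eqP: ki; apply: val_inj; rewrite /= e1 e2.
apply: IH; [|lia|lia] => j nj; rewrite !mnmBE !mnm1E.
have := H1 j nj; have [<-|ji] := eqVneq i j; first by rewrite (negPf ki); lia.
have [<-|jk] := eqVneq k j; first by have := maxi k nk; lia.
have := maxi j nj; have := maxk j; rewrite nj eq_sym ji => /(_ isT).
rewrite (bigD1 j) /= ?nj ?(eq_sym j) ?ji ?jk // in sumi.
by lia.
Qed.

End CoordinatePoints.

(** Summing [u j + 3 * r <= mdeg u] over the points gives [3 * n * r <= (n - 1) * mdeg u + outer_deg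
    u] for each monomial. For [n <= 4] this implies [4 * r <= mdeg u + outer_deg u], as
    [monomial_mixed] requires for the exponent [2 * r]. *)
Theorem few_points_containment r : (0 < n <= 4)%N -> (n <= N.+1)%N ->
  subideal (symbolic_power p (3 * r))
           (ideal_mul (ideal_pow (@irrelevant_ideal K N) (2 * r))
                      (ideal_pow (points_ideal p) r)).
Proof.
move=> /andP[n_gt0 n_le4] leN F HF.
have [V Vunit Vrow] := row_free_complete (affine_rows_free interp).
rewrite -(linear_substK F (mulVmx Vunit)); set G := linear_subst V F.
rewrite [G]mpolyE linear_subst_sum big_seq; apply: ideal_mul_sum => u hu.
have dualW (j : 'I_n) i :
    (linear_form (invmx V) i).@[fun k => affine_point (a j) 0 k] = (i == j :> nat)%:R.
  pose j' := widen_ord leN j.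
  have := mulmxV Vunit => /matrixP/(_ j' i); rewrite !mxE linear_form_eval eq_sym => <-.
  apply: eq_bigr => k _; rewrite mulrC; congr (_ * _).
  by have /rowP/(_ k) := Vrow j j' erefl; rewrite rowK [in RHS]mxE [LHS]mxE => ->; rewrite mxE.
have Hu (j : 'I_N.+1) : (j < n)%N -> (u j + 3 * r <= mdeg u)%N.
  move=> lt_jn; rewrite addnC; have [x nzx Ex] := Hp (Ordinal lt_jn).
  apply: (@ideal_pow_coord_ord _ _ V (p (Ordinal lt_jn)) x j (3 * r) F) => //.
    by rewrite (Vrow (Ordinal lt_jn)) // rowK.
have lt_sum : (\sum_(i < N.+1 | (i < n)%N) (u i + 3 * r) <= n * mdeg u)%N.
  apply: leq_trans (_ : \sum_(i < N.+1 | (i < n)%N) mdeg u <= _)%N.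
    by apply: leq_sum => i; apply: Hu.
  by rewrite -(big_ord_widen _ (fun=> mdeg u) leN) sum_nat_const card_ord.
rewrite big_split /= -(big_ord_widen _ (fun=> 3 * r)%N leN) sum_nat_const card_ord in lt_sum.
have sumE : mdeg u = (\sum_(i < N.+1 | (i < n)%N) u i + outer_deg u)%N.
  rewrite mdegE (bigID (fun i : 'I_N.+1 => i < n)%N) /=; congr (_ + _)%N.
  by apply: eq_bigl => i; rewrite -leqNgt.
set x := (\sum_(i < N.+1 | (i < n)%N) u i)%N in lt_sum sumE; clearbody x.
have h0 : (3 * r <= mdeg u)%N by have := Hu (widen_ord leN (Ordinal n_gt0)) n_gt0; lia.
have h4 : (4 * r <= mdeg u + outer_deg u)%N.
  have : n \in [:: 1; 2; 3; 4]%N by rewrite !inE; lia.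
  by rewrite !inE => /or4P[] /eqP en; rewrite en in lt_sum; lia.
rewrite linear_substZ -mul_mpolyC -[(2 * r)%N]add0n -[X in ideal_pow _ X]add0n.
apply: (mixed_powM (a := 0) (r := 0)).
  by apply: homog_mixed; rewrite -alg_mpolyC; apply: rpredZ; exact: dhomog1.
apply: (monomial_mixed dualW) => [j /Hu||]; lia.
Qed.

End FewPoints.

(** * Thirteen points in five planes *)

Section Curves.
Variables (K : fieldType) (k : nat).
Local Notation poly := {mpoly K[k]}.

(** By [leading_form_coords] every leading form is a form in the [f i], and modulo [J] only its term
    in a power of [f i0] remains. *)
Lemma curve_param_coords J (a : 'I_k -> K) (f : 'I_k -> poly) (G : 'M[K]_k) i0 :
  is_ideal J -> G \in unitmx ->
  (forall i, ord_ge a 2 (f i - \sum_j G i j *: ('X_j - (a j)%:MP))) ->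
  (forall i, i != i0 -> J (f i)) -> ord_ge a 1 (f i0) -> curve_param J a (f i0).
Proof.
move=> [J0 JD JM] uG Hf Jf f1; split=> // r g Hg.
have [phi [hphi Hphi]] := leading_form_coords uG Hf Hg.
set q := comp_mpoly _ _ in Hphi.
suff [x Jx] : exists x, J (q - x *: f i0 ^+ r).
  exists x; exists (q - x *: f i0 ^+ r); split=> //.
  by rewrite (_ : _ - _ = g - q) //; ring.
rewrite /q [phi]mpolyE comp_mpoly_sum big_seq.
elim/big_ind: _ => [|p1 p2 [x1 H1] [x2 H2]|u hu].
- by exists 0; rewrite scale0r subr0.
- exists (x1 + x2); rewrite scalerDl opprD addrACA; exact: JD.
have du : mdeg u = r by exact: (dhomog_mf hphi hu).
have [/exists_inP[i ne ui]|/exists_inPn h] := boolP [exists i in predC1 i0, u i != 0%N].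
  exists 0; rewrite scale0r subr0 comp_mpolyZ -mul_mpolyC comp_mpolyX (bigD1 i) //=.
  rewrite tnth_mktuple; move: ui; case: (u i) => // e _.
  set q' := \prod_(j | _) _.
  by rewrite (_ : _ * _ = (phi@_u)%:MP * f i ^+ e * q' * f i);
     [apply/JM/Jf | rewrite exprS; ring].
exists phi@_u; rewrite comp_mpolyZ comp_mpolyX (bigD1 i0) //= big1 => [|i ne]; last first.
  by have := h i ne; rewrite negbK => /eqP ->; rewrite expr0.
have -> : u i0 = r.
  rewrite -du mdegE (bigD1 i0) //= big1 ?addn0 // => i ne.
  by have := h i ne; rewrite negbK => /eqP.
by rewrite tnth_mktuple mulr1 subrr.
Qed.

Lemma ord_ge_pow a (p : poly) e : ord_ge a (if p.@[a] == 0 then e else 0%N) (p ^+ e).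
Proof.
case: eqP => [/ord_ge1 h|_]; last exact: ord_ge_triv.
by have := ord_ge_exp (e := e) h; rewrite mul1n.
Qed.

Variables (T : finType) (c : T -> 'I_k -> K).

Lemma exists_half r : exists e, (r <= 2 * e <= r.+1)%N.
Proof.
elim: r => [|r [e He]]; first by exists 0%N.
by have [h|h] := ltnP r (2 * e); [exists e | exists e.+1]; lia.
Qed.

(* The chords through [i, l], [l, m1], the sides of [m1, m2, m3], with
   exponents [r], [s - r], [e], [e], [s - e] for [e = (r + 1) / 2]. *)
Lemma slope52_five J (P : pred T) (S : eqType) (lab : T -> S) (cn : S -> 'I_k -> K)
    (s : seq S) (pi : S -> S -> poly) :
  is_ideal J -> injective lab -> (forall i, c i = cn (lab i)) ->
  (forall i, P i -> lab i \in s) -> size s = 5 -> uniq s ->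
  (forall a b, deg_le 1 (pi a b)) ->
  (forall a b x, a \in s -> b \in s -> x \in s -> a != b ->
     ((pi a b).@[cn x] == 0) = (x == a) || (x == b)) ->
  (forall a b, a \in s -> b \in s -> a != b -> curve_param J (cn a) (pi a b)) ->
  slope52 c J P.
Proof.
move=> idJ lab_inj cE Ps size_s uniq_s deg_pi eval_pi param.
exists 0%N => m d led; apply: jet_surj_curve => // i r Pi lt_rm.
have /rot_to[j s' Es] := Ps i Pi.
have sz : size s' = 4 by have := congr1 size Es; rewrite size_rot size_s => -[].
have un : uniq (lab i :: s') by rewrite -Es rot_uniq.
have mem x : x \in lab i :: s' -> x \in s by rewrite -Es mem_rot.
case: s' sz Es un mem => [|l [|m1 [|m2 [|m3 [|//]]]]] // _ Es un mem.
move: un; rewrite /= !inE !negb_or -!andbA.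
case/and5P=> n1 n2 n3 n4 /and5P[n5 n6 n7 n8 /and3P[n9 n10 _]].
have ni : lab i \in s by apply: mem; rewrite !inE eqxx ?orbT.
have nl : l \in s by apply: mem; rewrite !inE eqxx ?orbT.
have nm1 : m1 \in s by apply: mem; rewrite !inE eqxx ?orbT.
have nm2 : m2 \in s by apply: mem; rewrite !inE eqxx ?orbT.
have nm3 : m3 \in s by apply: mem; rewrite !inE eqxx ?orbT.
(* The lower bound gives order [m - r + 2 * e >= m] at [m1]; the upper one, with [r < m], keeps the
   degree [2 * m + e] within [5 * m / 2]. *)
have [e He] : exists e, (r <= 2 * e <= r.+1)%N by apply: exists_half.
exists (pi (lab i) l),
  (pi l m1 ^+ (m - r) * (pi m1 m2 ^+ e * (pi m1 m3 ^+ e * pi m2 m3 ^+ (m - e)))).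
split.
- by rewrite cE; apply: param.
- rewrite cE !mevalM !rmorphXn /= !mulf_eq0 !negb_or !expf_eq0 !negb_and !eval_pi //.
  by rewrite !negb_or n1 n2 n3 n4 !orbT.
- have := deg_leM (deg_le_exp r (deg_pi (lab i) l))
    (deg_leM (deg_le_exp (m - r) (deg_pi l m1)) (deg_leM (deg_le_exp e (deg_pi m1 m2))
    (deg_leM (deg_le_exp e (deg_pi m1 m3)) (deg_le_exp (m - e) (deg_pi m2 m3))))).
  move=> h; apply: deg_leW h; clear -led lt_rm He. lia.
move=> x Px nx; rewrite cE.
have nlx : lab x != lab i by rewrite (inj_eq lab_inj).
have : lab x \in [:: l; m1; m2; m3].
  by have := Ps x Px; rewrite -(mem_rot j) Es inE (negPf nlx).
have := ord_geM (@ord_ge_pow (cn (lab x)) (pi (lab i) l) r)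
  (ord_geM (@ord_ge_pow (cn (lab x)) (pi l m1) (m - r))
  (ord_geM (@ord_ge_pow (cn (lab x)) (pi m1 m2) e)
  (ord_geM (@ord_ge_pow (cn (lab x)) (pi m1 m3) e)
           (@ord_ge_pow (cn (lab x)) (pi m2 m3) (m - e))))).
rewrite !eval_pi ?(Ps x Px) // (negPf nlx) => h hx; apply: ord_geW h.
move: hx; rewrite !inE => /or4P[] /eqP ->; rewrite !eqxx ?orbT /=; clear -lt_rm He; lia.
Qed.
End Curves.

(** * The thirteen points and their numerical checks *)

Section ThirteenPoints.

Definition dot3 (v p : seq int) : int := v`_0 * p`_0 + v`_1 * p`_1 + v`_2 * p`_2.
Definition aff3 (v p : seq int) : int := dot3 v p + v`_3.
Definition cross3 (v w : seq int) : seq int :=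
  [:: v`_1 * w`_2 - v`_2 * w`_1; v`_2 * w`_0 - v`_0 * w`_2; v`_0 * w`_1 - v`_1 * w`_0].
(** In [plane6], the conics through the four points [(+-1, +-1)] are the combinations of [x^2 - 1]
    and [y^2 - 1], so three coefficients suffice. *)
Definition conic3 (q p : seq int) : int := q`_0 * p`_0 ^+ 2 + q`_1 * p`_1 ^+ 2 + q`_2.
Definition conic_grad (q p : seq int) : seq int := [:: 2 * q`_0 * p`_0; 2 * q`_1 * p`_1; 0].
(** The plane through [p] and [q] parallel to the third axis, which cuts [plane6] along their
    chord. *)
Definition chord3 (p q : seq int) : seq int :=
  [:: p`_1 - q`_1; q`_0 - p`_0; 0; p`_0 * q`_1 - p`_1 * q`_0].

(* Each point lies on exactly two of five planes.  [plane6] contains six points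
   and each of [planes5] five, listed with the sides of a pentagon they form.
   In [plane6] the six points are covered twice by two conics, each through the
   four points [(+-1, +-1)] and one of the others, and a line. *)
Definition points13 : seq (seq int) := [::
  [:: 1; 1; 0]; [:: -1; 1; 0]; [:: 1; -1; 0]; [:: -1; -1; 0]; [:: 0; 3; 0]; [:: 3; 0; 0];
  [:: -4; 0; 1]; [:: 0; 2; -1]; [:: -2; -3; 4]; [:: -2; 0; -1]; [:: -2; -2; 1];
  [:: 2; 0; -1]; [:: 2; 1; -4]]%Z.

Definition plane6 : seq int := [:: 0; 0; 1; 0]%Z.

Definition planes5 : seq (seq int * seq (seq int)) := [::
  ([:: 0; -1; -1; 1], [:: [:: 0; 1; -1; -1]; [:: -2; 3; -3; -5]; [:: 1; -1; 1; 3];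
                          [:: -5; 1; -1; -3]; [:: 8; -3; 3; -5]]);
  ([:: 0; -1; -1; -1], [:: [:: 0; 1; -1; 1]; [:: 2; 1; -1; 3]; [:: -1; 0; 0; -2];
                           [:: 1; -1; 1; -1]; [:: -2; 1; -1; 3]]);
  ([:: -1; 1; -1; -3], [:: [:: -2; 5; 7; -15]; [:: 0; -1; -1; 1]; [:: -1; 1; 2; 0];
                           [:: -2; -7; -5; -9]; [:: 1; 1; 0; -3]]);
  ([:: 1; -3; -1; -3], [:: [:: -15; 1; -18; 45]; [:: 10; 3; 1; 25]; [:: 4; -1; 7; -1];
                           [:: 10; 3; 1; -19]; [:: -13; -5; 2; 39]])]%Z.

Definition conic_a : seq int := [:: 8; 1; -9]%Z.
Definition conic_b : seq int := [:: 1; 8; -9]%Z.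
Definition line6 : seq int := [:: 1; 1; 0; -3]%Z.

(* Transversal to all the lines used, so that it separates their points. *)
Definition slant : seq int := [:: 1; 2; 0]%Z.

Definition pt13 (k : nat) : seq int := nth [::] points13 k.
Definition on_plane v k : bool := aff3 v (pt13 k) == 0.
Definition on_conic q k : bool := conic3 q (pt13 k) == 0.
Definition range13 : seq nat := iota 0 13.

(** The triple product is nonzero exactly when [slant] is nonconstant on the line of direction
    [cross3 h v], so that it provides a parameter there. *)
Definition good_line (h v : seq int) : bool :=
  let s := [seq k <- range13 | on_plane h k & on_plane v k] in
  [&& (size s <= 2)%N, dot3 (cross3 h v) slant != 0 &
      all (fun a => all (fun b => (a != b) ==> (dot3 slant (pt13 a) != dot3 slant (pt13 b))) s) s].

Definition good_pentagon (h : seq int) (vs : seq (seq int)) : bool :=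
  [&& size vs == 5, all (good_line h) vs &
    all (fun k => on_plane h k ==> (2 <= count (on_plane^~ k) vs)%N) range13].

(** The second condition makes a chord transversal to the conic at its end points, hence a local
    parameter there; the third says that it meets no other of the five points. *)
Definition good_conic (h q : seq int) : bool :=
  let s := [seq k <- range13 | on_plane h k & on_conic q k] in
  [&& size s == 5, all (fun a => all (fun b => (a != b) ==>
        (dot3 (cross3 h (conic_grad q (pt13 a))) (chord3 (pt13 a) (pt13 b)) != 0)) s) s &
      all (fun a => all (fun b => (a != b) ==> all (fun x =>
        on_plane (chord3 (pt13 a) (pt13 b)) x == ((x == a) || (x == b))) s) s) s].

Lemma pentagons_good : all (fun hv => good_pentagon hv.1 hv.2) planes5.
Proof. by vm_compute. Qed.

Lemma conics_good : good_conic plane6 conic_a && good_conic plane6 conic_b.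
Proof. by vm_compute. Qed.

Lemma line6_good : good_line plane6 line6.
Proof. by vm_compute. Qed.

Lemma plane6_cover : all (fun k => on_plane plane6 k ==>
  (2 <= on_conic conic_a k + on_conic conic_b k + on_plane line6 k)%N) range13.
Proof. by vm_compute. Qed.

Lemma planes_cover : all (fun k =>
  2 <= on_plane plane6 k + count (fun hv => on_plane hv.1 k) planes5)%N range13.
Proof. by vm_compute. Qed.

Variables (K : fieldType) (charK0 : [pchar K] =i pred0).
Local Notation poly := {mpoly K[3]}.

Lemma intr_eq0_char0 (x : int) : (x%:~R == 0 :> K) = (x == 0).
Proof.
case: x => n; first by rewrite -[_%:~R]/(n%:R) natr_eq0.
by rewrite NegzE mulrNz oppr_eq0 -[_%:~R]/(n.+1%:R) natr_eq0.
Qed.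

Definition pt_coords (p : seq int) : 'I_3 -> K := fun l => (p`_l)%:~R.
Definition c13 (i : 'I_13) : 'I_3 -> K := pt_coords (pt13 i).

Definition linp (v : seq int) : poly :=
  \sum_(l < 3) (v`_l)%:~R *: 'X_l + (v`_3)%:~R%:MP.

Definition conicp (q : seq int) : poly :=
  (q`_0)%:~R *: 'X_0 ^+ 2 + (q`_1)%:~R *: 'X_1 ^+ 2 + (q`_2)%:~R%:MP.

Lemma linp_eval v p : (linp v).@[pt_coords p] = (aff3 v p)%:~R.
Proof.
rewrite /linp mevalD mevalC meval_sum !big_ord_recl big_ord0 !mevalZ !mevalXU.
by rewrite /pt_coords /aff3 /dot3 !rmorphD !rmorphM /= addr0 !addrA.
Qed.

Lemma conicp_eval q p : (conicp q).@[pt_coords p] = (conic3 q p)%:~R.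
Proof.
rewrite /conicp !mevalD mevalC !mevalZ !rmorphXn /= !mevalXU.
by rewrite /pt_coords /conic3 !rmorphD !rmorphM.
Qed.

Lemma deg_linp v : deg_le 1 (linp v).
Proof.
apply: deg_leD; last exact: deg_leC.
by apply: deg_le_sum => l _; apply/deg_leZ/deg_leXi.
Qed.

Lemma deg_conicp q : deg_le 2 (conicp q).
Proof.
apply: deg_leD; last exact: deg_leC.
by apply: deg_leD; apply: deg_leZ; apply: (deg_le_exp 2 (deg_leXi _ _)).
Qed.

Lemma on_planeE v (i : 'I_13) : ((linp v).@[c13 i] == 0) = on_plane v i.
Proof. by rewrite linp_eval intr_eq0_char0. Qed.

Lemma on_conicE v (i : 'I_13) : ((conicp v).@[c13 i] == 0) = on_conic v i.
Proof. by rewrite conicp_eval intr_eq0_char0. Qed.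

Definition has_gradient (f : poly) p (g : seq int) : Prop :=
  ord_ge (pt_coords p) 2 (f - \sum_(j < 3) (g`_j)%:~R *: ('X_j - (pt_coords p j)%:MP)).

Lemma linp_gradient v p : aff3 v p = 0 -> has_gradient (linp v) p v.
Proof.
move=> v0; rewrite /has_gradient (_ : _ - _ = ((linp v).@[pt_coords p])%:MP).
  by rewrite linp_eval v0; apply: ord_ge0.
rewrite /linp mevalD mevalC meval_sum !big_ord_recl !big_ord0 !mevalZ !mevalXU.
by rewrite -!mul_mpolyC !mpolyCD !mpolyCM ?mpolyC0; ring.
Qed.

Lemma conicp_gradient q p : conic3 q p = 0 -> has_gradient (conicp q) p (conic_grad q p).
Proof.
move=> q0; rewrite /has_gradient.
pose y j : poly := 'X_j - (pt_coords p j)%:MP.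
have -> : conicp q - \sum_(j < 3) ((conic_grad q p)`_j)%:~R *: y j =
    (q`_0)%:~R *: y 0 ^+ 2 + (q`_1)%:~R *: y 1 ^+ 2 + ((conicp q).@[pt_coords p])%:MP.
  rewrite /conicp !mevalD mevalC !mevalZ !rmorphXn /= !mevalXU /y.
  rewrite !big_ord_recl !big_ord0 /= !rmorphM /= /pt_coords.
  have -> : (lift ord0 ord0 : 'I_3) = 1 by apply: val_inj.
  rewrite -!mul_mpolyC !mpolyCD !mpolyCM; ring.
rewrite conicp_eval q0 mpolyC0 addr0.
by apply: ord_geD; apply: ord_geZ; exact: (@ord_ge_exp _ _ _ 1 _ 2 (ord_ge_subX _ _)).
Qed.

(** The triple product of the gradients is the Jacobian determinant: [h], [k], [t] are local
    coordinates at [p], the first two of which lie in [J]. *)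
Lemma curve_param3 J p h k t gh gk gt : is_ideal J -> J h -> J k ->
  has_gradient h p gh -> has_gradient k p gk -> has_gradient t p gt ->
  dot3 (cross3 gh gk) gt != 0 -> t.@[pt_coords p] = 0 ->
  curve_param J (pt_coords p) t.
Proof.
move=> idJ Jh Jk Hh Hk Ht nz t0.
pose f (i : 'I_3) := nth 0 [:: h; k; t] i.
pose G : 'M[K]_3 := \matrix_(i, j) ((nth [::] [:: gh; gk; gt] i)`_j)%:~R.
have uG : G \in unitmx.
  rewrite unitmxE unitfE; move: nz; rewrite -intr_eq0_char0; congr (_ != 0).
  rewrite (expand_det_row _ ord_max) !big_ord_recl big_ord0 /cofactor.
  rewrite !(expand_det_row _ ord0) !big_ord_recl !big_ord0 /cofactor !det_mx11 !mxE /=.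
  rewrite /dot3 /cross3 /= !rmorphD !rmorphM /= !rmorphB !rmorphM /=.
  ring.
apply: (@curve_param_coords _ _ J (pt_coords p) f G ord_max) => //.
- move=> i; rewrite /f; under eq_bigr do rewrite mxE.
  by case: i => [[|[|[|//]]] hi] /=.
- by case=> [[|[|[|//]]] hi] //=.
- by apply/ord_ge1.
Qed.
(** At most two points lie on the line, so degree [r + m] suffices: the parameter at one point to
    the power [r], that at the other to the power [m]. This slope 2 is below 5/2. *)
Lemma good_line_slope J h v (P : pred 'I_13) : is_ideal J -> J (linp h) -> J (linp v) ->
  good_line h v -> (forall i, P i -> on_plane h i && on_plane v i) ->
  slope52 c13 J P.
Proof.
move=> idJ Jh Jv /and3P[size_s nz /allP sep] PE.
set s := [seq k <- _ | _] in size_s sep.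
have Ps (i : 'I_13) : P i -> val i \in s.
  by move/PE => h'; rewrite mem_filter h' mem_iota /= ltn_ord.
have Psep (i j : 'I_13) : P i -> P j -> j != i -> dot3 slant (pt13 i) != dot3 slant (pt13 j).
  move=> Pi Pj ne; have /allP/(_ (val j) (Ps j Pj)) := sep (val i) (Ps i Pi).
  by rewrite eq_sym (inj_eq val_inj) ne.
(* This is [slant] with the constant term that makes it vanish at the point [i]. *)
pose tau (i : 'I_13) := linp [:: 1; 2; 0; - dot3 slant (pt13 i)].
have tauE i j : (tau i).@[c13 j] = (dot3 slant (pt13 j) - dot3 slant (pt13 i))%:~R.
  by rewrite /tau linp_eval /aff3 /dot3 /=.
have cardP i : P i -> (\sum_(l | P l && (l != i)) 1 <= 1)%N.
  move=> Pi; have : (#|P| <= size s)%N.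
    rewrite cardE -(size_map val); apply: uniq_leq_size.
      by rewrite map_inj_uniq ?enum_uniq //; apply: val_inj.
    by move=> _ /mapP[l + ->]; rewrite mem_enum; apply: Ps.
  rewrite -sum1_card (bigD1 i) //= => h1.
  by rewrite -ltnS -add1n; apply: leq_trans size_s; apply: leq_trans h1.
exists 0%N => m d led; apply: jet_surj_curve => // i r Pi lt_rm.
exists (tau i), (\prod_(l | P l && (l != i)) tau l ^+ m); split.
- apply: (curve_param3 idJ Jh Jv (gh := h) (gk := v) (gt := slant)) => //.
  + by apply: linp_gradient; have /andP[/eqP] := PE i Pi.
  + by apply: linp_gradient; have /andP[_ /eqP] := PE i Pi.
  + have := @linp_gradient [:: 1; 2; 0; - dot3 slant (pt13 i)] (pt13 i).
    rewrite /aff3 /= => /(_ _) h1; have {}h1 := h1 (subrr _).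
    by move: h1; rewrite /has_gradient !big_ord_recl !big_ord0.
  + by rewrite -/(c13 i) tauE subrr.
- rewrite rmorph_prod; apply/prodf_neq0 => l /andP[Pl ne] /=.
  rewrite rmorphXn expf_neq0 //= tauE intr_eq0_char0 subr_eq0.
  by apply: Psep; rewrite // eq_sym.
- have h1 : deg_le (\sum_(l | P l && (l != i)) m) (\prod_(l | P l && (l != i)) tau l ^+ m).
    apply: deg_le_prod => l _.
    by have := deg_le_exp m (deg_linp [:: 1; 2; 0; - dot3 slant (pt13 l)]); rewrite mul1n.
  have := deg_leM (deg_le_exp r (deg_linp [:: 1; 2; 0; - dot3 slant (pt13 i)])) h1.
  apply: deg_leW; have -> : (\sum_(l | P l && (l != i)) m =
      (\sum_(l | P l && (l != i)) 1) * m)%N.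
    by rewrite big_distrl /=; apply: eq_bigr => l _; rewrite mul1n.
  by have := cardP i Pi; move: (\sum_(l | _) 1)%N => x; clear -led lt_rm; nia.
- move=> l Pl ne; apply: ord_geMr; apply: (ord_ge_prod1 (i := l)); first by rewrite Pl.
  have := ord_ge_exp (e := m) (proj2 (ord_ge1 (c13 l) (tau l)) _); rewrite mul1n; apply.
  by rewrite tauE subrr.
Qed.

Lemma pentagon_slope h vs (P : pred 'I_13) : good_pentagon h vs ->
  (forall i, P i -> on_plane h i) -> slope52 c13 (add_gen (@zero_ideal K 3) (linp h)) P.
Proof.
move=> /and3P[/eqP size_vs /allP lines /allP cover] PE.
have idJ : is_ideal (add_gen (@zero_ideal K 3) (linp h)) by apply/add_genP/zero_idealP.
apply: (slope52_cover (hs := [seq (linp v, 1%N) | v <- vs])) => //.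
- move=> _ /mapP[v hv ->]; split; first exact: deg_linp.
  apply: (@good_line_slope _ h v); rewrite ?lines //; first exact: add_genP.
  + exact/add_genl/add_genr/zero_idealP.
  + exact: add_genr.
  by move=> i /andP[Pi]; rewrite /= on_planeE PE.
- move=> i Pi; rewrite count_map /=; under eq_count do rewrite /= on_planeE.
  by have := cover (val i); rewrite PE //; apply; rewrite mem_iota /= ltn_ord.
- by rewrite big_map sum1_size size_vs.
Qed.

Lemma conic_slope h q (P : pred 'I_13) : good_conic h q ->
  (forall i, P i -> on_plane h i && on_conic q i) ->
  slope52 c13 (add_gen (add_gen (@zero_ideal K 3) (linp h)) (conicp q)) P.
Proof.
move=> /and3P[/eqP size_s /allP jac /allP inc] PE.
set s := [seq k <- _ | _] in size_s jac inc.
have uniq_s : uniq s by apply/filter_uniq/iota_uniq.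
have onS k : k \in s -> on_plane h k && on_conic q k by rewrite mem_filter => /andP[].
have id0 := zero_idealP K 3; have id1 := add_genP (linp h) id0.
apply: (@slope52_five _ _ _ c13 _ P _ val (fun k => pt_coords (pt13 k)) s
  (fun a b => linp (chord3 (pt13 a) (pt13 b)))) => //.
- exact: add_genP.
- exact: val_inj.
- by move=> i Pi; rewrite mem_filter PE // mem_iota /= ltn_ord.
- by move=> a b; apply: deg_linp.
- move=> a b x sa sb sx ne; rewrite linp_eval intr_eq0_char0.
  have /allP/(_ b sb) := inc a sa; rewrite ne /= => /allP/(_ x sx)/eqP <-.
  by [].
move=> a b sa sb ne; have /andP[/eqP ha /eqP qa] := onS a sa.
have /allP/(_ b sb) := jac a sa; rewrite ne /= => nz.
have ab0 : aff3 (chord3 (pt13 a) (pt13 b)) (pt13 a) = 0 by rewrite /aff3 /dot3 /=; ring.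
apply: (curve_param3 (gh := h) _ _ _ (linp_gradient ha) (conicp_gradient qa)
  (linp_gradient ab0)) => //.
- exact: add_genP.
- exact/add_genl/add_genr.
- exact: add_genr.
- by rewrite linp_eval ab0.
Qed.

Lemma plane6_slope (P : pred 'I_13) : (forall i, P i -> on_plane plane6 i) ->
  slope52 c13 (add_gen (@zero_ideal K 3) (linp plane6)) P.
Proof.
move=> PE; have id1 : is_ideal (add_gen (@zero_ideal K 3) (linp plane6)).
  exact/add_genP/zero_idealP.
have /andP[good_a good_b] := conics_good.
apply: (slope52_cover
  (hs := [:: (conicp conic_a, 2%N); (conicp conic_b, 2%N); (linp line6, 1%N)])) => //.
- move=> he; rewrite !inE => /or3P[] /eqP -> /=; split;
    try exact: deg_conicp; try exact: deg_linp.
  + by apply: conic_slope => // i /andP[Pi]; rewrite /= on_conicE PE.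
  + by apply: conic_slope => // i /andP[Pi]; rewrite /= on_conicE PE.
  + apply: (@good_line_slope _ plane6 line6); rewrite ?line6_good //; first exact: add_genP.
    * exact/add_genl/add_genr/zero_idealP.
    * exact: add_genr.
    by move=> i /andP[Pi]; rewrite /= on_planeE PE.
- move=> i Pi; rewrite /= !on_conicE on_planeE.
  have /allP/(_ (val i)) := plane6_cover; rewrite PE // mem_iota /= ltn_ord => /(_ isT).
  by rewrite addn0 addnA.
- by rewrite !big_cons big_nil.
Qed.

Theorem slope52_thirteen : exists C, forall s d, (5 * s + C <= 2 * d)%N ->
  jet_surj c13 (@zero_ideal K 3) (fun=> s) d.
Proof.
suff [C HC] : slope52 c13 (@zero_ideal K 3) xpredT by exists C.
have idJ := zero_idealP K 3.
apply: (slope52_cover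
  (hs := (linp plane6, 1%N) :: [seq (linp hv.1, 1%N) | hv <- planes5])) => //.
- move=> he; rewrite inE => /predU1P[->|/mapP[[h vs] hin ->]] /=; split; try exact: deg_linp.
    by apply: plane6_slope => i /= ; rewrite on_planeE.
  have /allP/(_ _ hin) := pentagons_good; move/pentagon_slope; apply => i /=.
  by rewrite on_planeE.
- move=> i _; rewrite /= on_planeE !on_planeE.
  have /allP/(_ (val i)) := planes_cover; rewrite mem_iota /= ltn_ord => /(_ isT).
  by [].
- by rewrite !big_cons big_nil.
Qed.

End ThirteenPoints.

(** * The containment for general points *)

Lemma card_bmultinom3 t : #|{: 'X_{1..3 < t.+1}}| = 'C(t + 3, 3).
Proof.
rewrite card_bmultinom; elim: t => [|t IH]; first by rewrite big_ord_recl big_ord0.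
rewrite big_ord_recr /= IH [in RHS]addSn binS; congr (_ + _)%N.
have <- := @bin_sub (t + 3) 2; last by lia.
by congr 'C(_, _); lia.
Qed.

Lemma bin3E t : (6 * 'C(t + 3, 3) = (t + 3) * (t + 2) * (t + 1))%N.
Proof. by have := bin_ffact (t + 3) 3; rewrite !ffactnS ffactn0 !factS fact0; lia. Qed.

(** For large [s], the strict inequality of leading coefficients absorbs the additive constant
    [C]. *)
Lemma square_slack A B C L : (L * B ^ 2 < A)%N -> exists s,
  (0 < s)%N /\ (L * (B * s + C) ^ 2 <= A * s ^ 2)%N.
Proof.
move=> lt_A; exists (L * (2 * B * C + C ^ 2)).+1; split=> //.
set x := (L * (2 * B * C + C ^ 2))%N; set s := x.+1.
have h1 : (L * (B * s + C) ^ 2 <= L * B ^ 2 * s ^ 2 + x * s)%N.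
  rewrite /x; have : (1 <= s)%N by []; move: s => s; nia.
have h2 : (L * B ^ 2 * s ^ 2 + s ^ 2 <= A * s ^ 2)%N by rewrite -mulSnr leq_mul2r lt_A orbT.
by apply: leq_trans h1 (leq_trans _ h2); rewrite leq_add2l /s; nia.
Qed.

Section Cases.
Variables (K : fieldType) (charK0 : [pchar K] =i pred0).

(** One linear inequality covers all orders [m], hence all [r] at once. *)
Definition degree_bound n (a : 'I_n -> 'I_3 -> K) L M : Prop :=
  forall f D m, f != 0 -> deg_le D f -> (forall j, ord_ge (a j) m f) -> (L * m <= M * D)%N.

(* [beta = b / q] *)
Lemma generic_bound n N0 q b C L M : (N0 <= n)%N -> (0 < C)%N ->
  (L * b ^ 2 < N0 * q ^ 2 * M)%N ->
  (forall s, exists c : 'I_N0 -> 'I_3 -> K,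
     jet_surj c (@zero_ideal K 3) (fun=> (q * s).+1) (b * s + C)) ->
  generic (fun a : 'I_n -> 'I_3 -> K => degree_bound a L M).
Proof.
move=> leN C_gt0 slack jets.
have [s [s_gt0 Hs]] := square_slack C slack.
have inj : injective (widen_ord leN) by move=> i j /(congr1 val) /= /val_inj.
apply: genericW (generic_jets inj (jets s)) => a Ha f D m nzf df Hf.
have d_gt0 : (0 < b * s + C)%N by lia.
have := jet_surj_bezout d_gt0 Ha nzf df (fun x => Hf (widen_ord leN x)).
rewrite card_ord; move: Hs; rewrite leqNgt.
set d := (b * s + C)%N in d_gt0 * => Hs h; rewrite leqNgt; apply/negP => lt_m.
have h1 : (M * D * d ^ 2 < L * m * d ^ 2)%N by rewrite ltn_pmul2r // expn_gt0 d_gt0.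
by move: h1 h Hs; rewrite expnMn; move: (d ^ 2)%N (s ^ 2)%N (q ^ 2)%N => x y z; nia.
Qed.

Lemma generic_bound_grid n N0 b L M : (N0 <= n)%N -> (0 < b)%N -> (N0 <= b ^ 3)%N ->
  (L * b ^ 2 < N0 * M)%N ->
  generic (fun a : 'I_n -> 'I_3 -> K => degree_bound a L M).
Proof.
move=> leN b_gt0 leb slack; apply: (@generic_bound n N0 1 b (3 * b)) => //; try lia.
move=> s; have [c Hc] := grid_jets_card charK0 s leb.
by exists c; rewrite mul1n.
Qed.

(** The numbers are [52 = 13 * 2 ^ 2] and [25 = 5 ^ 2]. The constant [C + 5] pays for jets of order
    [2 * s + 1] instead of [2 * s]. *)
Lemma generic_bound13 n L M : (13 <= n)%N -> (L * 25 < 52 * M)%N ->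
  generic (fun a : 'I_n -> 'I_3 -> K => degree_bound a L M).
Proof.
move=> le_n slack; have [C HC] := slope52_thirteen charK0.
apply: (@generic_bound n 13 2 5 (C + 5)) => //; try lia.
by move=> s; exists (c13 K); apply: HC; lia.
Qed.

Definition contained n (a : 'I_n -> 'I_3 -> K) : Prop :=
  forall p : 'I_n -> proj_point K 3, (forall j, has_affine_coords (p j) (a j)) ->
  forall r, subideal (symbolic_power p (3 * r))
    (ideal_mul (ideal_pow (@irrelevant_ideal K 3) (2 * r)) (ideal_pow (points_ideal p) r)).

Lemma bound_contained n (a : 'I_n -> 'I_3 -> K) t :
  jet_surj a (@zero_ideal K 3) (fun=> 1%N) t -> degree_bound a (t + 3) 3 -> contained a.
Proof.
move=> interp bound p Hp r.
apply: (symbolic_containment Hp interp (delta := 0)) => // [u Hu|f D nzf df Hf].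
  rewrite -[homogenize _ _]mul1r; apply: ideal_mul_mem => //; rewrite -[homogenize _ _]mulr1.
  by apply: ideal_mul_mem => //; apply: points_ideal_homogenize Hu.
by have := bound f D _ nzf df Hf; lia.
Qed.

(** Generation in degree [t] gives [delta = 1]: each element of [I] of degree [t.+1] contributes one
    linear factor. *)
Lemma generated_contained n (a : 'I_n -> 'I_3 -> K) t :
  linearly_generated a t -> degree_bound a (t + 2) 3 -> contained a.
Proof.
move=> [interp gen] bound p Hp r.
apply: (symbolic_containment Hp interp (delta := 1)) => // [u /gen|f D nzf df Hf].
  move: u; apply: powspan1_ind => [|f g Hf Hg|u w Iu dw].
  - by rewrite homogenize0; apply: ideal_mul0.
  - by rewrite homogenizeD; apply: ideal_mulD.
  have du : deg_le t u by case: Iu.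
  rewrite -(addn1 t) homogenizeM // mulrC; apply: ideal_mul_mem.
    exact/irrelevant_homog/homogenizeP.
  rewrite -[homogenize _ _]mulr1; apply: ideal_mul_mem => //.
  exact: points_ideal_homogenize Iu.
by have := bound f D _ nzf df Hf; lia.
Qed.

Lemma generic_bound_contained n t : (n <= 'C(t + 3, 3))%N ->
  generic (fun a : 'I_n -> 'I_3 -> K => degree_bound a (t + 3) 3) ->
  generic (@contained n).
Proof.
move=> le_n Hb; have card_n : (#|'I_n| <= #|{: 'X_{1..3 < t.+1}}|)%N.
  by rewrite card_ord card_bmultinom3.
have := genericI (generic_interp charK0 (@inj_id 'I_n) card_n) Hb.
by apply: genericW => a [interp bound]; apply: bound_contained bound.
Qed.

(** Here [t] is the degree in which the first ['C(t + 3, 3)] points are unisolvent. Generation takes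
    place in degree [t.+1], so the threshold of [generated_contained] reads [t + 3]. *)
Lemma generic_generated_contained n t : (n <= 'C(t + 4, 3))%N ->
  n = ('C(t + 3, 3) + 1)%N \/ n = ('C(t + 3, 3) + 2)%N -> (1 < 'C(t + 3, 3))%N ->
  generic (fun a : 'I_n -> 'I_3 -> K => degree_bound a (t + 3) 3) ->
  generic (@contained n).
Proof.
move=> le_n en lt1 Hb.
have Hg : generic (fun a : 'I_n -> 'I_3 -> K => linearly_generated a t.+1).
  have c1 : #|{: 'X_{1..3 < 2}}| = 4 by rewrite card_bmultinom3.
  have c2 : #|{: 'X_{1..3 < t.+2}}| = 'C(t + 4, 3) by rewrite card_bmultinom3 addSnnS.
  case: en => en; rewrite en in le_n Hb *.
    by apply: generic_generation1; rewrite ?c1 ?c2 ?card_bmultinom3.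
  by apply: generic_generation2; rewrite ?c1 ?c2 ?card_bmultinom3.
have := genericI Hg Hb; apply: genericW => a [gen bound].
by apply: (generated_contained gen); rewrite addSnnS.
Qed.

Lemma generic_contained_few n : (0 < n <= 4)%N -> generic (@contained n).
Proof.
move=> le_n; have card_n : (#|'I_n| <= #|{: 'X_{1..3 < 2}}|)%N.
  by rewrite card_ord card_bmultinom3; case/andP: le_n.
apply: genericW (generic_interp charK0 (@inj_id 'I_n) card_n) => a interp p Hp r.
by apply: (few_points_containment Hp interp) => //; case/andP: le_n.
Qed.

Lemma generic_bound_simplex n : (4 <= n)%N ->
  generic (fun a : 'I_n -> 'I_3 -> K => degree_bound a 4 3).
Proof.
move=> le_n; have inj : injective (widen_ord le_n) by move=> i j /(congr1 val) /= /val_inj.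
have card4 : (#|'I_4| <= #|{: 'X_{1..3 < 2}}|)%N by rewrite card_ord card_bmultinom3.
apply: genericW (generic_interp charK0 inj card4) => a interp f D m nzf df Hf.
by apply: (simplex_bound interp nzf df) => j; apply: Hf.
Qed.

(** If [b ^ 3 <= n], the claim is [t + 3 < 3 * b]. Otherwise it is reduced to
    [(t + 3) * (t + 6) ^ 2 < 27 * n], which is tight at [t = 5], [n = 36]: 968 against 972. With
    [n = 35] it would fail, so the strict lower bound on [n] matters. *)
Lemma grid_arith t n b : (5 <= t)%N -> ('C(t + 2, 3) < n)%N ->
  (t + 4 <= 3 * b <= t + 6)%N -> ((t + 3) * b ^ 2 < minn n (b ^ 3) * 3)%N.
Proof.
move=> le5 lt_n /andP[b2 b1]; move: lt_n.
have := bin3E (t - 1); rewrite (_ : t - 1 + 3 = t + 2)%N; last by lia.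
move: 'C(_, _) => y Ey lt_n.
rewrite /minn; case: ifP => _; last by nia.
suff h : (3 * ((t + 3) * (3 * b) ^ 2) < 3 * (27 * n))%N by nia.
have h1 : ((3 * b) ^ 2 <= (t + 6) ^ 2)%N by rewrite leq_sqr.
apply: (@leq_ltn_trans (3 * ((t + 3) * (t + 6) ^ 2))%N).
  by rewrite !leq_mul2l h1 !orbT.
have [x tx] : exists x, t = (5 + x)%N by exists (t - 5)%N; lia.
move: Ey; rewrite tx; nia.
Qed.

(** The required value of [N / beta ^ 2] and the one available are, for [n] in 5..6: 4/3 and 4/3
    (the simplex bound is exact and needs no slack); 7..10: 5/3 and 7/4; 11..12: 5/3 and 2; 13..20:
    2 and 52/25; 21: 2 and 21/9; 22..35: 7/3 and 22/9. The improved thresholds for 5, 6, 11, 12 and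
    21 points come from generation in lower degree. *)
Lemma generic_contained n : (0 < n)%N -> generic (@contained n).
Proof.
move=> n_gt0; have [le4|gt4] := leqP n 4; first by apply: generic_contained_few; rewrite n_gt0.
have [le6|gt6] := leqP n 6.
  apply: (@generic_generated_contained n 1) => //; first exact: leq_trans le6 _.
    by have -> : 'C(1 + 3, 3) = 4 by []; lia.
  exact: generic_bound_simplex (ltnW gt4).
have [le10|gt10] := leqP n 10.
  by apply: (@generic_bound_contained n 2) => //; apply: (@generic_bound_grid n 7 2).
have [le12|gt12] := leqP n 12.
  apply: (@generic_generated_contained n 2) => //.
  - exact: leq_trans le12 _.
  - by have -> : 'C(2 + 3, 3) = 10 by []; lia.
  by apply: (@generic_bound_grid n 8 2) => //; lia.
have [le20|gt20] := leqP n 20.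
  by apply: (@generic_bound_contained n 3) => //; apply: generic_bound13.
have [le21|gt21] := leqP n 21.
  have -> : n = 21 by lia.
  apply: (@generic_generated_contained 21 3) => //; first by left.
  exact: (@generic_bound_grid 21 21 3).
have [le35|gt35] := leqP n 35.
  by apply: (@generic_bound_contained n 4) => //; apply: (@generic_bound_grid n 22 3).
have ex_t : exists t, (n <= 'C(t + 3, 3))%N.
  exists n; have := bin3E n; nia.
case: (ex_minnP ex_t) => t le_n min_t.
have le5 : (5 <= t)%N.
  rewrite ltnNge; apply/negP => le4; move: gt35 le_n.
  by case: t le4 {min_t} => [|[|[|[|[|//]]]]] _ h1 h2; move: (leq_trans h1 h2).
have lt_n : ('C(t + 2, 3) < n)%N.
  rewrite ltnNge; apply/negP => le_n'; have := min_t (t - 1)%N.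
  by rewrite (_ : t - 1 + 3 = t + 2)%N ?le_n'; [move=> /(_ isT); lia | lia].
apply: (generic_bound_contained le_n).
(* The side [t %/ 3 + 2] is the least [b] with [t + 3 < 3 * b], the condition for a full grid. *)
apply: (@generic_bound_grid n (minn n ((t %/ 3 + 2) ^ 3)) (t %/ 3 + 2)).
- exact: geq_minl.
- by lia.
- exact: geq_minr.
- apply: grid_arith => //; lia.
Qed.

End Cases.

Theorem theorem3 (K : fieldType) (charK0 : [pchar K] =i pred0)
    (n : nat) (n_gt0 : (1 <= n)%N) :
  in_general_position (fun p : 'I_n -> proj_point K 3 =>
    forall r : nat, (1 <= r)%N ->
      subideal (symbolic_power p (3 * r))
               (ideal_mul (ideal_pow (@irrelevant_ideal K 3) (2 * r))
                          (ideal_pow (points_ideal p) r))).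
Proof.
apply: (generic_general charK0 (generic_contained charK0 n_gt0)) => p a Hp Ha r _.
exact: Ha.
Qed.
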